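(* Let $\Bbbk$ be an algebraically closed field of characteristic $p>2$ and $n\ge2$. Let $\bar Y_n^>(\Bbbk):=\mathbf{Y}_n^>\otimes_{\mathbb{Z}[\frac12]}\Bbbk$ (via the natural map $\mathbb{Z}[\frac12]\to\Bbbk$), write $\bar a=a\otimes1$, and let $\bar y_n^>(\Bbbk)$ (the small Yangian) be the $\Bbbk$-subalgebra of $\bar Y_n^>(\Bbbk)$ generated by the elements $\overline{e_\beta(r)^t/t!}$ for $\beta\in\Delta^+$, $r\in\mathbb{N}$, $0\le t\le p-1$. Then the elements $\bar E_h=E_h\otimes1$, with $h$ ranging over $p$-restricted finitely supported functions $h:\Delta^+\times\mathbb{N}\to\mathbb{N}$, form a $\Bbbk$-basis of $\bar y_n^>(\Bbbk)$.
   Context: $\mathbb{N}=\{0,1,\dots\}$, $I=\{1,\dots,n-1\}$, $(c_{ij})$ the Cartan matrix of $\mathfrak{sl}_n$. $Y_n^>$ is the $\mathbb{C}$-algebra generated by $e_{i,r}$ ($i\in I,r\in\mathbb{N}$) with relations $[e_{i,r+1},e_{j,s}]-[e_{i,r},e_{j,s+1}]=\frac{c_{ij}}{2}(e_{i,r}e_{j,s}+e_{j,s}e_{i,r})$; $[e_{i,r},e_{j,s}]=0$ if $c_{ij}=0$; $[e_{i,r_1},[e_{i,r_2},e_{j,s}]]+[e_{i,r_2},[e_{i,r_1},e_{j,s}]]=0$ if $c_{ij}=-1$. $\mathbf{Y}_n^>$ is its $\mathbb{Z}[\frac12]$-subalgebra generated by $e_{i,r}^t/t!$ ($t\in\mathbb{N}$);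 the elements $e_\beta(r)^t/t!$ lie in $\mathbf{Y}_n^>$. $\Delta^+=\{[i,j]:1\le i\le j\le n-1\}$, $e_\beta(r)=[\cdots[e_{i,r},e_{i+1,0}],\dots,e_{j,0}]$ for $\beta=[i,j]$. Order: $[i,j]\le[i',j']$ iff $i<i'$ or ($i=i'$, $j\le j'$); $(\beta,r)\le(\beta',r')$ iff $\beta<\beta'$ or ($\beta=\beta'$, $r\ge r'$). $E_h=\prod^{\rightarrow}_{(\beta,r)}e_\beta(r)^{h(\beta,r)}\in\mathbf{Y}_n^>$, product in increasing order. $h$ is $p$-restricted if $h(\beta,r)<p$ for all $(\beta,r)$. *)

(* Defs.v *)
From Stdlib Require List.
From HB Require Import structures.
From mathcomp Require Import all_boot all_order all_algebra.
From mathcomp Require Import reals complex.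
From mathcomp Require Import finmap.
Set Implicit Arguments. Unset Strict Implicit. Unset Printing Implicit Defensive.
Import Order.TTheory GRing.Theory Num.Theory.
Local Open Scope ring_scope.

(* Free associative algebra K<e_{i,r}> on letters g = (i, r) : nat * nat.     *)
(* An element is represented by a formal finite sum of (coefficient, word);   *)
(* two formal sums denote the same element of the free algebra iff they have  *)
(* the same coefficient [fcoef] at every word.                                *)
Definition letter := (nat * nat)%type.
Definition word := seq letter.
Definition fsum (K : Type) := seq (K * word).

Section FreeAlg.
Variable K : nzRingType.
Implicit Types x y : fsum K.

Definition fcoef x (w : word) : K := \sum_(cw <- x | cw.2 == w) cw.1.
Definition fadd x y : fsum K := x ++ y.
Definition fscale (c : K) x : fsum K := [seq (c * cw.1, cw.2) | cw <- x].
Definition fsub x y : fsum K := fadd x (fscale (-1) y).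
Definition fmul x y : fsum K := [seq (a.1 * b.1, a.2 ++ b.2) | a <- x, b <- y].
Definition fone : fsum K := [:: (1, [::])].
Definition fgen (g : letter) : fsum K := [:: (1, [:: g])].
Definition fcomm x y : fsum K := fsub (fmul x y) (fmul y x).
Definition fpow x (t : nat) : fsum K := iter t (fmul x) fone.
Definition fprod (l : seq (fsum K)) : fsum K := foldr fmul fone l.
Definition fsuml (l : seq (fsum K)) : fsum K := flatten l.
End FreeAlg.

(* The Yangian Y_n^> over C = R[i] (R a real closed complete field = the     *)
(* reals), as the free algebra on e_{i,r} (i in I = {1..n-1}, r in N) modulo  *)
(* the two-sided ideal generated by the defining relations.                  *)
Definition inI (n i : nat) : bool := (1 <= i <= n.-1)%N.
Definition valid_word (n : nat) (w : word) : bool := all (fun g => inI n g.1) w.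
Definition valid_fsum (K : Type) (n : nat) (x : fsum K) : bool :=
  all (fun cw => valid_word n cw.2) x.

Definition cartan (i j : nat) : int :=
  if i == j then 2%Z else if (i == j.+1) || (j == i.+1) then (-1)%Z else 0%Z.

Section Yangian.
Variable R : realType.
Notation C := (complex R).

Definition ye (i r : nat) : fsum C := fgen C (i, r).

Definition yrel (n : nat) (x : fsum C) : Prop :=
  (exists i j r s, inI n i /\ inI n j /\
     x = fsub (fsub (fcomm (ye i r.+1) (ye j s)) (fcomm (ye i r) (ye j s.+1)))
              (fscale ((cartan i j)%:~R / 2%:R)
                      (fadd (fmul (ye i r) (ye j s)) (fmul (ye j s) (ye i r)))))
  \/ (exists i j r s, inI n i /\ inI n j /\ cartan i j = 0 /\
     x = fcomm (ye i r) (ye j s))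
  \/ (exists i j r1 r2 s, inI n i /\ inI n j /\ cartan i j = (-1)%Z /\
     x = fadd (fcomm (ye i r1) (fcomm (ye i r2) (ye j s)))
              (fcomm (ye i r2) (fcomm (ye i r1) (ye j s)))).

Definition in_yideal (n : nat) (x : fsum C) : Prop :=
  exists l : seq (fsum C * fsum C * fsum C),
    (forall t, List.In t l -> valid_fsum n t.1.1 /\ yrel n t.1.2 /\ valid_fsum n t.2) /\
    forall w, fcoef x w = fcoef (fsuml [seq fmul (fmul t.1.1 t.1.2) t.2 | t <- l]) w.

Definition yeq (n : nat) (x y : fsum C) : Prop := in_yideal n (fsub x y).

(* elements a/2^m of Z[1/2], encoded by (a, m), mapped into any unit ring *)
Definition zhalf (F : unitRingType) (q : int * nat) : F := q.1%:~R / (2%:R ^+ q.2).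

Definition ydp (i r t : nat) : fsum C := fscale (t`!%:R)^-1 (fpow (ye i r) t).

(* membership in the Z[1/2]-subalgebra bfY_n^> of Y_n^> generated by the
   e_{i,r}^t/t! : Z[1/2]-linear combinations of finite products of them *)
Definition in_bfY (n : nat) (y : fsum C) : Prop :=
  exists l : seq ((int * nat) * seq (nat * nat * nat)),
    (forall t, List.In t l -> forall g, List.In g t.2 -> inI n g.1.1) /\
    yeq n y (fsuml [seq fscale (zhalf C t.1)
                          (fprod [seq ydp g.1.1 g.1.2 g.2 | g <- t.2]) | t <- l]).

Definition ebeta (i j r : nat) : fsum C :=
  foldl (fun acc l => fcomm acc (ye l 0)) (ye i r) (iota i.+1 (j - i)).

Definition ebeta_dp (i j r t : nat) : fsum C :=
  fscale (t`!%:R)^-1 (fpow (ebeta i j r) t).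

Definition inDelta (n i j : nat) : bool := (1 <= i <= j)%N && (j <= n.-1)%N.

(* keys ((i,j), r) for (beta, r); the order of the paper:
   (beta,r) <= (beta',r') iff beta < beta' or (beta = beta' and r >= r'),
   [i,j] <= [i',j'] iff i < i' or (i = i' and j <= j') *)
Definition key := (nat * nat * nat)%type.
Definition keyle (a b : key) : bool :=
  let: (i, j, r) := a in let: (i', j', r') := b in
  (i < i')%N || ((i == i') && ((j < j')%N || ((j == j') && (r' <= r)%N))).

Definition hfun := {fsfun key -> nat with 0%N}.
Definition h_dom (n : nat) (h : hfun) : Prop :=
  forall a : key, a \in finsupp h -> inDelta n a.1.1 a.1.2.
Definition p_restricted (p : nat) (h : hfun) : Prop := forall a : key, (h a < p)%N.

Definition Eh (h : hfun) : fsum C :=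
  fprod [seq fpow (ebeta a.1.1 a.1.2 a.2) (h a) | a <- sort keyle (enum_fset (finsupp h))].

(* The base change bar Y_n^>(k) = bfY_n^> (x)_{Z[1/2]} k: the free k-module  *)
(* on the elements of bfY_n^> modulo the relations making the map bilinear.  *)
(* Elements are formal k-combinations sum c_l [y_l] (= sum y_l (x) c_l);     *)
(* keys are compared through their representatives in the free algebra, and *)
(* the relation [y] = [y'] for y = y' in Y_n^> is among the generators.      *)
Section Tensor.
Variable k : fieldType.
Definition tsum := seq (k * fsum C).

Definition tcoef (x : tsum) (y : fsum C) : k := \sum_(cy <- x | cy.2 == y) cy.1.
Definition tsub (x x' : tsum) : tsum := x ++ [seq (- u.1, u.2) | u <- x'].

Definition tgen (n : nat) (g : tsum) : Prop :=
  (exists y y', in_bfY n y /\ in_bfY n y' /\ yeq n y y' /\ g = [:: (1, y); (-1, y')])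
  \/ (exists y y', in_bfY n y /\ in_bfY n y' /\
        g = [:: (1, fadd y y'); (-1, y); (-1, y')])
  \/ (exists (q : int * nat) y, in_bfY n y /\
        g = [:: (1, fscale (zhalf C q) y); (- zhalf k q, y)]).

Definition tzero (n : nat) (x : tsum) : Prop :=
  exists l : seq (k * tsum),
    (forall t, List.In t l -> tgen n t.2) /\
    forall y, tcoef x y = tcoef (flatten [seq [seq (t.1 * u.1, u.2) | u <- t.2] | t <- l]) y.

Definition teq (n : nat) (x x' : tsum) : Prop := tzero n (tsub x x').

Definition tbar (y : fsum C) : tsum := [:: (1, y)].

(* membership in the small Yangian bar y_n^>(k): the k-subalgebra generated by
   the bar(e_beta(r)^t/t!), beta in Delta^+, r in N, 0 <= t <= p-1, i.e. the
   k-span of finite products of these generators; the product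
   (y (x) 1)(y' (x) 1) is yy' (x) 1 *)
Definition in_smallY (n p : nat) (x : tsum) : Prop :=
  exists l : seq (k * seq (nat * nat * nat * nat)),
    (forall t, List.In t l -> forall g, List.In g t.2 ->
       inDelta n g.1.1.1 g.1.1.2 /\ (g.2 <= p.-1)%N) /\
    teq n x [seq (t.1, fprod [seq ebeta_dp g.1.1.1 g.1.1.2 g.1.2 g.2 | g <- t.2]) | t <- l].

Definition Ecomb (l : seq (k * hfun)) : tsum := [seq (t.1, Eh t.2) | t <- l].
End Tensor.
End Yangian.

(* Main.v *)
(* Modulo terms of lower degree in r, the elements e_beta(r) satisfy the relations of the loop algebra
   of strictly upper triangular matrices, so any product of them straightens to a Z[1/2]-combination of
   the E_h; if h is not p-restricted, E_h is p! times an element of bfY and dies in the base change.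

   For independence one maps words to symmetrized products: e_{i,r} goes to x^r in a shuffle algebra of
   functions on finite coloured sets of points, normalized so that no denominators occur.  There
   e_{i,r}^t/t! has integral values, whence a well-defined functional on the base change with values
   over k.  The image of e_beta(r) is, up to a unit, the sum of x_i^r over chains with one point of each
   colour in beta.  Given a relation among the E_h, choose h0 with maximal (sum of the r, number of
   factors), take one chain of points for each factor of h0, all points of the chain c being equal to
   T * eta_c, and read off the leading coefficient in T: only bijections from factors to chains
   contribute, and the coefficient of the monomial of h0 in the eta_c is the product of the h0(a)!,
   nonzero in k as h0 is p-restricted. *)
Require Import Defs.
From Stdlib Require List.
From HB Require Import structures.
From mathcomp Require Import all_boot all_order all_algebra.
From mathcomp Require Import reals complex boolp.
From mathcomp Require Import finmap.
From mathcomp Require Import zify ring.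
(* [finmap] shadows [fsub] *)
Import Defs.
Set Implicit Arguments.
Unset Strict Implicit.
Unset Printing Implicit Defensive.
Import Order.TTheory GRing.Theory Num.Theory.
Local Open Scope ring_scope.

(** * The Yangian modulo lower degree *)

(** Division by t! is the obstacle: over k a divided power is not determined by the power. The
    functional is therefore computed in an integral model, the normalized shuffle product over
    Z[eta][T], which embeds over C and reduces over k. There the t-th power of a one-colour
    generator is t! times an explicit function, a monomial times a discriminant; the factor t! is an
    interpolation identity. So bfY becomes integral up to powers of 2, and the embedding over C
    makes the reduction depend only on the class in Y.

    Leading terms separate for the following reason. When a point set is cut into the supports of
    the factors, the T-degree of the zeta factors is the total weight of all pairs minus the weight
    inside the supports. Top degree thus forces each support into a single chain, and fewer factors
    than chains cannot use up all points; hence the number of factors as second criterion in the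
    choice of h0.

    For e_beta(r)^t/t! to lie in bfY, relations modulo lower degree are too weak, since error terms
    would be divided by t! as well. Two Serre-type relations are proved exactly, and a Heisenberg
    ordering formula is solved for the divided power. *)

Section Commutator.
Variable A : pzRingType.
Implicit Types x y z : A.

Definition br x y := x * y - y * x.

Lemma brDl x y z : br (x + y) z = br x z + br y z.
Proof. by rewrite /br mulrDl mulrDr opprD addrACA. Qed.
Lemma brDr x y z : br x (y + z) = br x y + br x z.
Proof. by rewrite /br mulrDl mulrDr opprD addrACA. Qed.
Lemma brNl x y : br (- x) y = - br x y.
Proof. by rewrite /br mulNr mulrN opprB opprK addrC. Qed.
Lemma brNr x y : br x (- y) = - br x y.
Proof. by rewrite /br mulNr mulrN opprB opprK addrC. Qed.
Lemma brBl x y z : br (x - y) z = br x z - br y z.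
Proof. by rewrite brDl brNl. Qed.
Lemma brBr x y z : br x (y - z) = br x y - br x z.
Proof. by rewrite brDr brNr. Qed.
Lemma br0l x : br 0 x = 0. Proof. by rewrite /br mul0r mulr0 subr0. Qed.
Lemma br0r x : br x 0 = 0. Proof. by rewrite /br mul0r mulr0 subr0. Qed.
Lemma brC x y : br x y = - br y x. Proof. by rewrite /br opprB. Qed.

Lemma jacobi x y z : br x (br y z) = br (br x y) z + br y (br x z).
Proof.
rewrite /br !mulrBl !mulrBr !mulrA !opprB !addrA.
by rewrite [RHS](ACl (1*8*3*6*2*5*4*7)) /= !subrK.
Qed.

Lemma jacobil x y z : br (br x y) z = br x (br y z) - br y (br x z).
Proof. by rewrite jacobi addrK. Qed.

(** Jacobi applied in two ways to [[a,b],[c,b]]; the mixed terms combine because [a,c] = 0 gives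
    [a,[c,b]] = [c,[a,b]]. The right-hand side only has double commutators with [b], within reach of
    Serre relations, and the factor 2 is later removed by [h]. *)
Lemma br_double a b c : br a c = 0 ->
  br (br a b) (br c b) + br (br a b) (br c b) =
  br a (br b (br c b)) - br c (br b (br a b)).
Proof.
move=> ac; set P := br a b; set Q := br c b.
have aQ : br a Q = br c P by rewrite /Q jacobi ac br0l add0r.
have bcP : br b (br c P) = br P Q + br c (br b P).
  by rewrite jacobi -/Q (brC b c) -/Q brNl brC opprK.
have PQ : br P Q = br a (br b Q) - br P Q - br c (br b P).
  by rewrite -addrA -opprD -bcP -aQ -jacobil.
by rewrite {1}PQ addrAC subrK.
Qed.
End Commutator.

Lemma ltn_ind_from (P : nat -> Prop) (a : nat) :
  P a.+1 -> (forall b, (a < b)%N -> P b -> P b.+1) -> forall b, (a < b)%N -> P b.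
Proof.
move=> P0 PS; elim=> [//|b IH]; rewrite ltnS leq_eqVlt => /orP[/eqP<- //|ab].
by apply: PS => //; apply: IH.
Qed.

Section AbstractYangian.
Variables (A : pzRingType) (n : nat) (e : nat -> nat -> A) (h : A).
Hypothesis hC : forall x, h * x = x * h.
Hypothesis h2 : h + h = 1.
Hypothesis rel1 : forall i j r s, inI n i -> inI n j ->
  br (e i r.+1) (e j s) - br (e i r) (e j s.+1)
  = h * (cartan i j)%:~R * (e i r * e j s + e j s * e i r).
Hypothesis rel2 : forall i j r s, inI n i -> inI n j -> cartan i j = 0 ->
  br (e i r) (e j s) = 0.
Hypothesis rel3 : forall i j r1 r2 s, inI n i -> inI n j -> cartan i j = (-1)%Z ->
  br (e i r1) (br (e i r2) (e j s)) + br (e i r2) (br (e i r1) (e j s)) = 0.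

Definition wprod (w : word) : A := \prod_(g <- w) e g.1 g.2.
Definition wdeg (w : word) : nat := \sum_(g <- w) g.2.

Lemma wprod_cat u v : wprod (u ++ v) = wprod u * wprod v.
Proof. by rewrite /wprod big_cat. Qed.
Lemma wdeg_cat u v : wdeg (u ++ v) = (wdeg u + wdeg v)%N.
Proof. by rewrite /wdeg big_cat. Qed.

(* [filt d] is the Z[1/2]-span of the words of degree < d; [h] plays the role of 1/2. *)
Inductive filt (d : nat) : A -> Prop :=
| filt0 : filt d 0
| filtD x y : filt d x -> filt d y -> filt d (x + y)
| filtN x : filt d x -> filt d (- x)
| filt_half x : filt d x -> filt d (h * x)
| filt_word w : valid_word n w -> (wdeg w < d)%N -> filt d (wprod w).

Lemma filtB d x y : filt d x -> filt d y -> filt d (x - y).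
Proof. by move=> Fx Fy; apply: filtD => //; apply: filtN. Qed.

Lemma filtMn d x m : filt d x -> filt d (x *+ m).
Proof. by move=> Fx; elim: m => [|m IH]; rewrite ?mulr0n ?mulrS; [exact: filt0|exact: filtD]. Qed.

Lemma filtMz d x (m : int) : filt d x -> filt d (m%:~R * x).
Proof.
case: m => m Fx; first by rewrite mulr_natl; apply: filtMn.
by rewrite NegzE mulrNz mulNr; apply: filtN; rewrite mulr_natl; apply: filtMn.
Qed.

Lemma filt_double d x : filt d (x + x) -> filt d x.
Proof. by move=> /filt_half; rewrite mulrDr -mulrDl h2 mul1r. Qed.

Lemma filt_le d d' x : (d <= d')%N -> filt d x -> filt d' x.
Proof.
move=> le; elim=> {x} [|x y _ Fx _ Fy|x _ Fx|x _ Fx|w Vw dw].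
- exact: filt0.
- exact: filtD.
- exact: filtN.
- exact: filt_half.
- by apply: filt_word => //; apply: leq_trans le.
Qed.

(** Both bounds are strict, so the degrees add up to at most a + b - 2. *)
Lemma filtM a b x y : filt a x -> filt b y -> filt (a + b).-1 (x * y).
Proof.
move=> Fx Fy; elim: Fx => {x} [|x x' _ Fx _ Fx'|x _ Fx|x _ Fx|w Vw dw].
- by rewrite mul0r; apply: filt0.
- by rewrite mulrDl; apply: filtD.
- by rewrite mulNr; apply: filtN.
- by rewrite -mulrA; apply: filt_half.
elim: Fy => {y} [|x x' _ Fx _ Fx'|x _ Fx|x _ Fx|w' Vw' dw'].
- by rewrite mulr0; apply: filt0.
- by rewrite mulrDr; apply: filtD.
- by rewrite mulrN; apply: filtN.
- by rewrite mulrA -hC -mulrA; apply: filt_half.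
- rewrite -wprod_cat; apply: filt_word; first by rewrite /valid_word all_cat; apply/andP.
  by rewrite wdeg_cat; lia.
Qed.

Lemma filt_brl a b x y : filt a.+1 x -> filt b y -> filt (a + b) (br x y).
Proof.
move=> Fx Fy; rewrite -[(a + b)%N]/((a.+1 + b).-1)%N.
by apply: filtB; [|rewrite addnC]; apply: filtM.
Qed.
Lemma filt_brr a b x y : filt a x -> filt b.+1 y -> filt (a + b) (br x y).
Proof. by move=> Fx Fy; rewrite brC addnC; apply/filtN/filt_brl. Qed.

(** With [d] the common degree of both sides this is equality in the associated graded ring, where
    the loop algebra relations hold. *)
Definition eqf d x y := filt d (x - y).

Lemma eqf_refl d x : eqf d x x. Proof. by rewrite /eqf subrr; apply: filt0. Qed.
Lemma eqf_sym d x y : eqf d x y -> eqf d y x.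
Proof. by rewrite /eqf => /filtN; rewrite opprB. Qed.
Lemma eqf_trans d y x z : eqf d x y -> eqf d y z -> eqf d x z.
Proof. by rewrite /eqf => Fx Fy; rewrite -[x](subrK y) -addrA; apply: filtD. Qed.
Lemma eqfD d x y x' y' : eqf d x y -> eqf d x' y' -> eqf d (x + x') (y + y').
Proof. by rewrite /eqf opprD addrACA; apply: filtD. Qed.
Lemma eqfN d x y : eqf d x y -> eqf d (- x) (- y).
Proof. by rewrite /eqf => /filtN; rewrite opprB opprK addrC. Qed.
Lemma eqf_brl a b d x x' y : (a + b)%N = d -> filt b.+1 y ->
  eqf a x x' -> eqf d (br x y) (br x' y).
Proof. by move=> <- Fy Cx; rewrite /eqf -brBl; apply: filt_brr. Qed.
Lemma eqf_brr a b d x y y' : (a + b)%N = d -> filt a.+1 x ->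
  eqf b y y' -> eqf d (br x y) (br x y').
Proof. by move=> <- Fy Cx; rewrite /eqf -brBr; apply: filt_brl. Qed.

Lemma filt_e i r : inI n i -> filt r.+1 (e i r).
Proof.
move=> Ii; rewrite (_ : e i r = wprod [:: (i, r)]); last by rewrite /wprod big_seq1.
by apply: filt_word; rewrite /valid_word /= ?Ii // /wdeg big_seq1.
Qed.

(* [rootv a b r] is e_beta(r) for beta = [a, b - 1], so that its commutators follow those of the
   matrix units E_ab of gl_n. *)
Definition ebr i m r : A := foldl (fun acc l => br acc (e l 0)) (e i r) (iota i.+1 m).
Definition rootv a b r := ebr a (b - a.+1) r.

Lemma rootv1 a r : rootv a a.+1 r = e a r. Proof. by rewrite /rootv subnn. Qed.
Lemma rootvS a b r : (a < b)%N -> rootv a b.+1 r = br (rootv a b r) (e b 0).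
Proof.
move=> ab; rewrite /rootv /ebr subSS (_ : (b - a)%N = (b - a.+1).+1); last lia.
by rewrite -(addn1 (b - a.+1)) iotaD foldl_cat /= (_ : (a.+1 + (b - a.+1))%N = b) //; lia.
Qed.

Definition valid_root a b := [&& 1 <= a, a < b & b <= n]%N.

Lemma inIP i : reflect (1 <= i < n)%N (inI n i).
Proof. by apply: (iffP idP); rewrite /inI; lia. Qed.

Lemma filt_rootv a b r : valid_root a b -> filt r.+1 (rootv a b r).
Proof.
case/and3P=> a1 ab bn; elim/ltn_ind_from: b / ab bn => [|b ab IH] bn.
  by rewrite rootv1; apply: filt_e; apply/inIP; lia.
rewrite rootvS //; move: (@filt_brr r.+1 0 (rootv a b r) (e b 0)); rewrite addn0; apply.
  by apply: IH; lia.
by apply: filt_e; apply/inIP; lia.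
Qed.

(** * Loop algebra relations in top degree *)

Lemma cartan_far i j : (i.+1 < j)%N || (j.+1 < i)%N -> cartan i j = 0.
Proof. by rewrite /cartan => H; rewrite !ifF //; lia. Qed.
Lemma cartan_adj i j : (i == j.+1) || (j == i.+1) -> cartan i j = (-1)%Z.
Proof. by rewrite /cartan => H; rewrite ifF ?H //; lia. Qed.

(** The right-hand side of [rel1] has degree r + s, one below the commutators. So in top degree a
    commutator of generators depends only on the sum of the indices. *)
Lemma shift1 i j r s : inI n i -> inI n j ->
  eqf (r.+1 + s) (br (e i r.+1) (e j s)) (br (e i r) (e j s.+1)).
Proof.
move=> Ii Ij; rewrite /eqf rel1 //.
rewrite -mulrA; apply/filt_half/filtMz; apply: filtD.
- by apply: filt_le (filtM (filt_e r Ii) (filt_e s Ij)); lia.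
- by apply: filt_le (filtM (filt_e s Ij) (filt_e r Ii)); lia.
Qed.

Lemma shift0 i j r s : inI n i -> inI n j ->
  eqf (r + s) (br (e i r) (e j s)) (br (e i 0) (e j (r + s))).
Proof.
move=> Ii Ij; elim: r s => [|r IH] s; first exact: eqf_refl.
apply: eqf_trans (shift1 _ _ _ _) _ => //.
by rewrite addSnnS; apply: IH.
Qed.

Lemma shift d i j r s r' s' : inI n i -> inI n j -> (r + s)%N = d -> (r' + s')%N = d ->
  eqf d (br (e i r) (e j s)) (br (e i r') (e j s')).
Proof.
move=> Ii Ij <- rs; apply: eqf_trans (shift0 _ _ _ _) _ => //.
by rewrite -rs; apply: eqf_sym; apply: shift0.
Qed.

(** By [shift] the commutator is symmetric in r and s in top degree; it is also antisymmetric, and 2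
    is invertible. *)
Lemma br_same i r s : inI n i -> eqf (r + s) (br (e i r) (e i s)) 0.
Proof.
move=> Ii; rewrite /eqf subr0; apply: filt_double; rewrite {2}brC.
by apply: shift => //; rewrite addnC.
Qed.

Lemma br_far i j r s : inI n i -> inI n j -> (i.+1 < j)%N || (j.+1 < i)%N ->
  br (e i r) (e j s) = 0.
Proof. by move=> Ii Ij ij; apply: rel2 => //; apply: cartan_far. Qed.

Lemma serre0 i j r s : inI n i -> inI n j -> (i == j.+1) || (j == i.+1) ->
  br (e i r) (br (e i r) (e j s)) = 0.
Proof.
move=> Ii Ij ij; have := @rel3 i j r r s Ii Ij (cartan_adj ij).
by move=> H; rewrite -[LHS]mul1r -h2 mulrDl -mulrDr H mulr0.
Qed.

(** [rel3] only kills the sum over both orders of r, r'. The two terms differ by a bracket with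
    [e_{i,r}, e_{i,r'}], which [br_same] puts in lower degree, so twice each term is negligible. *)
Lemma serre i j r r' s : inI n i -> inI n j -> (i == j.+1) || (j == i.+1) ->
  eqf (r + r' + s) (br (e i r) (br (e i r') (e j s))) 0.
Proof.
move=> Ii Ij ij; rewrite /eqf subr0; apply: filt_double.
have := @rel3 i j r r' s Ii Ij (cartan_adj ij) => /eqP; rewrite addr_eq0 => /eqP H.
rewrite {2}H jacobi addrK.
move: (@br_same i r r' Ii); rewrite /eqf subr0 => H'.
by apply: filt_brr => //; apply: filt_e.
Qed.

Lemma rootv_far a b l r s : valid_root a b -> inI n l -> (l.+1 < a)%N || (b < l)%N ->
  br (rootv a b r) (e l s) = 0.
Proof.
case/and3P=> a1 ab bn Il; elim/ltn_ind_from: b / ab bn => [|b ab IH] bn lab.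
  by rewrite rootv1; apply: br_far => //; [apply/inIP|]; lia.
rewrite rootvS // jacobil IH; [|lia|lia].
have -> : br (e b 0) (e l s) = 0 by apply: br_far => //; [apply/inIP|]; lia.
by rewrite !br0r subr0.
Qed.

(** By definition root vectors carry their degree on the first letter. The degree s is passed to the
    neighbouring letter by [shift] and then, by induction, down to the first one. *)
Lemma rootv_next a b r s : valid_root a b -> inI n b ->
  eqf (r + s) (br (rootv a b r) (e b s)) (rootv a b.+1 (r + s)).
Proof.
case/and3P=> a1 ab bn; elim/ltn_ind_from: b / ab bn r s => [|b ab IH] bn r s Ib.
  rewrite [rootv a a.+2 _]rootvS // !rootv1; apply: shift; rewrite ?addn0 //; apply/inIP; lia.
have Ib' : inI n b by apply/inIP; lia.
have vab : valid_root a b by apply/and3P; split; lia.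
rewrite rootvS // jacobil (rootv_far _ _ vab Ib) ?leqnn ?orbT // br0r subr0.
apply: eqf_trans (_ : eqf _ (br (rootv a b r) (br (e b s) (e b.+1 0))) _).
  apply: (eqf_brr (a := r) (b := s)) => //; first exact: filt_rootv.
  by apply: eqf_sym; apply: shift => //; rewrite addn0.
rewrite jacobi (rootv_far _ _ vab Ib) ?leqnn ?orbT // br0r addr0 [X in eqf _ _ X]rootvS; last lia.
apply: (eqf_brl (a := (r + s)%N) (b := 0)) => //; first exact: addn0.
  exact: filt_e.
by apply: IH => //; lia.
Qed.

Lemma rootv_prev l b r s : valid_root l.+1 b -> inI n l ->
  eqf (r + s) (br (e l s) (rootv l.+1 b r)) (rootv l b (r + s)).
Proof.
case/and3P=> a1 ab bn Il; elim/ltn_ind_from: b / ab bn => [|b ab IH] bn.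
  rewrite rootv1 [rootv l l.+2 _]rootvS // rootv1 [(r + s)%N]addnC; apply: shift; rewrite ?addn0 //; apply/inIP; lia.
have Ib' : inI n b by apply/inIP; lia.
rewrite !rootvS ?(ltnW ab) // jacobi (br_far (i := l)) //; last by rewrite ab.
rewrite br0r addr0; apply: (eqf_brl (a := (r + s)%N) (b := 0)) => //; first exact: addn0.
  exact: filt_e.
by apply: IH; lia.
Qed.

Lemma eqf0_brr a b d x y : (a + b)%N = d -> filt a.+1 x -> eqf b y 0 -> eqf d (br x y) 0.
Proof. by move=> ab Fx Fy; rewrite -(br0r x); apply: eqf_brr ab Fx Fy. Qed.
Lemma eqf0N d x : eqf d x 0 -> eqf d (- x) 0.
Proof. by move=> /eqfN; rewrite oppr0. Qed.
Lemma eqf0D d x y : eqf d x 0 -> eqf d y 0 -> eqf d (x + y) 0.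
Proof. by move=> Cx Cy; rewrite -[0](addr0 0); apply: eqfD. Qed.
Lemma eqf0B d x y : eqf d x 0 -> eqf d y 0 -> eqf d (x - y) 0.
Proof. by move=> Cx Cy; apply/eqf0D/eqf0N. Qed.

(* The hard case a < l, b = l + 2 is [br_double], whose right-hand side vanishes by Serre and induction. *)
Lemma rootv_mid a b l r s : valid_root a b -> (a <= l < b)%N ->
  eqf (r + s) (br (rootv a b r) (e l s)) 0.
Proof.
case/and3P=> a1 ab bn; elim/ltn_ind_from: b / ab bn r s => [|b ab IH] bn r s lab.
  have -> : l = a by lia.
  by rewrite rootv1; apply: br_same; apply/inIP; lia.
have Ib : inI n b by apply/inIP; lia.
have Il : inI n l by apply/inIP; lia.
have vab : valid_root a b by apply/and3P; split; lia.
rewrite rootvS //.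
have [lb|bl] := ltnP l.+1 b.
  rewrite jacobil (br_far (i := b)) ?lb ?orbT // br0r sub0r; apply: eqf0N.
  apply: (@eqf0_brr 0 (r + s)) => //; first exact: filt_e.
  by apply: IH; lia.
have [bl' | lb'] := leqP b l.
  have El : l = b by lia.
  subst l => {lab bl Il bl'}.
  have [ba | ba] := leqP b a.+1.
    have Eb : b = a.+1 by lia.
    subst b => {ba vab}.
    have Ia : inI n a by apply/inIP; lia.
    rewrite rootv1 brC (brC (e a r)) brNr opprK.
    rewrite -[(r + s)%N]addn0 -addnA addnC addn0.
    have Ia' : inI n a.+1 by apply/inIP; lia.
    move: (@serre a.+1 a s 0 r Ia' Ia); rewrite addn0 addnC [(r + s)%N]addnC eqxx; exact.
  move: b ba ab vab Ib IH bn => [//|b] ba ab vab Ib IH bn.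
  have vab' : valid_root a b by apply/and3P; split; lia.
  have Ib' : inI n b by apply/inIP; lia.
  rewrite rootvS; last lia.
  rewrite (jacobil (rootv a b r)) (rootv_far _ _ vab' Ib) ?leqnn ?orbT // br0r subr0.
  rewrite jacobil (rootv_far _ _ vab' Ib) ?leqnn ?orbT // br0r subr0.
  apply: (@eqf0_brr r s) => //; first exact: filt_rootv.
  rewrite brC (brC (e b 0)) brNr opprK.
  move: (@serre b.+1 b s 0 0 Ib Ib'); rewrite !addn0 eqxx; exact.
have {bl lb'} El : b = l.+1 by lia.
have [la | al] := leqP l a.
  have El' : l = a by lia.
  rewrite El El' rootv1 brC; apply: eqf0N.
  have Ia : inI n a by apply/inIP; lia.
  have Ia' : inI n a.+1 by apply/inIP; lia.
  move: (@serre a a.+1 s r 0 Ia Ia'); rewrite addn0 [(r + s)%N]addnC eqxx orbT; exact.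
rewrite jacobil; apply: eqf0B; last first.
  apply: (@eqf0_brr 0 (r + s)) => //; first exact: filt_e.
  by apply: IH; lia.
have Fab : filt r.+1 (rootv a b r) by exact: filt_rootv.
(* The degree s is moved from colour [l] to colour [b], so that the inner bracket contains the same
   element [e l 0] that ends [rootv a b r]; this is the shape required by [br_double]. *)
apply: eqf_trans (_ : eqf _ (br (rootv a b r) (br (e b s) (e l 0))) _).
  by apply: (@eqf_brr r s) => //; apply: shift; rewrite ?addn0.
have val : valid_root a l by apply/and3P; split; lia.
have EalC : br (rootv a l r) (e b s) = 0 by apply: rootv_far => //; lia.
rewrite /eqf subr0; apply: filt_double.
have adj : (l == b.+1) || (b == l.+1) by rewrite El eqxx orbT.
have EE : rootv a b r = br (rootv a l r) (e l 0) by rewrite El rootvS.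
rewrite EE br_double // -EE -[X in filt _ X]subr0; apply: eqf0B.
  apply: (@eqf0_brr r s) => //; first exact: filt_rootv.
  rewrite (brC (e b s)) brNr; apply: eqf0N.
  exact: (@serre l b 0 0 s).
apply: (@eqf0_brr s r) => //; [exact: addnC|exact: filt_e|].
rewrite brC; apply: eqf0N.
by have := IH (ltnW bn) r 0; rewrite addn0; apply; lia.
Qed.

Lemma rootv_gen a b l r s : valid_root a b -> inI n l ->
  eqf (r + s) (br (rootv a b r) (e l s))
     ((if b == l then rootv a l.+1 (r + s) else 0) - (if a == l.+1 then rootv l b (r + s) else 0)).
Proof.
move=> vab Il; have /and3P[a1 ab bn] := vab.
case: eqP => [bl|bl].
  rewrite ifF; last lia.
  by rewrite subr0 -bl; apply: rootv_next => //; rewrite bl.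
case: eqP => [al|al].
  rewrite sub0r brC; apply: eqfN; rewrite al; apply: rootv_prev => //; by rewrite -al.
rewrite subr0; have [H|H] := boolP (a <= l < b)%N; first exact: rootv_mid.
by rewrite rootv_far //; [exact: eqf_refl|lia].
Qed.

(** Induction on [d], splitting the last letter off the second root vector by Jacobi; the cases are
    those of [E_ab, E_cd] for matrix units. *)
Lemma rootv_br a b c d r s : valid_root a b -> valid_root c d ->
  eqf (r + s) (br (rootv a b r) (rootv c d s))
     ((if b == c then rootv a d (r + s) else 0) - (if a == d then rootv c b (r + s) else 0)).
Proof.
move=> vab /and3P[c1 cd]; elim/ltn_ind_from: d / cd a b r s vab => [|d cd IH] a b r s vab dn.
  have Ic : inI n c by apply/inIP; lia.
  have := rootv_gen r s vab Ic; rewrite rootv1.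
  by case: eqP => // ->.
have Id : inI n d by apply/inIP; lia.
have vcd : valid_root c d by apply/and3P; split; lia.
have dn' : (d <= n)%N by lia.
have /and3P[a1 ab bn] := vab.
rewrite (rootvS _ cd) jacobi.
apply: eqf_trans (_ : eqf _ (br ((if b == c then rootv a d (r + s) else 0) - (if a == d then rootv c b (r + s) else 0)) (e d 0) + br (rootv c d s) ((if b == d then rootv a d.+1 r else 0) - (if a == d.+1 then rootv d b r else 0))) _).
  apply: eqfD.
    apply: (@eqf_brl (r + s) 0) => //; [exact: addn0|exact: filt_e|exact: IH].
  apply: (@eqf_brr s r) => //; [exact: addnC|exact: filt_rootv|].
  by have := rootv_gen r 0 vab Id; rewrite addn0; case: (_ == d.+1).
have [bc|bc] := eqVneq b c.
  subst c; have /negPf-> : a != d by lia.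
  have /negPf-> : b != d by lia.
  have /negPf-> : a != d.+1 by lia.
  rewrite !subr0 br0r addr0.
  have vad : valid_root a d by apply/and3P; split; lia.
  by have := rootv_next (r + s) 0 vad Id; rewrite addn0.
have [ad|ad] := eqVneq a d.
  subst a; have /negPf-> : b != d by lia.
  have /negPf-> : d != d.+1 by lia.
  rewrite !subr0 sub0r br0r addr0 brNl; apply: eqf0N.
  have vcb : valid_root c b by apply/and3P; split; lia.
  have := @rootv_mid c b d (r + s) 0 vcb; rewrite addn0; apply; lia.
rewrite subr0 br0l add0r.
(* In the two remaining nontrivial cases the induction hypothesis is applied to a first root
   enlarged by the letter [d], which is why [a] and [b] vary in the induction. *)
have [bd|bd] := eqVneq b d.
  subst b; have /negPf-> : a != d.+1 by lia.
  rewrite !subr0 brC; apply: eqf0N.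
  have vad : valid_root a d.+1 by apply/and3P; split; lia.
  have := IH a d.+1 r s vad dn'.
  rewrite (negPf ad) ifF; last lia.
  by rewrite subr0.
have [ad1|ad1] := eqVneq a d.+1; last by rewrite subr0 br0r; apply: eqf_refl.
subst a; rewrite !sub0r brNr.
have vdb : valid_root d b by apply/and3P; split; lia.
have := IH d b r s vdb dn'; rewrite eqxx (negPf bc) sub0r.
by rewrite (brC (rootv c d s)) opprK.
Qed.

(** * Straightening of products of root vectors *)

Definition valid_key (k : key) := inDelta n k.1.1 k.1.2.
Definition rootv_key (k : key) := rootv k.1.1 k.1.2.+1 k.2.
Definition mon (l : seq key) : A := \prod_(k <- l) rootv_key k.
Definition kdeg (l : seq key) : nat := \sum_(k <- l) k.2.

Lemma valid_keyE k : valid_key k = valid_root k.1.1 k.1.2.+1.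
Proof. by rewrite /valid_key /inDelta /valid_root; lia. Qed.

(** In [rootv_br] the conditions b = c and a = d exclude each other, since a < b and c < d; so at
    most one root vector survives. *)
Lemma rootv_key_br k k' : valid_key k -> valid_key k' ->
  exists2 u, eqf (k.2 + k'.2) (br (rootv_key k) (rootv_key k')) u &
    u = 0 \/ exists2 c, valid_key c /\ c.2 = (k.2 + k'.2)%N & u = rootv_key c \/ u = - rootv_key c.
Proof.
rewrite !valid_keyE => vk vk'; eexists; first exact: rootv_br.
case: eqP => [bc|_].
  have /negPf-> : k.1.1 != k'.1.2.+1 by move: vk vk'; rewrite /valid_root; lia.
  right; exists (k.1.1, k'.1.2, (k.2 + k'.2)%N); last by left; rewrite subr0.
  by rewrite valid_keyE; move: vk vk'; rewrite /valid_root /=; lia.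
case: eqP => [ad|_]; last by left; rewrite subr0.
right; exists (k'.1.1, k.1.2, (k.2 + k'.2)%N); last by right; rewrite sub0r.
by rewrite valid_keyE; move: vk vk'; rewrite /valid_root /=; lia.
Qed.

Lemma mon_cat l l' : mon (l ++ l') = mon l * mon l'.
Proof. by rewrite /mon big_cat. Qed.
Lemma mon_cons a l : mon (a :: l) = rootv_key a * mon l.
Proof. by rewrite /mon big_cons. Qed.
Lemma kdeg_cat l l' : kdeg (l ++ l') = (kdeg l + kdeg l')%N.
Proof. by rewrite /kdeg big_cat. Qed.
Lemma kdeg_cons a l : kdeg (a :: l) = (a.2 + kdeg l)%N.
Proof. by rewrite /kdeg big_cons. Qed.

Lemma filt_mon l : all valid_key l -> filt (kdeg l).+1 (mon l).
Proof.
elim: l => [_|a l IH /= /andP[oa ol]].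
  rewrite /mon big_nil (_ : 1 = wprod [::]); last by rewrite /wprod big_nil.
  by apply: filt_word => //; rewrite /wdeg big_nil.
rewrite mon_cons kdeg_cons; move: oa; rewrite valid_keyE => /(filt_rootv a.2) Fa.
by apply: filt_le (filtM Fa (IH ol)); lia.
Qed.

Inductive ordered_span : A -> Prop :=
| ordered_span0 : ordered_span 0
| ordered_spanD x y : ordered_span x -> ordered_span y -> ordered_span (x + y)
| ordered_spanN x : ordered_span x -> ordered_span (- x)
| ordered_span_half x : ordered_span x -> ordered_span (h * x)
| ordered_span_mon l : all valid_key l -> sorted keyle l -> ordered_span (mon l).

Lemma ordered_span_sub x y : ordered_span (x - y) -> ordered_span y -> ordered_span x.
Proof. by move=> Sxy Sy; rewrite -(subrK y x); apply: ordered_spanD. Qed.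

Section Straightening.
Variables d m : nat.
Hypothesis SpF : forall x, filt d x -> ordered_span x.
Hypothesis Spshort : forall l, all valid_key l -> (kdeg l <= d)%N -> (size l < m)%N -> ordered_span (mon l).

(** The commutator is, up to lower degree, zero or plus or minus one root vector of the same degree.
    The first part falls under [SpF], the second gives a monomial with one factor less and falls
    under [Spshort]. *)
Lemma mon_swap u a b v : all valid_key (u ++ a :: b :: v) -> (kdeg (u ++ a :: b :: v) <= d)%N ->
  (size (u ++ a :: b :: v) <= m)%N ->
  ordered_span (mon (u ++ a :: b :: v) - mon (u ++ b :: a :: v)).
Proof.
rewrite all_cat kdeg_cat size_cat /= !kdeg_cons => /andP[ou /and3P[oa ob ov]] dd sm.
rewrite !mon_cat !mon_cons -mulrBr !mulrA -mulrBl -/(br (rootv_key a) (rootv_key b)) mulrA.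
have [w Cw ww] := rootv_key_br oa ob.
rewrite -[br _ _](subrK w) mulrDr mulrDl; apply: ordered_spanD.
  apply: SpF; apply: filt_le (filtM (filtM (filt_mon ou) Cw) (filt_mon ov)); lia.
have Smon c : valid_key c -> c.2 = (a.2 + b.2)%N -> ordered_span (mon u * rootv_key c * mon v).
  move=> oc ec; rewrite -mulrA -mon_cons -mon_cat; apply: Spshort.
  - by rewrite all_cat /= ou oc ov.
  - by rewrite kdeg_cat kdeg_cons ec; lia.
  - by rewrite size_cat /=; lia.
case: ww => [->|[c [oc ec] [->|->]]].
- by rewrite mulr0 mul0r; apply: ordered_span0.
- exact: Smon.
- by rewrite mulrN mulNr; apply/ordered_spanN/Smon.
Qed.

Lemma mon_front u a w v : all valid_key (u ++ w ++ a :: v) -> (kdeg (u ++ w ++ a :: v) <= d)%N ->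
  (size (u ++ w ++ a :: v) <= m)%N ->
  ordered_span (mon (u ++ w ++ a :: v) - mon (u ++ a :: w ++ v)).
Proof.
elim: w u => [|b w IH] u; first by rewrite subrr => _ _ _; apply: ordered_span0.
move=> ok dd sm; apply: (@ordered_span_sub _ (mon (u ++ b :: a :: w ++ v) - mon (u ++ a :: b :: w ++ v))).
  rewrite opprB addrA subrK; have := IH (rcons u b).
  by rewrite !cat_rcons; apply.
apply: mon_swap.
- by move: ok; rewrite !all_cat /= !all_cat /=; lia.
- by move: dd; rewrite !kdeg_cat /= !kdeg_cons ?kdeg_cat ?kdeg_cons; lia.
- by move: sm; rewrite !size_cat /= ?size_cat /=; lia.
Qed.

Lemma mon_perm u l l' : perm_eq l l' -> all valid_key (u ++ l) -> (kdeg (u ++ l) <= d)%N ->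
  (size (u ++ l) <= m)%N -> ordered_span (mon (u ++ l) - mon (u ++ l')).
Proof.
elim: l' u l => [|a l' IH] u l.
  by move=> /perm_nilP-> _ _ _; rewrite subrr; apply: ordered_span0.
move=> pl ok dd sm.
have al : a \in l by rewrite (perm_mem pl) inE eqxx.
case/splitPr: al pl ok dd sm => w v pl ok dd sm.
apply: (@ordered_span_sub _ (mon (u ++ a :: w ++ v) - mon (u ++ a :: l'))).
  by rewrite opprB addrA subrK; apply: mon_front.
rewrite -!cat_rcons; apply: IH.
- by rewrite -(perm_cons a) -(permPr pl) -cat_cons (perm_catCA [:: a] w v).
- by move: ok; rewrite !all_cat all_rcons /= ?all_cat; lia.
- have k0 : kdeg [::] = 0%N by rewrite /kdeg big_nil.
  by move: dd; rewrite -cats1 !(kdeg_cat, kdeg_cons) k0; lia.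
- by move: sm; rewrite !size_cat size_rcons /= ?size_cat; lia.
Qed.
End Straightening.

Lemma keyle_total : total keyle.
Proof. by move=> [[i j] r] [[i' j'] r'] /=; lia. Qed.
Lemma keyle_trans : transitive keyle.
Proof. by move=> [[i j] r] [[i' j'] r'] [[i'' j''] r''] /=; lia. Qed.
Lemma keyle_anti : antisymmetric keyle.
Proof. by move=> [[i j] r] [[i' j'] r'] /= H; congr (_, _, _); lia. Qed.

(** Induction on the degree, and inside it on the number of factors. The outer hypothesis covers all
    of [filt d], because words in the generators are monomials in simple root vectors. *)
Lemma mon_ordered_span l : all valid_key l -> ordered_span (mon l).
Proof.
move: {2}(kdeg l).+1 (ltnSn (kdeg l)) => d; elim: d l => [//|d IHd] l.
have SpF x : filt d x -> ordered_span x.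
  elim=> {x} [|x y _ Fx _ Fy|x _ Fx|x _ Fx|w Vw dw].
  - exact: ordered_span0.
  - exact: ordered_spanD.
  - exact: ordered_spanN.
  - exact: ordered_span_half.
  rewrite (_ : wprod w = mon [seq (g.1, g.1, g.2) | g <- w]); last first.
    by rewrite /wprod /mon big_map; apply: eq_bigr => g _; rewrite /rootv_key rootv1.
  apply: IHd; first by rewrite /kdeg big_map.
  rewrite all_map; apply: sub_all Vw => g /inIP Ig.
  by rewrite /= valid_keyE /valid_root /=; lia.
move: {2}(size l).+1 (ltnSn (size l)) => m; elim: m l => [//|m IHm] l sm dl ol.
have := @mon_perm d m SpF _ [::] l (sort keyle l); rewrite /= => H.
apply: ordered_span_sub (H _ _ _ _ _) _ => //.
- by move=> l' ol' dl' sl'; apply: IHm.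
- by rewrite perm_sym perm_sort.
by apply: ordered_span_mon; [rewrite all_sort|apply: sort_sorted keyle_total _].
Qed.

(** An exact relation, not one modulo lower degree: it serves to build a Heisenberg triple whose
    divided powers can be compared. All letters of the root vector but the last commute with
    [e b 0], so it comes down to one Serre relation. *)
Lemma br_rootv_gen0 a b : valid_root a b.+1 -> (a < b)%N -> forall r,
  br (e b 0) (br (rootv a b r) (e b 0)) = 0.
Proof.
move=> vab ab r; have /and3P[a1 _ bn] := vab.
have Ib : inI n b by apply/inIP; lia.
have [ba | ba] := leqP b a.+1.
  have Eb : b = a.+1 by lia.
  subst b; rewrite rootv1 (brC (e a r)) brNr serre0 ?oppr0 ?eqxx //.
  by apply/inIP; lia.
move: b ba ab vab Ib bn => [//|b] ba ab vab Ib bn.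
have vab' : valid_root a b by apply/and3P; split; lia.
have Ib' : inI n b by apply/inIP; lia.
rewrite rootvS; last lia.
have E0 : br (rootv a b r) (e b.+1 0) = 0 by apply: rootv_far => //; rewrite leqnn orbT.
rewrite jacobil E0 br0r subr0 jacobi (brC (e b.+1 0) (rootv _ _ _)) E0 oppr0 br0l add0r.
by rewrite (brC (e b 0)) brNr serre0 ?eqxx // oppr0 br0r.
Qed.

(** Write x for the shorter root vector, y = [x, e_b] and f = e_{b+1}. Then [y,[y,f]] =
    [y,[x,[e_b,f]]] = [x,[y,[e_b,f]]], as [y,x] = 0 by induction. The inner bracket is
    -[[x,e_b],[f,e_b]], which vanishes by [br_double]. *)
Lemma br_rootv_gen1 a b : valid_root a b.+1 -> (a < b)%N -> forall r,
  br (rootv a b r) (br (rootv a b r) (e b 0)) = 0.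
Proof.
move=> vab ab r; have /and3P[a1 _ bn] := vab.
elim/ltn_ind_from: b / ab vab bn => [|b ab IH] vab bn.
  by rewrite rootv1 serre0 ?eqxx ?orbT //; apply/inIP; lia.
have vab' : valid_root a b.+1 by apply/and3P; split; lia.
have {}IH := IH vab' (ltnW bn).
have Ib : inI n b by apply/inIP; lia.
have Ib' : inI n b.+1 by apply/inIP; lia.
have bx : br (e b 0) (rootv a b.+1 r) = 0 by rewrite rootvS // br_rootv_gen0.
have xx : br (rootv a b.+1 r) (rootv a b r) = 0 by rewrite brC rootvS // IH oppr0.
have vab'' : valid_root a b by apply/and3P; split; lia.
have ac : br (rootv a b r) (e b.+1 0) = 0 by apply: rootv_far => //; rewrite leqnn orbT.
have z_ : br (rootv a b.+1 r) (e b.+1 0) = br (rootv a b r) (br (e b 0) (e b.+1 0)).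
  by rewrite {1}rootvS // jacobil ac br0r subr0.
rewrite z_ jacobi xx br0l add0r.
suff -> : br (rootv a b.+1 r) (br (e b 0) (e b.+1 0)) = 0 by rewrite br0r.
rewrite (brC (e b 0)) brNr {1}rootvS //.
have D := br_double (e b 0) ac.
have Z0 : br (rootv a b r) (br (e b 0) (br (e b.+1 0) (e b 0))) = 0.
  by rewrite (brC (e b.+1 0)) brNr serre0 ?eqxx ?orbT // oppr0 br0r.
have Z1 : br (e b.+1 0) (br (e b 0) (br (rootv a b r) (e b 0))) = 0.
  by rewrite -rootvS // bx br0r.
rewrite Z0 Z1 subr0 in D.
by apply/eqP; rewrite oppr_eq0 -[br _ _]mul1r -h2 mulrDl -mulrDr D mulr0.
Qed.
End AbstractYangian.

(** * The Yangian as a quotient ring *)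

Lemma InP (T : eqType) (x : T) (s : seq T) : reflect (List.In x s) (x \in s).
Proof.
elim: s => [|y s IH] /=; first by constructor.
rewrite inE; apply: (iffP orP) => -[].
- by move=> /eqP->; left.
- by move=> /IH; right.
- by move=> ->; left.
- by move=> /IH; right.
Qed.

Section LinearExtension.
Variables (K : nmodType) (T : eqType) (V : zmodType) (f : T -> K -> V).
Hypothesis f0 : forall t, f t 0 = 0.
Hypothesis fD : forall t, {morph f t : a b / a + b}.

Definition coef (x : seq (K * T)) t : K := \sum_(ct <- x | ct.2 == t) ct.1.

Lemma lin_ext_undup (W : seq T) (x : seq (K * T)) : uniq W -> {subset [seq ct.2 | ct <- x] <= W} ->
  \sum_(ct <- x) f ct.2 ct.1 = \sum_(t <- W) f t (coef x t).
Proof.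
move=> uW; elim: x => [|[c t] x IH] sub.
  by rewrite big_nil big1 // => t _; rewrite /coef big_nil f0.
rewrite big_cons /= IH; last by move=> u Hu; apply: sub; rewrite inE Hu orbT.
have tW : t \in W by apply: sub; rewrite inE eqxx.
rewrite (bigD1_seq t) //= [RHS](bigD1_seq t) //= addrA -fD.
rewrite /coef [in RHS]big_cons /= eqxx; congr (_ + _); apply: eq_bigr => u ut.
by rewrite big_cons /= eq_sym (negPf ut).
Qed.

(** Makes evaluations of formal sums well defined: [fcoef] and [tcoef] are instances of [coef] up to
    conversion. *)
Lemma lin_ext (x y : seq (K * T)) : (forall t, coef x t = coef y t) ->
  \sum_(ct <- x) f ct.2 ct.1 = \sum_(ct <- y) f ct.2 ct.1.
Proof.
move=> xy; pose W := undup ([seq ct.2 | ct <- x] ++ [seq ct.2 | ct <- y]).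
rewrite !(lin_ext_undup (W := W)) ?undup_uniq //.
- by apply: eq_bigr => t _; rewrite xy.
- by move=> t Ht; rewrite mem_undup mem_cat Ht orbT.
- by move=> t Ht; rewrite mem_undup mem_cat Ht.
Qed.
End LinearExtension.

Section FreeAlgebra.
Variable K : comNzRingType.
Implicit Types x y z : fsum K.

Lemma fcoef_cat x y w : fcoef (x ++ y) w = fcoef x w + fcoef y w.
Proof. by rewrite /fcoef big_cat. Qed.
Lemma fcoef_nil w : fcoef ([::] : fsum K) w = 0.
Proof. by rewrite /fcoef big_nil. Qed.
Lemma fcoef_scale c x w : fcoef (fscale c x) w = c * fcoef x w.
Proof. by rewrite /fcoef /fscale big_map mulr_sumr. Qed.
Lemma fcoef_sub x y w : fcoef (fsub x y) w = fcoef x w - fcoef y w.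
Proof. by rewrite fcoef_cat fcoef_scale mulN1r. Qed.
Lemma fcoef_mul x y w :
  fcoef (fmul x y) w = \sum_(a <- x) \sum_(b <- y) (if a.2 ++ b.2 == w then a.1 * b.1 else 0).
Proof.
rewrite /fcoef /fmul big_flatten big_map; apply: eq_bigr => a _.
by rewrite big_map big_mkcond.
Qed.
Lemma fcoef_mull x x' y : (forall w, fcoef x w = fcoef x' w) ->
  forall w, fcoef (fmul x y) w = fcoef (fmul x' y) w.
Proof.
move=> E w; rewrite !fcoef_mul.
apply: (@lin_ext K word K (fun u c => \sum_(b <- y) (if u ++ b.2 == w then c * b.1 else 0))) => //.
  by move=> t; rewrite big1 // => b _; rewrite mul0r; case: ifP.
by move=> t a b; rewrite -big_split; apply: eq_bigr => c _ /=; case: ifP; rewrite ?mulrDl ?addr0.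
Qed.
Lemma fcoef_mulr x y y' : (forall w, fcoef y w = fcoef y' w) ->
  forall w, fcoef (fmul x y) w = fcoef (fmul x y') w.
Proof.
move=> E w; rewrite !fcoef_mul exchange_big [RHS]exchange_big.
apply: (@lin_ext K word K (fun u c => \sum_(b <- x) (if b.2 ++ u == w then b.1 * c else 0))) => //.
  by move=> t; rewrite big1 // => b _; rewrite mulr0; case: ifP.
by move=> t a b; rewrite -big_split; apply: eq_bigr => c _ /=; case: ifP; rewrite ?mulrDr ?addr0.
Qed.

Lemma fmul_cons a x y : fmul (a :: x) y = [seq (a.1 * b.1, a.2 ++ b.2) | b <- y] ++ fmul x y.
Proof. by []. Qed.
Lemma fmul_catl x x' y : fmul (x ++ x') y = fmul x y ++ fmul x' y.
Proof. by rewrite /fmul map_cat flatten_cat. Qed.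
Lemma fmulA x y z : fmul x (fmul y z) = fmul (fmul x y) z.
Proof.
elim: x => [//|a x IH]; rewrite !fmul_cons fmul_catl -IH; congr (_ ++ _).
elim: y {IH} => [//|b y IH]; rewrite /= !fmul_cons map_cat IH; congr (_ ++ _).
by rewrite -map_comp; apply: eq_map => c /=; rewrite mulrA catA.
Qed.
Lemma fmul1l x : fmul (fone K) x = x.
Proof.
rewrite /fone fmul_cons cats0 -[RHS]map_id; apply: eq_map => -[c w] /=.
by rewrite mul1r.
Qed.
Lemma fmul1r x : fmul x (fone K) = x.
Proof. by elim: x => [//|[c w] x IH]; rewrite fmul_cons IH /= mulr1 cats0. Qed.
Lemma fcoef_mulDr x y z w : fcoef (fmul x (y ++ z)) w = fcoef (fmul x y ++ fmul x z) w.
Proof.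
rewrite fcoef_cat !fcoef_mul -big_split; apply: eq_bigr => a _ /=.
by rewrite big_cat.
Qed.
Lemma fcoef_mulZl c x y w : fcoef (fmul (fscale c x) y) w = c * fcoef (fmul x y) w.
Proof.
rewrite !fcoef_mul big_map mulr_sumr; apply: eq_bigr => a _ /=.
by rewrite mulr_sumr; apply: eq_bigr => b _; case: ifP; rewrite ?mulr0 // mulrA.
Qed.
Lemma fcoef_mulZr c x y w : fcoef (fmul x (fscale c y)) w = c * fcoef (fmul x y) w.
Proof.
rewrite !fcoef_mul mulr_sumr; apply: eq_bigr => a _ /=.
rewrite big_map mulr_sumr; apply: eq_bigr => b _ /=; case: ifP; rewrite ?mulr0 //.
by rewrite mulrCA.
Qed.
End FreeAlgebra.

Section YangianRing.
Variables (R : realType) (n : nat).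
Notation C := (complex R).
Implicit Types x y z : fsum C.

(* The ideal in Defs is generated with multipliers in the letters (i, r), i in I, only.  Sending every
   word with another letter to 0 makes the quotient of all formal sums a ring. *)
Definition vpart x : fsum C := [seq cw <- x | valid_word n cw.2].

Lemma fcoef_vpart x w : fcoef (vpart x) w = if valid_word n w then fcoef x w else 0.
Proof.
rewrite /fcoef /vpart big_filter_cond big_mkcond [X in _ = if _ then X else _]big_mkcond.
case: ifP => Vw; last first.
  rewrite big1 // => cw _; case: ifP => // /andP[V /eqP E].
  by rewrite E Vw in V.
by apply: eq_bigr => cw _; case: eqP => [->|]; rewrite ?Vw ?andbF.
Qed.
Lemma vpart_id x : valid_fsum n x -> vpart x = x.
Proof. by move=> /all_filterP. Qed.
Lemma vpart_valid x : valid_fsum n (vpart x).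
Proof. exact: filter_all. Qed.
Lemma vpart_mul x y : vpart (fmul x y) = fmul (vpart x) (vpart y).
Proof.
elim: x => [//|a x IH]; rewrite fmul_cons /vpart filter_cat -/(vpart _) -/(vpart _) IH /=.
case: ifP => Va.
  rewrite fmul_cons; congr (_ ++ _); rewrite /vpart filter_map; congr map.
  by apply: eq_filter => b /=; rewrite /valid_word all_cat -/(valid_word n _) Va.
rewrite [X in X ++ _](_ : _ = [::]) // /vpart filter_map (eq_filter (a2 := pred0)) ?filter_pred0 // => b /=.
by rewrite /valid_word all_cat -/(valid_word n _) Va.
Qed.

Lemma valid_mul x y : valid_fsum n x -> valid_fsum n y -> valid_fsum n (fmul x y).
Proof. by move=> /vpart_id <- /vpart_id <-; rewrite -vpart_mul; apply: vpart_valid. Qed.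
Lemma valid_cat x y : valid_fsum n (x ++ y) = valid_fsum n x && valid_fsum n y.
Proof. exact: all_cat. Qed.
Lemma valid_scale c x : valid_fsum n (fscale c x) = valid_fsum n x.
Proof. by rewrite /valid_fsum all_map. Qed.
Lemma valid_sub x y : valid_fsum n (fsub x y) = valid_fsum n x && valid_fsum n y.
Proof. by rewrite valid_cat valid_scale. Qed.
Lemma valid_comm x y : valid_fsum n x -> valid_fsum n y -> valid_fsum n (fcomm x y).
Proof. by move=> Vx Vy; rewrite valid_sub !valid_mul. Qed.
Lemma valid_pow x t : valid_fsum n x -> valid_fsum n (fpow x t).
Proof. by move=> Vx; elim: t => [//|t IH]; apply: valid_mul. Qed.
Lemma valid_prod (l : seq (fsum C)) : (forall x, x \in l -> valid_fsum n x) -> valid_fsum n (fprod l).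
Proof.
elim: l => [//|x l IH] H; apply: valid_mul; first by apply: H; rewrite inE eqxx.
by apply: IH => y yl; apply: H; rewrite inE yl orbT.
Qed.
Lemma valid_ye i r : inI n i -> valid_fsum n (ye R i r).
Proof. by rewrite /valid_fsum /valid_word /= => ->. Qed.

Lemma ideal_coef x y : (forall w, fcoef x w = fcoef y w) -> in_yideal n x -> in_yideal n y.
Proof. by move=> E [l [Hl E']]; exists l; split=> // w; rewrite -E E'. Qed.
Lemma ideal0 : in_yideal n ([::] : fsum C).
Proof. by exists [::]; split. Qed.
Lemma ideal_cat x y : in_yideal n x -> in_yideal n y -> in_yideal n (x ++ y).
Proof.
move=> [l [Hl E]] [l' [Hl' E']]; exists (l ++ l'); split.
  by move=> t /InP; rewrite mem_cat => /orP[] /InP; [exact: Hl|exact: Hl'].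
by move=> w; rewrite map_cat /fsuml flatten_cat !fcoef_cat E E'.
Qed.
Lemma idealMl a x : valid_fsum n a -> in_yideal n x -> in_yideal n (fmul a x).
Proof.
move=> Va [l [Hl E]]; exists [seq (fmul a t.1.1, t.1.2, t.2) | t <- l]; split.
  move=> t /InP /mapP[u /InP /Hl [V1 [V2 V3]] ->]; split=> //=.
  exact: valid_mul.
move=> w; rewrite (fcoef_mulr a E) -map_comp.
elim: l {Hl E} w => [|t l IH] w.
  by rewrite /= fcoef_mul /fcoef big_nil big1 // => b _; rewrite big_nil.
by rewrite /= fcoef_mulDr !fcoef_cat IH !fmulA.
Qed.
Lemma idealMr a x : valid_fsum n a -> in_yideal n x -> in_yideal n (fmul x a).
Proof.
move=> Va [l [Hl E]]; exists [seq (t.1.1, t.1.2, fmul t.2 a) | t <- l]; split.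
  move=> t /InP /mapP[u /InP /Hl [V1 [V2 V3]] ->]; split=> //=; split=> //.
  exact: valid_mul.
move=> w; rewrite (fcoef_mull a E) -map_comp.
elim: l {Hl E} w => [//|t l IH] w.
by rewrite /= fmul_catl !fcoef_cat IH !fmulA.
Qed.
Lemma idealZ c x : in_yideal n x -> in_yideal n (fscale c x).
Proof.
move=> /(@idealMl [:: (c, [::])]); move=> /(_ isT).
by apply: ideal_coef => w; rewrite fcoef_scale fmul_cons cats0 /fcoef big_map mulr_sumr.
Qed.

Definition ysim x y := in_yideal n (vpart (fsub x y)).

Lemma ysim_coef x y : (forall w, fcoef x w = fcoef y w) -> ysim x y.
Proof.
move=> E; apply: ideal_coef ideal0 => w.
by rewrite fcoef_vpart fcoef_sub E subrr fcoef_nil if_same.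
Qed.
Lemma ysim_refl x : ysim x x. Proof. exact: ysim_coef. Qed.
Lemma ysim_sym x y : ysim x y -> ysim y x.
Proof.
move=> /(idealZ (-1)); apply: ideal_coef => w.
rewrite fcoef_scale !fcoef_vpart !fcoef_sub; case: ifP; rewrite ?mulr0 //.
by rewrite mulN1r opprB.
Qed.
Lemma ysim_trans y x z : ysim x y -> ysim y z -> ysim x z.
Proof.
move=> xy yz; apply: ideal_coef (ideal_cat xy yz) => w.
rewrite fcoef_cat !fcoef_vpart !fcoef_sub; case: ifP; rewrite ?addr0 //.
by rewrite addrA subrK.
Qed.
Lemma ysim_cat x x' y y' : ysim x x' -> ysim y y' -> ysim (x ++ y) (x' ++ y').
Proof.
move=> xy yz; apply: ideal_coef (ideal_cat xy yz) => w.
rewrite fcoef_cat !fcoef_vpart !fcoef_sub !fcoef_cat; case: ifP; rewrite ?addr0 //.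
by rewrite opprD addrACA.
Qed.
Lemma ysim_scale c x x' : ysim x x' -> ysim (fscale c x) (fscale c x').
Proof.
move=> /(idealZ c); apply: ideal_coef => w.
by rewrite fcoef_scale !fcoef_vpart !fcoef_sub !fcoef_scale; case: ifP; rewrite ?mulr0 ?mulrBr.
Qed.
Lemma ysim_mul x x' y y' : ysim x x' -> ysim y y' -> ysim (fmul x y) (fmul x' y').
Proof.
move=> xy yz; apply: (@ysim_trans (fmul x' y)).
  apply: ideal_coef (idealMr (vpart_valid y) xy) => w.
  rewrite -vpart_mul !fcoef_vpart; case: ifP => // _.
  by rewrite fmul_catl !fcoef_sub fcoef_cat fcoef_mulZl mulN1r.
apply: ideal_coef (idealMl (vpart_valid x') yz) => w.
rewrite -vpart_mul !fcoef_vpart; case: ifP => // _.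
by rewrite fcoef_mulDr !fcoef_sub fcoef_cat fcoef_mulZr mulN1r.
Qed.

Definition yb x y : bool := `[< ysim x y >].
Lemma yb_refl : reflexive yb. Proof. by move=> x; apply/asboolP/ysim_refl. Qed.
Lemma yb_sym : symmetric yb.
Proof. by move=> x y; apply/asboolP/asboolP => /ysim_sym. Qed.
Lemma yb_trans : transitive yb.
Proof. by move=> y x z /asboolP xy /asboolP yz; apply/asboolP; apply: ysim_trans yz. Qed.
Canonical yb_equiv := EquivRel yb yb_refl yb_sym yb_trans.
Definition Yangian := {eq_quot yb}%qT.
HB.instance Definition _ := Choice.on Yangian.
Definition py (x : fsum C) : Yangian := (\pi_Yangian x)%qT.

Lemma pyP x y : py x = py y <-> ysim x y.
Proof.
split=> [H|H]; first by apply/asboolP; apply/(@eqmodP _ yb_equiv); exact: H.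
by apply/(@eqmodP _ yb_equiv); apply/asboolP.
Qed.
Lemma py_repr (a : Yangian) : py (repr a) = a. Proof. exact: reprK. Qed.
Lemma py_coef x y : (forall w, fcoef x w = fcoef y w) -> py x = py y.
Proof. by move=> E; apply/pyP/ysim_coef. Qed.

Definition yadd (a b : Yangian) : Yangian := py (repr a ++ repr b).
Definition yopp (a : Yangian) : Yangian := py (fscale (-1) (repr a)).
Definition ymul (a b : Yangian) : Yangian := py (fmul (repr a) (repr b)).

Lemma repr_py x : ysim (repr (py x)) x. Proof. by apply/pyP; rewrite py_repr. Qed.
Lemma yaddE x y : yadd (py x) (py y) = py (x ++ y).
Proof. by apply/pyP/ysim_cat; apply: repr_py. Qed.
Lemma yoppE x : yopp (py x) = py (fscale (-1) x).
Proof. by apply/pyP/ysim_scale; apply: repr_py. Qed.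
Lemma ymulE x y : ymul (py x) (py y) = py (fmul x y).
Proof. by apply/pyP/ysim_mul; apply: repr_py. Qed.

Lemma yaddA : associative yadd.
Proof.
move=> a b c; rewrite -[a]py_repr -[b]py_repr -[c]py_repr !yaddE; by rewrite catA.
Qed.
Lemma yaddC : commutative yadd.
Proof.
move=> a b; rewrite -[a]py_repr -[b]py_repr !yaddE; apply: py_coef => w.
by rewrite !fcoef_cat addrC.
Qed.
Lemma yadd0 : left_id (py [::]) yadd.
Proof. by move=> a; rewrite -[a]py_repr yaddE. Qed.
Lemma yaddN : left_inverse (py [::]) yopp yadd.
Proof.
move=> a; rewrite -[a]py_repr yoppE yaddE; apply: py_coef => w.
by rewrite fcoef_cat fcoef_scale mulN1r addNr fcoef_nil.
Qed.
HB.instance Definition _ := GRing.isZmodule.Build Yangian yaddA yaddC yadd0 yaddN.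

Lemma ymulA : associative ymul.
Proof.
by move=> a b c; rewrite -[a]py_repr -[b]py_repr -[c]py_repr !ymulE fmulA.
Qed.
Lemma ymul1l : left_id (py (fone C)) ymul.
Proof. by move=> a; rewrite -[a]py_repr ymulE fmul1l. Qed.
Lemma ymul1r : right_id (py (fone C)) ymul.
Proof. by move=> a; rewrite -[a]py_repr ymulE fmul1r. Qed.
Lemma ymulDl : left_distributive ymul yadd.
Proof.
by move=> a b c; rewrite -[a]py_repr -[b]py_repr -[c]py_repr !(yaddE, ymulE) fmul_catl.
Qed.
Lemma ymulDr : right_distributive ymul yadd.
Proof.
move=> a b c; rewrite -[a]py_repr -[b]py_repr -[c]py_repr !(yaddE, ymulE).
by apply: py_coef => w; apply: fcoef_mulDr.
Qed.
HB.instance Definition _ := GRing.Zmodule_isPzRing.Build Yangian ymulA ymul1l ymul1r ymulDl ymulDr.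

Lemma pyD x y : py (fadd x y) = py x + py y. Proof. exact: esym (yaddE x y). Qed.
Lemma py0 : py [::] = 0. Proof. by []. Qed.
Lemma pyM x y : py (fmul x y) = py x * py y. Proof. exact: esym (ymulE x y). Qed.
Lemma pyNs x : py (fscale (-1) x) = - py x. Proof. exact: esym (yoppE x). Qed.
Lemma pyB x y : py (fsub x y) = py x - py y. Proof. by rewrite pyD pyNs. Qed.
Lemma py_comm x y : py (fcomm x y) = br (py x) (py y). Proof. by rewrite pyB !pyM. Qed.
Lemma py_pow x t : py (fpow x t) = py x ^+ t.
Proof. by elim: t => [|t IH]; rewrite ?expr0 // exprS -IH -pyM. Qed.
Lemma py_prod l : py (fprod l) = \prod_(x <- l) py x.
Proof. by elim: l => [|x l IH]; [rewrite big_nil|rewrite big_cons -IH -pyM]. Qed.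
Lemma py_suml l : py (fsuml l) = \sum_(x <- l) py x.
Proof. by elim: l => [|x l IH]; [rewrite big_nil|rewrite big_cons -IH -pyD]. Qed.

Definition ysc (c : C) : Yangian := py [:: (c, [::])].
Lemma ysc_is_zmod : zmod_morphism ysc.
Proof.
move=> a b; rewrite /ysc -pyB; apply: py_coef => w.
by rewrite fcoef_sub /fcoef !big_cons !big_nil /=; case: ifP; rewrite ?addr0 ?subr0.
Qed.
Lemma ysc_is_mon : monoid_morphism ysc.
Proof. by split=> // a b; rewrite /ysc -pyM. Qed.
HB.instance Definition _ := GRing.isZmodMorphism.Build C Yangian ysc ysc_is_zmod.
HB.instance Definition _ := GRing.isMonoidMorphism.Build C Yangian ysc ysc_is_mon.

Lemma pyZ c x : py (fscale c x) = ysc c * py x.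
Proof.
rewrite -pyM; apply: py_coef => w.
by rewrite fcoef_scale fmul_cons cats0 /fcoef big_map mulr_sumr.
Qed.
Lemma yscC c a : ysc c * a = a * ysc c.
Proof.
rewrite -[a]py_repr -!pyM; apply: py_coef => w; rewrite fmul_cons cats0.
rewrite fcoef_mul /fcoef big_map big_mkcond; apply: eq_bigr => b _.
by rewrite big_seq1 /= cats0 mulrC.
Qed.

Lemma valid_yrel x : yrel n x -> valid_fsum n x.
Proof.
case=> [[i [j [r [s [Ii [Ij ->]]]]]]|[[i [j [r [s [Ii [Ij [_ ->]]]]]]]|]].
- rewrite valid_sub valid_scale; apply/andP; split; last by rewrite valid_cat !valid_mul ?valid_ye.
  by rewrite valid_sub !valid_comm ?valid_ye.
- by rewrite valid_comm ?valid_ye.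
- by move=> [i [j [r1 [r2 [s [Ii [Ij [_ ->]]]]]]]]; rewrite valid_cat !valid_comm ?valid_ye.
Qed.

(** The way back from the ring to the ideal: on valid sums [vpart] is the identity. *)
Lemma py_yeq x y : valid_fsum n x -> valid_fsum n y -> py x = py y -> yeq n x y.
Proof. by move=> Vx Vy /pyP; rewrite /ysim vpart_id // valid_sub Vx. Qed.
Lemma py_yrel x : yrel n x -> py x = 0.
Proof.
move=> Hx; rewrite -py0; apply/pyP; rewrite /ysim vpart_id; last first.
  by rewrite valid_sub valid_yrel.
exists [:: (fone C, x, fone C)]; split; first by move=> t [<-|//].
by move=> w; rewrite /= /fsuml /= cats0 fmul1l fmul1r fcoef_sub fcoef_nil subr0.
Qed.

Definition yh : Yangian := ysc 2^-1.
Definition ygen i r : Yangian := py (ye R i r).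

Lemma yhC a : yh * a = a * yh. Proof. exact: yscC. Qed.
Lemma yh2 : yh + yh = 1.
Proof. by rewrite /yh -rmorphD /= (_ : 2^-1 + 2^-1 = 1) ?rmorph1 //; field. Qed.

Lemma y_rel1 i j r s : inI n i -> inI n j ->
  br (ygen i r.+1) (ygen j s) - br (ygen i r) (ygen j s.+1)
  = yh * (cartan i j)%:~R * (ygen i r * ygen j s + ygen j s * ygen i r).
Proof.
move=> Ii Ij; have : yrel n (fsub (fsub (fcomm (ye R i r.+1) (ye R j s)) (fcomm (ye R i r) (ye R j s.+1)))
              (fscale ((cartan i j)%:~R / 2%:R)
                      (fadd (fmul (ye R i r) (ye R j s)) (fmul (ye R j s) (ye R i r))))).
  by left; exists i, j, r, s.
move/py_yrel/eqP; rewrite pyB pyB !py_comm pyZ pyD !pyM subr_eq0 => /eqP ->.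
by rewrite rmorphM /= rmorph_int -/yh yhC.
Qed.
Lemma y_rel2 i j r s : inI n i -> inI n j -> cartan i j = 0 -> br (ygen i r) (ygen j s) = 0.
Proof.
move=> Ii Ij ij; rewrite -py_comm; apply: py_yrel.
by right; left; exists i, j, r, s.
Qed.
Lemma y_rel3 i j r1 r2 s : inI n i -> inI n j -> cartan i j = (-1)%Z ->
  br (ygen i r1) (br (ygen i r2) (ygen j s)) + br (ygen i r2) (br (ygen i r1) (ygen j s)) = 0.
Proof.
move=> Ii Ij ij; have /py_yrel : yrel n (fadd (fcomm (ye R i r1) (fcomm (ye R i r2) (ye R j s)))
    (fcomm (ye R i r2) (fcomm (ye R i r1) (ye R j s)))).
  by right; right; exists i, j, r1, r2, s.
by rewrite pyD !py_comm.
Qed.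

Definition y_rootv a b r : Yangian := rootv ygen a b r.

Lemma py_ebeta i j r : py (ebeta R i j r) = y_rootv i j.+1 r.
Proof.
rewrite /ebeta /y_rootv /rootv /ebr subSS; move: (iota _ _) => l.
have -> : ygen i r = py (ye R i r) by [].
elim: l (ye R i r) => [//|a l IH] x /=; by rewrite IH py_comm.
Qed.

Lemma valid_ebeta i j r : inDelta n i j -> valid_fsum n (ebeta R i j r).
Proof.
move=> D; rewrite /ebeta.
have : all (inI n) (iota i.+1 (j - i)).
  by apply/allP => a; rewrite mem_iota; move: D; rewrite /inDelta /inI; lia.
have : valid_fsum n (ye R i r) by apply: valid_ye; move: D; rewrite /inDelta /inI; lia.
move: (iota _ _) (ye R i r) => l; elim: l => [//|a l IH] x Vx /= /andP[Ia Il].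
by apply: IH => //; apply: valid_comm => //; apply: valid_ye.
Qed.
End YangianRing.

(** * Divided powers and the base change *)

Section ZHalf.
Variable F : fieldType.
Lemma zhalf_nat m : zhalf F (m%:Z, 0%N) = m%:R.
Proof. by rewrite /zhalf /= expr0 divr1. Qed.
Lemma zhalfN a m : zhalf F (- a, m) = - zhalf F (a, m).
Proof. by rewrite /zhalf /= rmorphN mulNr. Qed.
Lemma zhalfS a m : zhalf F (a, m.+1) = 2^-1 * zhalf F (a, m).
Proof. by rewrite /zhalf /= exprS invfM mulrCA. Qed.
Lemma zhalfM a m b l : zhalf F (a, m) * zhalf F (b, l) = zhalf F (a * b, (m + l)%N).
Proof. by rewrite /zhalf /= exprD invfM rmorphM mulrACA. Qed.
End ZHalf.

Section DividedPowers.
Variables (R : realType) (n : nat).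
Notation C := (complex R).
Notation Y := (Yangian R n).
Implicit Types x y z : Y.

Definition dp x t : Y := locked (ysc n (t`!%:R^-1) * x ^+ t).
Lemma dpE x t : dp x t = ysc n (t`!%:R^-1) * x ^+ t.
Proof. by rewrite /dp -lock. Qed.

Lemma ysc_nat m : ysc n (m%:R : C) = m%:R. Proof. exact: rmorph_nat. Qed.

(** Positive integers are invertible through [ysc], so identities between divided powers may be
    checked after multiplying by factorials. *)
Lemma natY_inj m x y : (0 < m)%N -> m%:R * x = m%:R * y -> x = y.
Proof.
case: m => // m _ /(congr1 (fun u => ysc n (m.+1%:R^-1 : C) * u)).
by rewrite !mulrA -ysc_nat -rmorphM /= mulVf ?pnatr_eq0 // rmorph1 !mul1r.
Qed.

Lemma dp0 x : dp x 0 = 1.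
Proof. by rewrite !dpE expr0 fact0 invr1 rmorph1 mulr1. Qed.
Lemma fact_dp x t : t`!%:R * dp x t = x ^+ t.
Proof.
by rewrite !dpE mulrA -ysc_nat -rmorphM /= mulfV ?rmorph1 ?mul1r // pnatr_eq0 -lt0n fact_gt0.
Qed.
Lemma dpS x t : x * dp x t = t.+1%:R * dp x t.+1.
Proof.
rewrite !dpE exprS mulrA -yscC -mulrA [RHS]mulrA; congr (_ * _).
rewrite -ysc_nat -rmorphM /=; congr (ysc n _).
by rewrite factS natrM invfM mulrA mulfV ?mul1r // pnatr_eq0.
Qed.
Lemma commr_dp x z t : GRing.comm x z -> GRing.comm x (dp z t).
Proof.
move=> xz; rewrite /GRing.comm dpE mulrA -yscC -!mulrA; congr (_ * _).
exact: commrX.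
Qed.

Section Heisenberg.
Variables x y z : Y.
Hypothesis xyz : br x y = z.
Hypothesis xz : br x z = 0.
Hypothesis yz : br y z = 0.

Let cxz : GRing.comm x z. Proof. by apply/eqP; rewrite -subr_eq0; apply/eqP. Qed.
Let cyz : GRing.comm y z. Proof. by apply/eqP; rewrite -subr_eq0; apply/eqP. Qed.
Let xyE : x * y = y * x + z. Proof. by rewrite -xyz /br addrC subrK. Qed.

Lemma mul_exp_r j : x * y ^+ j.+1 = y ^+ j.+1 * x + j.+1%:R * (y ^+ j * z).
Proof.
elim: j => [|j IH]; first by rewrite !expr1 expr0 !mul1r.
rewrite exprSr mulrA IH mulrDl -mulrA xyE mulrDr mulrA -exprSr -addrA; congr (_ + _).
rewrite -!mulrA -cyz [y ^+ j * _]mulrA -exprSr -{1}[y ^+ j.+1 * z]mul1r -mulrDl.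
by rewrite -[1]/(1%:R) -natrD.
Qed.

Lemma mul_dp_r j : x * dp y j.+1 = dp y j.+1 * x + dp y j * z.
Proof.
apply: (@natY_inj j.+1`!); first exact: fact_gt0.
have cn w u : w%:R * (x * u) = x * (w%:R * u).
  by rewrite !mulrA; congr (_ * _); apply: esym; apply: commr_nat.
rewrite cn fact_dp mul_exp_r [RHS]mulrDr [X in _ = X + _]mulrA fact_dp; congr (_ + _).
by rewrite factS natrM -mulrA; congr (_ * _); rewrite mulrA fact_dp.
Qed.

(** For k > a the truncated difference would leave a spurious divided power of [z]; hence the
    explicit 0. *)
Definition hT (a k : nat) : Y := if (k <= a)%N then dp z k * dp x (a - k) else 0.

Lemma mul_hT a k : x * hT a k = (a.+1 - k)%:R * hT a.+1 k.
Proof.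
rewrite /hT; case: (leqP k a) => [ka|ka].
  rewrite leqW // mulrA (commr_dp k cxz) -mulrA dpS -subSn // !mulrA.
  by rewrite (commr_nat (dp z k) _ : _ * _ = _).
rewrite mulr0; case: leqP => ka'; last by rewrite mulr0.
by rewrite (_ : (a.+1 - k)%N = 0%N) ?mul0r //; lia.
Qed.
Lemma z_mul_hT a k : z * hT a k = k.+1%:R * hT a.+1 k.+1.
Proof.
rewrite /hT ltnS; case: ifP => _; last by rewrite !mulr0.
by rewrite mulrA dpS subSS mulrA.
Qed.

(** Kostant-type ordering formula for a Heisenberg triple. In the induction on [a], left
    multiplication by [x] produces the k-th term with coefficients a + 1 - k and k, which add up to
    a + 1 for every k. *)
Lemma dp_mul_dp a m : dp x a * dp y m = \sum_(k < m.+1) dp y (m - k) * hT a k.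
Proof.
elim: a => [|a IH].
  rewrite dp0 mul1r big_ord_recl /= subn0 /hT /= !dp0 !mulr1.
  by rewrite big1 ?addr0 // => k _; rewrite mulr0.
apply: (@natY_inj a.+1) => //.
rewrite mulrA -dpS -mulrA IH mulr_sumr.
have E k : (k < m)%N -> x * (dp y (m - k) * hT a k) =
    (a.+1 - k)%:R * (dp y (m - k) * hT a.+1 k) + k.+1%:R * (dp y (m - k.+1) * hT a.+1 k.+1).
  move=> km; rewrite (_ : (m - k)%N = (m - k.+1).+1); last lia.
  rewrite mulrA mul_dp_r mulrDl -!mulrA mul_hT z_mul_hT !mulrA.
  by rewrite !(commr_nat (dp y _) _ : _ * _ = _).
rewrite big_ord_recr /= subnn dp0 mul1r mul_hT.
under eq_bigr do rewrite E //.
rewrite big_split /= addrAC.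
pose U k := dp y (m - k) * hT a.+1 k.
have -> : \sum_(i < m) i.+1%:R * (dp y (m - i.+1) * hT a.+1 i.+1) = \sum_(k < m.+1) k%:R * U k.
  by rewrite big_ord_recl mul0r add0r; apply: eq_bigr => i _.
have -> : \sum_(i < m) (a.+1 - i)%:R * (dp y (m - i) * hT a.+1 i) + (a.+1 - m)%:R * hT a.+1 m
    = \sum_(k < m.+1) (a.+1 - k)%:R * U k.
  by rewrite big_ord_recr /= /U subnn dp0 mul1r.
rewrite -big_split mulr_sumr; apply: eq_bigr => k _ /=.
rewrite -mulrDl -natrD /U /hT; case: leqP => ka; last by rewrite !mulr0.
by rewrite subnK.
Qed.

(** The ordering formula with both exponents equal to t, solved for its term k = t. Only lower
    divided powers of [z] remain on the right, so the formula is a recursion. *)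
Lemma dp_br t : dp z t =
  dp x t * dp y t - \sum_(k < t) dp y (t - k) * (dp z k * dp x (t - k)).
Proof.
rewrite dp_mul_dp big_ord_recr /= subnn /hT leqnn subnn !dp0 mul1r mulr1.
rewrite (eq_bigr (fun k : 'I_t => dp y (t - k) * (dp z k * dp x (t - k)))); first by rewrite addrC addrK.
by move=> k _; rewrite ltnW.
Qed.
End Heisenberg.

Definition inbf (a : Y) := exists l : seq ((int * nat) * seq (nat * nat * nat)),
  (forall t g, t \in l -> g \in t.2 -> inI n g.1.1) /\
  a = \sum_(t <- l) ysc n (zhalf C t.1) * \prod_(g <- t.2) dp (ygen R n g.1.1 g.1.2) g.2.

Lemma py_ydp i r t : py n (ydp R i r t) = dp (ygen R n i r) t.
Proof. by rewrite /ydp pyZ py_pow dpE. Qed.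
Lemma py_ebeta_dp i j r t : py n (ebeta_dp R i j r t) = dp (y_rootv R n i j.+1 r) t.
Proof. by rewrite /ebeta_dp pyZ py_pow py_ebeta dpE. Qed.

Lemma py_bfY_sum (l : seq ((int * nat) * seq (nat * nat * nat))) :
  py n (fsuml [seq fscale (zhalf C t.1) (fprod [seq ydp R g.1.1 g.1.2 g.2 | g <- t.2]) | t <- l]) =
  \sum_(t <- l) ysc n (zhalf C t.1) * \prod_(g <- t.2) dp (ygen R n g.1.1 g.1.2) g.2.
Proof.
rewrite py_suml big_map; apply: eq_bigr => t _; rewrite pyZ py_prod big_map; congr (_ * _).
by apply: eq_bigr => g _; rewrite py_ydp.
Qed.

Lemma inbf_in_bfY (y : fsum C) : valid_fsum n y -> inbf (py n y) -> in_bfY n y.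
Proof.
move=> Vy [l [Hl E]]; exists l; split.
  by move=> t /InP tl g /InP gl; apply: Hl tl gl.
apply: py_yeq => //; last by rewrite py_bfY_sum.
apply/allP => cw /flattenP[x /mapP[t tl ->]].
suff /allP : valid_fsum n (fscale (zhalf C t.1) (fprod [seq ydp R g.1.1 g.1.2 g.2 | g <- t.2])) by exact.
rewrite valid_scale; apply: valid_prod => z /mapP[g gl ->].
by rewrite valid_scale valid_pow // valid_ye // (Hl t).
Qed.

Lemma inbf0 : inbf 0. Proof. by exists [::]; rewrite big_nil. Qed.
Lemma inbfD x y : inbf x -> inbf y -> inbf (x + y).
Proof.
move=> [l [Hl ->]] [l' [Hl' ->]]; exists (l ++ l'); split; last by rewrite big_cat.
by move=> t g; rewrite mem_cat => /orP[/Hl|/Hl']; apply.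
Qed.
Lemma inbf_sum (I : eqType) (r : seq I) (f : I -> Y) :
  (forall i, i \in r -> inbf (f i)) -> inbf (\sum_(i <- r) f i).
Proof.
elim: r => [|i r IH] H; first by rewrite big_nil; apply: inbf0.
rewrite big_cons; apply: inbfD; first by apply: H; rewrite inE eqxx.
by apply: IH => j jr; apply: H; rewrite inE jr orbT.
Qed.
Lemma inbfM x y : inbf x -> inbf y -> inbf (x * y).
Proof.
move=> [l [Hl ->]] [l' [Hl' ->]]; rewrite mulr_suml; apply: inbf_sum => -[[a m] u0] tl.
rewrite mulr_sumr; apply: inbf_sum => -[[a' m'] u1] tl'.
exists [:: ((a * a', (m + m')%N), u0 ++ u1)]; split.
  move=> u g; rewrite inE => /eqP -> /=; rewrite mem_cat => /orP[]; [exact: Hl tl|exact: Hl' tl'].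
rewrite big_seq1 big_cat /= -zhalfM.
move: (zhalf _ _) (zhalf _ _) (\prod_(_ <- _) _) (\prod_(_ <- _) _) => q q' P P'.
by rewrite rmorphM /= -!mulrA; congr (_ * _); rewrite !mulrA yscC.
Qed.
Lemma inbfsc q : inbf (ysc n (zhalf C q)).
Proof. by exists [:: (q, [::])]; rewrite big_seq1 big_nil mulr1; split=> // t g; rewrite inE => /eqP->. Qed.
Lemma inbfZ q x : inbf x -> inbf (ysc n (zhalf C q) * x).
Proof. by move=> Bx; apply: inbfM => //; apply: inbfsc. Qed.
Lemma inbfnat m : inbf (m%:R). Proof. by rewrite -ysc_nat -zhalf_nat; apply: inbfsc. Qed.
Lemma inbf1 : inbf 1. Proof. exact: (inbfnat 1). Qed.
Lemma inbfN x : inbf x -> inbf (- x).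
Proof.
move=> /(inbfZ (-1, 0%N)); rewrite zhalfN (zhalf_nat _ 1) rmorphN rmorph1 /= mulN1r; exact.
Qed.
Lemma inbfB x y : inbf x -> inbf y -> inbf (x - y).
Proof. by move=> Bx By; apply/inbfD/inbfN. Qed.
Lemma inbf_prod (I : eqType) (r : seq I) (f : I -> Y) :
  (forall i, i \in r -> inbf (f i)) -> inbf (\prod_(i <- r) f i).
Proof.
elim: r => [|i r IH] H; first by rewrite big_nil; apply: inbf1.
rewrite big_cons; apply: inbfM; first by apply: H; rewrite inE eqxx.
by apply: IH => j jr; apply: H; rewrite inE jr orbT.
Qed.
Lemma inbfg i r t : inI n i -> inbf (dp (ygen R n i r) t).
Proof.
move=> Ii; exists [:: ((1, 0%N), [:: (i, r, t)])]; split.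
  by move=> u g; rewrite inE => /eqP-> /=; rewrite inE => /eqP->.
by rewrite !big_seq1 (zhalf_nat _ 1) rmorph1 mul1r.
Qed.

(** Induction on the root and then on t: [dp_br] is applied to the root vector, the next generator
    of degree 0 and their bracket, a Heisenberg triple by [br_rootv_gen0] and [br_rootv_gen1]. *)
Lemma inbf_rootv a b r t : valid_root n a b -> inbf (dp (y_rootv R n a b r) t).
Proof.
case/and3P=> a1 ab bn; elim/ltn_ind_from: b / ab bn r t => [|b ab IH] bn r t.
  by rewrite /y_rootv rootv1; apply: inbfg; apply/inIP; lia.
have vab : valid_root n a b.+1 by apply/and3P; split; lia.
have Ib : inI n b by apply/inIP; lia.
have Ez : br (y_rootv R n a b r) (ygen R n b 0) = y_rootv R n a b.+1 r by rewrite /y_rootv rootvS.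
have H1 : br (y_rootv R n a b r) (y_rootv R n a b.+1 r) = 0.
  rewrite /y_rootv (rootvS _ _ ab); apply: (br_rootv_gen1 (n := n) (h := yh R n)) => //.
  - exact: yh2.
  - exact: y_rel2.
  - exact: y_rel3.
have H2 : br (ygen R n b 0) (y_rootv R n a b.+1 r) = 0.
  rewrite /y_rootv (rootvS _ _ ab); apply: (br_rootv_gen0 (n := n) (h := yh R n)) => //.
  - exact: yh2.
  - exact: y_rel2.
  - exact: y_rel3.
elim/ltn_ind: t => t IHt; rewrite (dp_br Ez H1 H2).
apply: inbfB; first by apply: inbfM; [apply: IH; lia|apply: inbfg].
rewrite -(big_mkord xpredT (fun k => dp (ygen R n b 0) (t - k) * (dp (y_rootv R n a b.+1 r) k * dp (y_rootv R n a b r) (t - k)))).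
apply: inbf_sum => k; rewrite mem_index_iota => /= kt.
by apply: inbfM; [apply: inbfg|apply: inbfM; [apply: IHt|apply: IH; lia]].
Qed.
End DividedPowers.

(** * Exponent functions as sorted lists of keys *)

Definition hkeys (h : hfun) : seq key := sort keyle (enum_fset (finsupp h)).
Definition hexp (h : hfun) : seq key := flatten [seq nseq (h a) a | a <- hkeys h].
Definition hcount (l : seq key) : hfun := [fsfun a in seq_fset tt l => count_mem a l].

Lemma hkeysE (h : hfun) a : (a \in hkeys h) = (h a != 0%N).
Proof. by rewrite mem_sort mem_finsupp. Qed.
Lemma hkeys_uniq (h : hfun) : uniq (hkeys h).
Proof. by rewrite sort_uniq fset_uniq. Qed.

Lemma hcountE l a : hcount l a = count_mem a l.
Proof.
rewrite /hcount fsfunE seq_fsetE; case: ifP => // /negbT al.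
by apply/esym/count_memPn.
Qed.

Lemma count_hexp (h : hfun) a : count_mem a (hexp h) = h a.
Proof.
rewrite /hexp count_flatten -map_comp.
rewrite (eq_map (g := fun b => ((b == a) * h b)%N)); last by move=> b /=; rewrite count_nseq.
rewrite sumnE big_map.
have [ah|] := boolP (a \in hkeys h).
  rewrite (bigD1_seq a) ?hkeys_uniq //= eqxx mul1n big1 ?addn0 // => b /negPf -> //.
rewrite hkeysE negbK => /eqP ha; rewrite ha; apply: big1 => b _.
by case: eqP => [->|]; rewrite ?ha ?muln0.
Qed.

Lemma sorted_hexp (h : hfun) : sorted keyle (hexp h).
Proof.
have : pairwise keyle (hkeys h).
  by rewrite -sorted_pairwise ?sort_sorted //; [exact: keyle_total|exact: keyle_trans].
rewrite /hexp sorted_pairwise; last exact: keyle_trans.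
elim: (hkeys h) => [//|a s IH] /= /andP[as_ /IH IHs].
rewrite pairwise_cat IHs andbT; apply/andP; split.
  apply/allrelP => x y /nseqP[-> _] /flattenP[z /mapP[b bs ->]] /nseqP[-> _].
  exact: (allP as_).
elim: (h a) => [//|m IHm] /=; rewrite IHm andbT all_nseq.
by case: (a) => [[i j] r]; rewrite /keyle !eqxx leqnn !orbT.
Qed.

Lemma hexp_inj (h h' : hfun) : perm_eq (hexp h) (hexp h') -> h = h'.
Proof.
move=> /permP E; apply/fsfunP => a.
by rewrite -!count_hexp E.
Qed.

Lemma hexp_hcount l : sorted keyle l -> hexp (hcount l) = l.
Proof.
move=> sl; apply: (sorted_eq keyle_trans keyle_anti (sorted_hexp _) sl).
by apply/allP => a _ /=; rewrite count_hexp hcountE.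
Qed.

Lemma hexp_mem h a : (a \in hexp h) = (h a != 0%N).
Proof. by rewrite -has_pred1 has_count count_hexp lt0n. Qed.

Lemma h_dom_hcount n l : all (valid_key n) l -> h_dom n (hcount l).
Proof.
move=> /allP H a; rewrite mem_finsupp hcountE -lt0n -has_count has_pred1.
exact: H.
Qed.

Section Spanning.
Variables (R : realType) (n : nat).
Notation C := (complex R).
Notation Y := (Yangian R n).

Lemma py_Eh h : py n (Eh R h) = mon (ygen R n) (hexp h).
Proof.
rewrite /Eh py_prod big_map /mon /hexp big_flatten big_map; apply: eq_bigr => a _.
by rewrite py_pow py_ebeta big_nseq iter_mulr_1.
Qed.

Lemma ordered_span_Eh (x : Y) : ordered_span n (ygen R n) (yh R n) x ->
  exists l : seq ((int * nat) * hfun), (forall t, t \in l -> h_dom n t.2) /\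
    x = \sum_(t <- l) ysc n (zhalf C t.1) * py n (Eh R t.2).
Proof.
elim=> {x} [|x y _ [l [Hl ->]] _ [l' [Hl' ->]]|x _ [l [Hl ->]]|x _ [l [Hl ->]]|l okl sl].
- by exists [::]; rewrite big_nil.
- exists (l ++ l'); split; last by rewrite big_cat.
  by move=> t; rewrite mem_cat => /orP[/Hl|/Hl'].
- exists [seq ((- t.1.1, t.1.2), t.2) | t <- l]; split.
    by move=> t /mapP[u /Hl + ->].
  rewrite big_map -sumrN; apply: eq_bigr => -[[a m] h] _ /=.
  by rewrite zhalfN rmorphN mulNr.
- exists [seq ((t.1.1, t.1.2.+1), t.2) | t <- l]; split.
    by move=> t /mapP[u /Hl + ->].
  rewrite big_map mulr_sumr; apply: eq_bigr => -[[a m] h] _ /=.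
  by rewrite zhalfS; move: (zhalf _ _) => q; rewrite rmorphM /= -mulrA.
exists [:: ((1, 0%N), hcount l)]; split.
  by move=> t; rewrite inE => /eqP-> /=; apply: h_dom_hcount.
by rewrite big_seq1 /= (zhalf_nat _ 1) rmorph1 mul1r py_Eh hexp_hcount.
Qed.

Lemma mon_Eh (l : seq key) : all (valid_key n) l ->
  exists l' : seq ((int * nat) * hfun), (forall t, t \in l' -> h_dom n t.2) /\
    mon (ygen R n) l = \sum_(t <- l') ysc n (zhalf C t.1) * py n (Eh R t.2).
Proof.
move=> okl; apply: ordered_span_Eh; apply: mon_ordered_span okl.
- exact: yhC.
- exact: yh2.
- exact: y_rel1.
- exact: y_rel2.
- exact: y_rel3.
Qed.
End Spanning.

(** * Calculus in the base change *)

Section Tensor.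
Variables (R : realType) (k : fieldType) (n : nat).
Notation C := (complex R).
Implicit Types (x y z : tsum R k) (c : k).

Lemma tcoef_cat x y w : tcoef (x ++ y) w = tcoef x w + tcoef y w.
Proof. by rewrite /tcoef big_cat. Qed.
Definition tscale (c : k) x : tsum R k := [seq (c * u.1, u.2) | u <- x].
Lemma tcoef_scale c x w : tcoef (tscale c x) w = c * tcoef x w.
Proof. by rewrite /tcoef /tscale big_map mulr_sumr. Qed.
Lemma tcoef_opp x w : tcoef [seq (- u.1, u.2) | u <- x] w = - tcoef x w.
Proof. by rewrite /tcoef big_map sumrN. Qed.
Lemma tcoef_sub x y w : tcoef (tsub x y) w = tcoef x w - tcoef y w.
Proof. by rewrite tcoef_cat tcoef_opp. Qed.
Lemma tcoef_nil w : tcoef ([::] : tsum R k) w = 0.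
Proof. by rewrite /tcoef big_nil. Qed.

Lemma tzero_coef x y : (forall w, tcoef x w = tcoef y w) -> tzero n x -> tzero n y.
Proof. by move=> E [l [Hl E']]; exists l; split=> // w; rewrite -E E'. Qed.
Lemma tzero_cat x y : tzero n x -> tzero n y -> tzero n (x ++ y).
Proof.
move=> [l [Hl E]] [l' [Hl' E']]; exists (l ++ l'); split.
  by move=> t H; case: (List.in_app_or _ _ _ H) => ?; [apply: Hl|apply: Hl'].
by move=> w; rewrite map_cat flatten_cat !tcoef_cat E E'.
Qed.
Lemma tzero_scale c x : tzero n x -> tzero n (tscale c x).
Proof.
move=> [l [Hl E]]; exists [seq (c * t.1, t.2) | t <- l]; split.
  by move=> t /List.in_map_iff [u [<- ul]] /=; apply: Hl.
move=> w; rewrite tcoef_scale E -tcoef_scale; congr tcoef.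
rewrite /tscale map_flatten -!map_comp; congr flatten; apply: eq_map => t /=.
by rewrite -map_comp; apply: eq_map => u /=; rewrite mulrA.
Qed.
Lemma tzero_gen x : tgen n x -> tzero n x.
Proof.
move=> gx; exists [:: (1, x)]; split; first by move=> t [<-|].
move=> w; rewrite /= cats0; congr tcoef; rewrite -[LHS]map_id; apply: eq_map => -[c y].
by rewrite mul1r.
Qed.

Lemma teq_coef x y : (forall w, tcoef x w = tcoef y w) -> teq n x y.
Proof.
move=> E; exists [::]; split=> // w.
by rewrite tcoef_sub E subrr tcoef_nil.
Qed.
Lemma teq_refl x : teq n x x. Proof. exact: teq_coef. Qed.
Lemma teq_sym x y : teq n x y -> teq n y x.
Proof.
move=> /(tzero_scale (-1)); apply: tzero_coef => w.
by rewrite tcoef_scale !tcoef_sub mulN1r opprB.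
Qed.
Lemma teq_trans y x z : teq n x y -> teq n y z -> teq n x z.
Proof.
move=> xy yz; apply: tzero_coef (tzero_cat xy yz) => w.
by rewrite tcoef_cat !tcoef_sub addrA subrK.
Qed.
Lemma teq_cat x x' y y' : teq n x x' -> teq n y y' -> teq n (x ++ y) (x' ++ y').
Proof.
move=> xy yz; apply: tzero_coef (tzero_cat xy yz) => w.
by rewrite tcoef_cat !tcoef_sub !tcoef_cat opprD addrACA.
Qed.
Lemma teq_scale c x x' : teq n x x' -> teq n (tscale c x) (tscale c x').
Proof.
move=> /(tzero_scale c); apply: tzero_coef => w.
by rewrite tcoef_scale !tcoef_sub !tcoef_scale mulrBr.
Qed.
Lemma teq_gen x y : tgen n (tsub x y) -> teq n x y.
Proof. exact: tzero_gen. Qed.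

Lemma teq_yeq c (a b : fsum C) : in_bfY n a -> in_bfY n b -> yeq n a b ->
  teq n [:: (c, a)] [:: (c, b)].
Proof.
move=> Ba Bb ab; have /(teq_scale c) : teq n [:: (1 : k, a)] [:: (1, b)].
  by apply: teq_gen; left; exists a, b.
by rewrite /tscale /= mulr1.
Qed.
Lemma teq_add c (a b : fsum C) : in_bfY n a -> in_bfY n b ->
  teq n [:: (c, a ++ b)] [:: (c, a); (c, b)].
Proof.
move=> Ba Bb; have /(teq_scale c) : teq n [:: (1 : k, a ++ b)] [:: (1, a); (1, b)].
  by apply: teq_gen; right; left; exists a, b.
by rewrite /tscale /= mulr1.
Qed.
Lemma teq_zhalf c q (a : fsum C) : in_bfY n a ->
  teq n [:: (c, fscale (zhalf C q) a)] [:: (c * zhalf k q, a)].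
Proof.
move=> Ba; have /(teq_scale c) : teq n [:: (1 : k, fscale (zhalf C q) a)] [:: (zhalf k q, a)].
  by apply: teq_gen; right; right; exists q, a.
by rewrite /tscale /= mulr1.
Qed.
Lemma teq_0 c (a : fsum C) : c = 0 -> teq n [:: (c, a)] [::].
Proof. by move=> ->; apply: teq_coef => w; rewrite /tcoef big_cons big_nil /= addr0 if_same. Qed.

Lemma teq_suml c (l : seq ((int * nat) * fsum C)) :
  (forall t, t \in l -> valid_fsum n t.2 /\ inbf (py n t.2)) ->
  teq n [:: (c, fsuml [seq fscale (zhalf C t.1) t.2 | t <- l])] [seq (c * zhalf k t.1, t.2) | t <- l].
Proof.
elim: l => [|[q a] l IH] H.
  have B0 : in_bfY n ([::] : fsum C) by apply: inbf_in_bfY => //; rewrite py0; apply: inbf0.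
  (* The empty sum tensor c vanishes: additivity gives 0 = 0 + 0 in the tensor product, and one copy
     is cancelled. *)
  have := @teq_add c [::] [::] B0 B0.
  move=> /(teq_cat (teq_refl [:: (- c, [::])])) /teq_sym E.
  apply: teq_trans (teq_trans _ E) _; apply: teq_coef => w; rewrite /tcoef !big_cons big_nil /=;
    by case: (_ == w); rewrite ?addr0 // ?addNr // addKr.
have [Va Ba] := H (q, a) (mem_head _ _).
have Hl t : t \in l -> valid_fsum n t.2 /\ inbf (py n t.2) by move=> tl; apply: H; rewrite inE tl orbT.
rewrite /= /fsuml /= -/(fsuml _); apply: teq_trans (teq_add _ _ _) _.
- apply: inbf_in_bfY; first by rewrite valid_scale.
  by rewrite pyZ; apply: inbfZ.
- apply: inbf_in_bfY.
    apply/allP => cw /flattenP[x /mapP[t /Hl [V B] ->]].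
    suff /allP : valid_fsum n (fscale (zhalf C t.1) t.2) by exact.
    by rewrite valid_scale.
  rewrite py_suml big_map; apply: inbf_sum => t /Hl [V B].
  by rewrite pyZ; apply: inbfZ.
rewrite -cat1s -[_ :: [seq _ | _ <- _]]cat1s; apply: teq_cat; last exact: IH.
by apply: teq_zhalf; apply: inbf_in_bfY.
Qed.

Definition powprod (g : seq (key * nat)) : fsum C :=
  fprod [seq fpow (ebeta R u.1.1.1 u.1.1.2 u.1.2) u.2 | u <- g].
Definition dpprod (g : seq (key * nat)) : fsum C :=
  fprod [seq ebeta_dp R u.1.1.1 u.1.1.2 u.1.2 u.2 | u <- g].
Definition factprod (g : seq (key * nat)) : nat := \prod_(u <- g) u.2`!.

Lemma py_powprod g : py n (powprod g) = \prod_(u <- g) rootv_key (ygen R n) u.1 ^+ u.2.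
Proof.
by rewrite py_prod big_map; apply: eq_bigr => u _; rewrite py_pow py_ebeta.
Qed.
Lemma py_dpprod g : py n (dpprod g) = \prod_(u <- g) dp (rootv_key (ygen R n) u.1) u.2.
Proof.
by rewrite py_prod big_map; apply: eq_bigr => u _; rewrite py_ebeta_dp.
Qed.
Lemma py_pow_dp g : py n (powprod g) = py n (fscale (zhalf C ((factprod g)%:Z, 0%N)) (dpprod g)).
Proof.
rewrite pyZ zhalf_nat ysc_nat py_powprod py_dpprod /factprod.
elim: g => [|u g IH]; first by rewrite !big_nil mulr1.
rewrite !big_cons natrM IH -(fact_dp _ u.2) -!mulrA; congr (_ * _).
rewrite !mulrA; congr (_ * _).
by rewrite (commr_nat (dp _ _) _ : _ * _ = _).
Qed.
Lemma valid_powprod g : all (fun u => valid_key n u.1) g -> valid_fsum n (powprod g).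
Proof.
move=> /allP ok; apply: valid_prod => x /mapP[u /ok ug ->].
by apply: valid_pow; apply: valid_ebeta.
Qed.
Lemma valid_dpprod g : all (fun u => valid_key n u.1) g -> valid_fsum n (dpprod g).
Proof.
move=> /allP ok; apply: valid_prod => x /mapP[u /ok ug ->].
by rewrite valid_scale; apply: valid_pow; apply: valid_ebeta.
Qed.
Lemma inbf_dpprod g : all (fun u => valid_key n u.1) g -> inbf (py n (dpprod g)).
Proof.
move=> /allP ok; rewrite py_dpprod; apply: inbf_prod => u /ok; rewrite valid_keyE => v.
exact: inbf_rootv.
Qed.
Lemma inbf_powprod g : all (fun u => valid_key n u.1) g -> inbf (py n (powprod g)).
Proof. by move=> ok; rewrite py_pow_dp pyZ; apply/inbfZ/inbf_dpprod. Qed.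

(** Here the factorials become scalars of k: invertible if all exponents are below p, zero as soon
    as one of them is at least p. *)
Lemma teq_powprod c g : all (fun u => valid_key n u.1) g ->
  teq n [:: (c, powprod g)] [:: (c * (factprod g)%:R, dpprod g)].
Proof.
move=> ok; have Vd := valid_dpprod ok; have Vp := valid_powprod ok.
have Bd := inbf_dpprod ok; have Bp := inbf_powprod ok.
rewrite -(zhalf_nat k); apply: teq_trans (teq_zhalf _ _ _); last exact: inbf_in_bfY.
apply: teq_yeq; first exact: inbf_in_bfY.
- by apply: inbf_in_bfY; rewrite ?valid_scale ?pyZ //; apply: inbfZ.
- by apply: py_yeq; rewrite ?valid_scale // py_pow_dp.
Qed.
End Tensor.

(** * The restricted E_h span the small Yangian *)

Section SmallYangian.
Variables (R : realType) (k : fieldType) (p n : nat).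
Hypothesis hp : p \in [pchar k].
Notation C := (complex R).

Definition hpairs (h : hfun) : seq (key * nat) := [seq (a, h a) | a <- hkeys h].

Lemma Eh_powprod h : Eh R h = powprod R (hpairs h).
Proof. by rewrite /Eh /powprod /hpairs -map_comp. Qed.
Lemma hpairs_ok h : h_dom n h -> all (fun u => valid_key n u.1) (hpairs h).
Proof.
move=> hd; apply/allP => u /mapP[a ah ->]; apply: hd.
by move: ah; rewrite mem_sort.
Qed.

Lemma p_unit t : (t < p)%N -> (t`!%:R : k) != 0.
Proof.
elim: t => [|t IH] tp; first by rewrite oner_eq0.
rewrite factS natrM mulf_neq0 ?IH //; last exact: ltnW.
by rewrite -(dvdn_pcharf hp) gtnNdvd.
Qed.
Lemma p_fact t : (p <= t)%N -> (t`!%:R : k) = 0.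
Proof.
move=> pt; apply/eqP; rewrite -(dvdn_pcharf hp); apply: dvdn_fact.
by rewrite pt (prime_gt0 (pcharf_prime hp)).
Qed.
Lemma factprod_unit (g : seq (key * nat)) : all (fun u => u.2 < p)%N g -> ((factprod g)%:R : k) != 0.
Proof.
rewrite /factprod; elim: g => [|u g IH] /=; first by rewrite big_nil oner_eq0.
by move=> /andP[up gp]; rewrite big_cons natrM mulf_neq0 ?p_unit ?IH.
Qed.

Lemma Eh_in_smallY (h : hfun) : h_dom n h -> p_restricted p h ->
  @in_smallY R k n p (@tbar R k (Eh R h)).
Proof.
move=> hd hr; have ok := hpairs_ok hd.
exists [:: (1 * (factprod (hpairs h))%:R, hpairs h)]; split.
  move=> t [<-|//] g /InP gh /=; split; first by move/allP: ok; apply.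
  by case/mapP: gh => a _ ->; rewrite -ltnS prednK // (leq_ltn_trans _ (hr a)).
by rewrite /tbar Eh_powprod; apply: teq_powprod.
Qed.

Lemma teq_Eh_nonrestricted (c : k) (h : hfun) : h_dom n h -> ~ p_restricted p h ->
  teq n [:: (c, Eh R h)] [::].
Proof.
move=> hd hr; have ok := hpairs_ok hd.
rewrite Eh_powprod; apply: teq_trans (teq_powprod R c ok) _; apply: teq_0.
have [a ha] : exists a, (p <= h a)%N.
  by apply: contrapT => H; apply: hr => a; rewrite ltnNge; apply/negP => pa; apply: H; exists a.
have ah : a \in hkeys h by rewrite hkeysE -lt0n (leq_trans _ ha) // (prime_gt0 (pcharf_prime hp)).
rewrite /factprod /hpairs big_map (bigD1_seq a) ?hkeys_uniq //= natrM p_fact //.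
by rewrite mul0r mulr0.
Qed.

Lemma h_dom_valid h : h_dom n h -> valid_fsum n (Eh R h) /\ inbf (py n (Eh R h)).
Proof.
by move=> /hpairs_ok ok; rewrite Eh_powprod; split; [apply: valid_powprod|apply: inbf_powprod].
Qed.

Definition restricted_span (x : tsum R k) := exists l : seq (k * hfun),
  (forall t, List.In t l -> h_dom n t.2 /\ p_restricted p t.2) /\ teq n x (@Ecomb R k l).

Lemma span_teq x y : teq n x y -> restricted_span y -> restricted_span x.
Proof. by move=> xy [l [Hl E]]; exists l; split=> //; apply: teq_trans E. Qed.
Lemma span_nil : restricted_span [::].
Proof. by exists [::]; split=> //; apply: teq_refl. Qed.
Lemma span_cat x y : restricted_span x -> restricted_span y -> restricted_span (x ++ y).
Proof.
move=> [l [Hl E]] [l' [Hl' E']]; exists (l ++ l'); split.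
  by move=> t H; case: (List.in_app_or _ _ _ H) => ?; [apply: Hl|apply: Hl'].
by rewrite /Ecomb map_cat; apply: teq_cat.
Qed.
Lemma span_map (T : eqType) (f : T -> k * fsum C) (l : seq T) :
  (forall t, t \in l -> restricted_span [:: f t]) -> restricted_span (map f l).
Proof.
elim: l => [|t l IH] H /=; first exact: span_nil.
rewrite -cat1s; apply: span_cat; first by apply: H; rewrite inE eqxx.
by apply: IH => u ul; apply: H; rewrite inE ul orbT.
Qed.

Lemma span_Eh c h : h_dom n h -> restricted_span [:: (c, Eh R h)].
Proof.
move=> hd; have [hr|hr] := pselect (p_restricted p h).
  exists [:: (c, h)]; split; first by move=> t [<-|].
  exact: teq_refl.
exact: span_teq (teq_Eh_nonrestricted _ hd hr) span_nil.
Qed.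

Lemma span_powprod c g : all (fun u => valid_key n u.1) g -> restricted_span [:: (c, powprod R g)].
Proof.
move=> ok; pose l := flatten [seq nseq u.2 u.1 | u <- g].
have okl : all (valid_key n) l.
  by apply/allP => a /flattenP[s /mapP[u ug ->]] /nseqP[-> _]; move/allP: ok; apply.
have [l' [Hl' E]] := mon_Eh R okl.
pose q := [seq (t.1, Eh R t.2) | t <- l'].
have Hq t : t \in q -> valid_fsum n t.2 /\ inbf (py n t.2).
  by case/mapP=> u /Hl' hd ->; apply: h_dom_valid.
have ql := teq_suml c Hq.
apply: (@span_teq _ [:: (c, fsuml [seq fscale (zhalf C t.1) t.2 | t <- q])]).
  have Bs : inbf (py n (fsuml [seq fscale (zhalf C t.1) t.2 | t <- q])).
    by rewrite py_suml big_map; apply: inbf_sum => t /Hq[V B]; rewrite pyZ; apply: inbfZ.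
  have Vs : valid_fsum n (fsuml [seq fscale (zhalf C t.1) t.2 | t <- q]).
    apply/allP => cw /flattenP[x /mapP[t /Hq [V B] ->]].
    suff /allP : valid_fsum n (fscale (zhalf C t.1) t.2) by exact.
    by rewrite valid_scale.
  apply: teq_yeq; [apply: inbf_in_bfY|apply: inbf_in_bfY|apply: py_yeq] => //.
  - exact: valid_powprod.
  - exact: inbf_powprod.
  - exact: valid_powprod.
  rewrite py_powprod py_suml big_map big_map; transitivity (mon (ygen R n) l).
    rewrite /mon /l big_flatten big_map; apply: eq_bigr => u _.
    by rewrite big_nseq iter_mulr_1.
  by rewrite E; apply: eq_bigr => t _; rewrite pyZ.
apply: span_teq ql _; apply: span_map => t /mapP[u /Hl' hd ->].
exact: span_Eh.
Qed.

(** Divided powers of exponent below p are plain powers up to a unit of k. So it is enough to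
    straighten products of plain powers with coefficients in Z[1/2], and to drop the nonrestricted
    terms. *)
Lemma smallY_span x : @in_smallY R k n p x -> restricted_span x.
Proof.
move=> [l [Hl E]]; apply: span_teq E _; apply: (@span_map _ (fun t => (t.1, dpprod R t.2))) => -[c g] /= cg.
have ok : all (fun u => valid_key n u.1) g.
  by apply/allP => u ug; have [] := Hl _ (elimT (InP _ _) cg) u (elimT (InP _ _) ug).
have gp : all (fun u => u.2 < p)%N g.
  apply/allP => u ug; have [_] := Hl _ (elimT (InP _ _) cg) u (elimT (InP _ _) ug).
  by rewrite -ltnS prednK // (prime_gt0 (pcharf_prime hp)).
apply: span_teq (span_powprod (c / (factprod g)%:R) ok); apply: teq_sym.
by have := teq_powprod R (c / (factprod g)%:R) ok; rewrite divfK ?factprod_unit.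
Qed.
End SmallYangian.

(** * The shuffle algebra *)

Lemma prod_disjU (D : comNzRingType) (P : finType) (S T : {set P}) (F : P -> D) :
  [disjoint S & T] -> \prod_(a in S :|: T) F a = \prod_(a in S) F a * \prod_(a in T) F a.
Proof. by move=> dST; rewrite -bigU //; apply: eq_bigl => a; rewrite !inE. Qed.

(* [col] and [X] do not occur in the carrier; they determine the product. *)
Definition Sh (D : comNzRingType) (P : finType) (col : P -> nat) (X : P -> D) :=
  {ffun {set P} -> D}.

Section ShuffleRing.
Variables (D : comNzRingType) (P : finType) (col : P -> nat) (X : P -> D).
Implicit Types (a b c : P) (S T U B : {set P}).

(* In the coordinates X = 2x the usual factor is (X - Y + c) / (X - Y).  It is multiplied by a function
   of the unordered pair of points so as to become a polynomial, except for c = 0, where it is 1. *)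
Definition zeta a b : D :=
  if col a == col b then (X a - X b + 2) * (X b - X a)
  else if col b == (col a).+1 then X a - X b - 1
  else if col a == (col b).+1 then X b - X a + 1
  else 1.

Definition zetaS S U : D := \prod_(a in S) \prod_(b in U) zeta a b.

Lemma zetaS0l U : zetaS set0 U = 1. Proof. by rewrite /zetaS big_set0. Qed.
Lemma zetaS0r S : zetaS S set0 = 1. Proof. by rewrite /zetaS big1 // => a _; rewrite big_set0. Qed.
Lemma zetaSUl S T U : [disjoint S & T] -> zetaS (S :|: T) U = zetaS S U * zetaS T U.
Proof. exact: prod_disjU. Qed.
Lemma zetaSUr S T U : [disjoint T & U] -> zetaS S (T :|: U) = zetaS S T * zetaS S U.
Proof. by move=> dTU; rewrite /zetaS -big_split; apply: eq_bigr => a _; rewrite prod_disjU. Qed.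
Lemma zetaS1l a U : zetaS [set a] U = \prod_(b in U) zeta a b.
Proof. by rewrite /zetaS big_set1. Qed.

Notation Sh := (Sh col X).
HB.instance Definition _ := GRing.Zmodule.copy Sh {ffun {set P} -> D}.
Implicit Types f g h : Sh.

Definition shone : Sh := [ffun B => (B == set0)%:R].
Definition shmul f g : Sh :=
  [ffun B : {set P} => \sum_(S : {set P} | S \subset B) f S * zetaS S (B :\: S) * g (B :\: S)].

(** Both sides are sums over ordered partitions of B into S, V, W with the factor zeta(S,V)
    zeta(S,W) zeta(V,W). *)
Lemma shmulA : associative shmul.
Proof.
move=> f g h; apply/ffunP => B; rewrite !ffunE.
under eq_bigr do rewrite ffunE mulr_sumr.
under [RHS]eq_bigr do rewrite ffunE !mulr_suml.
rewrite [RHS](exchange_big_dep (fun S => S \subset B)) /=; last first.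
  by move=> T S TB ST; apply: subset_trans TB.
apply: eq_bigr => S SB; rewrite [RHS](reindex_onto (fun V : {set P} => S :|: V) (fun T : {set P} => T :\: S)) /=; last first.
  by move=> T /andP[_ ST]; rewrite setDE setUIr setUCr setIT; apply/setUidPr.
have E (V : {set P}) : (V \subset B :\: S) = [&& S :|: V \subset B, S \subset S :|: V & (S :|: V) :\: S == V].
  rewrite subsetUl subUset SB subsetD /= setDUl setDv set0U; congr (_ && _).
  by apply/idP/eqP => [/setDidPl|/setDidPl].
apply: eq_big => [V|V VB]; first by rewrite E andbA.
have dVS : [disjoint S & V] by move: VB; rewrite subsetD disjoint_sym => /andP[].
have EV : (S :|: V) :\: S = V by apply/eqP; move: VB; rewrite E => /and3P[].
rewrite EV setDDl zetaSUl //.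
have VB' : V \subset B :\: S by [].
have -> : zetaS S (B :\: S) = zetaS S V * zetaS S (B :\: (S :|: V)).
  rewrite -zetaSUr; last by rewrite disjoints_subset; apply/subsetP => x xV; rewrite !inE xV orbT.
  congr (zetaS S _); apply/setP => x; rewrite !inE.
  move/subsetP/(_ x): VB'; rewrite !inE.
  by case: (x \in V); case: (x \in S); case: (x \in B) => //= H; have := H isT.
by ring.
Qed.
Lemma shmul1l : left_id shone shmul.
Proof.
move=> f; apply/ffunP => B; rewrite ffunE (bigD1 set0) ?sub0set //= ffunE eqxx zetaS0l setD0 !mul1r.
by rewrite big1 ?addr0 // => S /andP[_ /negPf S0]; rewrite ffunE S0 !mul0r.
Qed.
Lemma shmul1r : right_id shone shmul.
Proof.
move=> f; apply/ffunP => B; rewrite ffunE (bigD1 B) //= ffunE setDv eqxx zetaS0r !mulr1.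
rewrite big1 ?addr0 // => S /andP[SB /negPf S0]; rewrite ffunE setD_eq0.
by case: (boolP (B \subset S)) => BS; rewrite ?mulr0 //; move: S0; rewrite eqEsubset SB BS.
Qed.
Lemma shmulDl : left_distributive shmul +%R.
Proof.
move=> f g h; apply/ffunP => B; rewrite !ffunE -big_split; apply: eq_bigr => S _ /=.
by rewrite ffunE !mulrDl.
Qed.
Lemma shmulDr : right_distributive shmul +%R.
Proof.
move=> f g h; apply/ffunP => B; rewrite !ffunE -big_split; apply: eq_bigr => S _ /=.
by rewrite ffunE !mulrDr.
Qed.
HB.instance Definition _ := GRing.Zmodule_isPzRing.Build Sh shmulA shmul1l shmul1r shmulDl shmulDr.

Lemma shDE f g B : (f + g) B = f B + g B. Proof. by rewrite ffunE. Qed.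
Lemma shNE f B : (- f) B = - f B. Proof. by rewrite ffunE. Qed.
Lemma shBE f g B : (f - g) B = f B - g B. Proof. by rewrite shDE shNE. Qed.
Lemma sh0E B : (0 : Sh) B = 0. Proof. by rewrite ffunE. Qed.
Lemma sh1E B : (1 : Sh) B = (B == set0)%:R. Proof. by rewrite ffunE. Qed.
Lemma shME f g B : (f * g) B = \sum_(S : {set P} | S \subset B) f S * zetaS S (B :\: S) * g (B :\: S).
Proof. by rewrite ffunE. Qed.

Definition shsc (d : D) : Sh := [ffun B => if B == set0 then d else 0].
Lemma shscE d f B : (shsc d * f) B = d * f B.
Proof.
rewrite shME (bigD1 set0) ?sub0set //= ffunE eqxx zetaS0l setD0 mulr1.
by rewrite big1 ?addr0 // => S /andP[_ /negPf S0]; rewrite ffunE S0 !mul0r.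
Qed.
Lemma shscEr d f B : (f * shsc d) B = f B * d.
Proof.
rewrite shME (bigD1 B) //= ffunE setDv eqxx zetaS0r mulr1.
rewrite big1 ?addr0 // => S /andP[SB /negPf S0]; rewrite ffunE setD_eq0.
by case: (boolP (B \subset S)) => BS; rewrite ?mulr0 //; move: S0; rewrite eqEsubset SB BS.
Qed.
Lemma shscC d f : shsc d * f = f * shsc d.
Proof. by apply/ffunP => B; rewrite shscE shscEr mulrC. Qed.
Lemma shsc_is_zmod : zmod_morphism shsc.
Proof. by move=> x y; apply/ffunP => B; rewrite shBE !ffunE; case: ifP; rewrite ?subr0. Qed.
Lemma shsc_is_mon : monoid_morphism shsc.
Proof.
split; first by apply/ffunP => B; rewrite !ffunE; case: ifP.
by move=> x y; apply/ffunP => B; rewrite shscE !ffunE; case: ifP; rewrite ?mulr0.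
Qed.
HB.instance Definition _ := GRing.isZmodMorphism.Build D Sh shsc shsc_is_zmod.
HB.instance Definition _ := GRing.isMonoidMorphism.Build D Sh shsc shsc_is_mon.

Definition sing (phi : P -> D) : Sh := [ffun B : {set P} => \sum_a (B == [set a])%:R * phi a].

Lemma sing_mulE phi f B : (sing phi * f) B = \sum_(a in B) phi a * zetaS [set a] (B :\ a) * f (B :\ a).
Proof.
rewrite shME; under eq_bigr do rewrite ffunE -mulrA mulr_suml.
rewrite exchange_big /= (bigID (fun a => a \in B)) /= [X in _ + X]big1 ?addr0; last first.
  move=> a aB; apply: big1 => S SB; case: eqP => [Sa|]; last by rewrite !mul0r.
  by move: SB; rewrite Sa sub1set (negPf aB).
apply: eq_bigr => a aB; rewrite (bigD1 [set a]) ?sub1set //= eqxx mul1r mulrA.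
by rewrite big1 ?addr0 // => S /andP[_ /negPf->]; rewrite !mul0r.
Qed.

(** The sum runs over ordered pairs, so the variables may be renamed. Relations can then be checked
    for one fixed assignment of generators to points; likewise for [triple_sum]. *)
Definition pair_sum B (F : P -> P -> D) := \sum_a \sum_b (if (a != b) && (B == [set a; b]) then F a b else 0).
Definition triple_sum B (F : P -> P -> P -> D) :=
  \sum_a \sum_b \sum_c (if [&& a != b, a != c, b != c & B == a |: (b |: [set c])] then F a b c else 0).

Lemma pair_sum_swap B F : pair_sum B F = pair_sum B (fun a b => F b a).
Proof.
rewrite /pair_sum exchange_big; apply: eq_bigr => a _; apply: eq_bigr => b _.
by rewrite eq_sym setUC.
Qed.
Lemma triple_sum_swap12 B F : triple_sum B F = triple_sum B (fun a b c => F b a c).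
Proof.
rewrite /triple_sum exchange_big; apply: eq_bigr => a _; apply: eq_bigr => b _; apply: eq_bigr => c _.
by rewrite (eq_sym b a) (setUCA [set b]); case: (a != b) => //=; rewrite andbCA.
Qed.
Lemma triple_sum_swap23 B F : triple_sum B F = triple_sum B (fun a b c => F a c b).
Proof.
rewrite /triple_sum; apply: eq_bigr => a _; rewrite exchange_big; apply: eq_bigr => b _; apply: eq_bigr => c _.
by rewrite (eq_sym c b) (setUC [set c]) andbCA.
Qed.

Lemma pair_sum_add B F H : pair_sum B F + pair_sum B H = pair_sum B (fun a b => F a b + H a b).
Proof.
rewrite /pair_sum -big_split; apply: eq_bigr => a _; rewrite -big_split; apply: eq_bigr => b _ /=.
by case: ifP; rewrite ?addr0.
Qed.
Lemma pair_sum_opp B F : - pair_sum B F = pair_sum B (fun a b => - F a b).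
Proof.
rewrite /pair_sum -sumrN; apply: eq_bigr => a _; rewrite -sumrN; apply: eq_bigr => b _ /=.
by case: ifP; rewrite ?oppr0.
Qed.
Lemma pair_sum_mul B d F : d * pair_sum B F = pair_sum B (fun a b => d * F a b).
Proof.
rewrite /pair_sum mulr_sumr; apply: eq_bigr => a _; rewrite mulr_sumr; apply: eq_bigr => b _ /=.
by case: ifP; rewrite ?mulr0.
Qed.
Lemma triple_sum_add B F H : triple_sum B F + triple_sum B H = triple_sum B (fun a b c => F a b c + H a b c).
Proof.
rewrite /triple_sum -big_split; apply: eq_bigr => a _; rewrite -big_split; apply: eq_bigr => b _ /=.
by rewrite -big_split; apply: eq_bigr => c _ /=; case: ifP; rewrite ?addr0.
Qed.
Lemma triple_sum_opp B F : - triple_sum B F = triple_sum B (fun a b c => - F a b c).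
Proof.
rewrite /triple_sum -sumrN; apply: eq_bigr => a _; rewrite -sumrN; apply: eq_bigr => b _ /=.
by rewrite -sumrN; apply: eq_bigr => c _ /=; case: ifP; rewrite ?oppr0.
Qed.
Lemma pair_sum_0 B F : (forall a b, a != b -> F a b = 0) -> pair_sum B F = 0.
Proof.
by move=> H; rewrite /pair_sum big1 // => a _; apply: big1 => b _; case: ifP => // /andP[ab _]; apply: H.
Qed.
Lemma triple_sum_0 B F : (forall a b c, a != b -> F a b c = 0) -> triple_sum B F = 0.
Proof.
move=> H; rewrite /triple_sum big1 // => a _; apply: big1 => b _; apply: big1 => c _.
by case: ifP => // /and4P[ab _ _ _]; apply: H.
Qed.

Lemma setD1P2 a B T : (a \in B) && (B :\ a == T) = (a \notin T) && (B == a |: T).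
Proof.
apply/idP/idP => /andP[].
  by move=> aB /eqP <-; rewrite setD1K // eqxx andbT !inE eqxx.
by move=> aT /eqP ->; rewrite !inE eqxx /= setU1K // eqxx.
Qed.

Lemma sing_mul2 phi psi B : (sing phi * sing psi) B = pair_sum B (fun a b => phi a * psi b * zeta a b).
Proof.
rewrite sing_mulE /pair_sum big_mkcond; apply: eq_bigr => a _; rewrite ffunE mulr_sumr.
case: ifP => aB; last first.
  rewrite big1 // => b _; case: ifP => // /andP[_ /eqP Ba].
  by rewrite Ba !inE eqxx in aB.
apply: eq_bigr => b _; have := setD1P2 a B [set b]; rewrite aB inE /= => ->.
case: ifP => [|_]; last by rewrite mul0r mulr0.
move=> /andP[ab /eqP EB]; rewrite mul1r EB setU1K ?inE // zetaS1l big_set1.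
by rewrite mulrAC.
Qed.

Definition weight3 (phi psi chi : P -> D) a b c :=
  phi a * psi b * chi c * (zeta a b * zeta a c * zeta b c).

Lemma sing_mul3 phi psi chi B : (sing phi * (sing psi * sing chi)) B = triple_sum B (weight3 phi psi chi).
Proof.
rewrite sing_mulE /triple_sum big_mkcond; apply: eq_bigr => a _; rewrite sing_mul2 /pair_sum mulr_sumr.
case: ifP => aB; last first.
  rewrite big1 // => b _; rewrite big1 // => c _; case: ifP => // /and4P[_ _ _ /eqP Ba].
  by rewrite Ba !inE eqxx in aB.
apply: eq_bigr => b _; rewrite mulr_sumr; apply: eq_bigr => c _.
have := setD1P2 a B [set b; c]; rewrite aB !inE /= negb_or => ->.
rewrite -!andbA andbCA [X in if X then _ else _](_ : _ = [&& a != b, a != c, b != c & B == a |: (b |: [set c])]); last first.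
  by case: (a == b); case: (a == c); case: (b == c).
case: ifP => [|_]; last by rewrite mulr0.
move=> /and4P[ab ac bc /eqP EB]; rewrite EB setU1K ?inE ?negb_or ?ab ?ac // zetaS1l /weight3.
by rewrite big_setU1 ?inE //= big_set1; ring.
Qed.

(** Image of 2^r e_{i,r}, since X = 2x; the coefficient 1/2 of the first defining relation thereby
    disappears from [genS_rel1]. *)
Definition genS i r : Sh := sing (fun a => (col a == i)%:R * X a ^+ r).

Lemma genS_rel1 i j r s :
  br (genS i r.+1) (genS j s) - br (genS i r) (genS j s.+1) = (cartan i j)%:~R * (genS i r * genS j s + genS j s * genS i r).
Proof.
apply/ffunP => B.
have -> : (cartan i j)%:~R * (genS i r * genS j s + genS j s * genS i r) =
  shsc (cartan i j)%:~R * (genS i r * genS j s + genS j s * genS i r) by rewrite rmorph_int.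
rewrite shscE /br !shBE !shDE !sing_mul2.
(* After the swap the first point always carries the generator of colour [i], and the relation
   becomes an identity for each pair. *)
rewrite ![pair_sum B (fun a b => (col a == j)%:R * _ * _ * _)]pair_sum_swap.
rewrite pair_sum_add pair_sum_mul !pair_sum_opp !pair_sum_add pair_sum_opp pair_sum_add; apply/eqP; rewrite -subr_eq0 pair_sum_opp pair_sum_add; apply/eqP.
apply: pair_sum_0 => a b _.
have [ai|_] := eqVneq (col a) i; last by rewrite !(mul0r, mulr0); ring.
have [bj|_] := eqVneq (col b) j; last by rewrite !(mul0r, mulr0); ring.
rewrite /zeta /cartan ai bj (eq_sym j i) !exprS.
have [_|ij] := eqVneq i j; first by ring.
have [ji|ji] := eqVneq j i.+1.
  rewrite orbT; have /negPf -> : i != j.+1 by lia.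
  by ring.
by rewrite orbF; case: eqP => _; ring.
Qed.

Lemma genS_rel2 i j r s : cartan i j = 0 -> br (genS i r) (genS j s) = 0.
Proof.
move=> ij; apply/ffunP => B; rewrite /br sh0E shBE !sing_mul2.
rewrite [X in _ - X]pair_sum_swap pair_sum_opp pair_sum_add; apply: pair_sum_0 => a b _.
have [ai|_] := eqVneq (col a) i; last by rewrite !(mul0r, mulr0); ring.
have [bj|_] := eqVneq (col b) j; last by rewrite !(mul0r, mulr0); ring.
move: ij; rewrite /zeta /cartan ai bj (eq_sym j i).
case: eqVneq => // _; case: (boolP (i == j.+1)) => // _; case: (boolP (j == i.+1)) => // _ _.
by ring.
Qed.

Lemma brbr (x y z : Sh) : br x (br y z) = x * (y * z) - x * (z * y) - y * (z * x) + z * (y * x).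
Proof. by rewrite /br mulrBr mulrBl !mulrA opprB addrA addrAC. Qed.

Lemma sing_mul3_132 phi psi chi B :
  (sing phi * (sing psi * sing chi)) B = triple_sum B (fun a b c => weight3 phi psi chi a c b).
Proof. by rewrite sing_mul3 triple_sum_swap23. Qed.
Lemma sing_mul3_213 phi psi chi B :
  (sing phi * (sing psi * sing chi)) B = triple_sum B (fun a b c => weight3 phi psi chi b a c).
Proof. by rewrite sing_mul3 triple_sum_swap12. Qed.
Lemma sing_mul3_231 phi psi chi B :
  (sing phi * (sing psi * sing chi)) B = triple_sum B (fun a b c => weight3 phi psi chi b c a).
Proof. by rewrite sing_mul3_132 triple_sum_swap12. Qed.
Lemma sing_mul3_312 phi psi chi B :
  (sing phi * (sing psi * sing chi)) B = triple_sum B (fun a b c => weight3 phi psi chi c a b).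
Proof. by rewrite sing_mul3_213 triple_sum_swap23. Qed.
Lemma sing_mul3_321 phi psi chi B :
  (sing phi * (sing psi * sing chi)) B = triple_sum B (fun a b c => weight3 phi psi chi c b a).
Proof. by rewrite sing_mul3_231 triple_sum_swap23. Qed.

Lemma genS_rel3 i j r1 r2 s : cartan i j = (-1)%Z ->
  br (genS i r1) (br (genS i r2) (genS j s)) + br (genS i r2) (br (genS i r1) (genS j s)) = 0.
Proof.
move=> ij; apply/ffunP => B; rewrite !brbr sh0E !shDE !shNE /genS.
set p1 := fun a => _ * X a ^+ r1; set p2 := fun a => _ * X a ^+ r2; set q := fun a => _ * X a ^+ s.
(* Each product is reordered so that [a], [b], [c] carry [p1], [p2], [q]. These weights are then
   common factors, and what remains is a polynomial identity between the zeta factors. *)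
rewrite (sing_mul3 p1 p2) (sing_mul3_132 p1 q p2) (sing_mul3_231 p2 q p1) (sing_mul3_321 q p2 p1) (sing_mul3_213 p2 p1 q) (sing_mul3_312 q p1 p2).
rewrite !triple_sum_opp !triple_sum_add; apply: triple_sum_0 => a b c _.
rewrite /weight3 /p1 /p2 /q.
have [ai|_] := eqVneq (col a) i; last by rewrite !(mul0r, mulr0); ring.
have [bi|_] := eqVneq (col b) i; last by rewrite !(mul0r, mulr0); ring.
have [cj|_] := eqVneq (col c) j; last by rewrite !(mul0r, mulr0); ring.
move: ij; rewrite /zeta /cartan ai bi cj eqxx (eq_sym j i).
case: (eqVneq i j) => // _.
have [ji|ji] := eqVneq j i.+1.
  have /negPf -> : i != j.+1 by lia.
  by move=> _; ring.
by rewrite orbF; case: (boolP (i == j.+1)) => // _ _; ring.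
Qed.
End ShuffleRing.

(* Compare leading coefficients in the Lagrange interpolation of prod (T - x_b + c) - prod (T - x_b). *)
Lemma lagrange_count (K : fieldType) (P : finType) (x : P -> K) (B : {set P}) (c : K) :
  c != 0 -> {in B &, injective x} ->
  \sum_(a in B) \prod_(b in B :\ a) ((x a - x b + c) / (x a - x b)) = #|B|%:R.
Proof.
move=> c0 xinj; pose w a := \prod_(b in B :\ a) ((x a - x b + c) / (x a - x b)).
have [->|B0] := eqVneq B set0; first by rewrite big_set0 cards0.
pose m := #|B|.-1; have Bm : #|B| = m.+1 by rewrite /m prednK // card_gt0.
pose Q (S : {set P}) (y : P -> K) : {poly K} := \prod_(b in S) ('X - (y b)%:P).
have sQ S y : size (Q S y) = #|S|.+1 by rewrite /Q -big_enum /= size_prod_XsubC -cardE.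
have lQ S y : (Q S y)`_#|S| = 1.
  have /monicP := monic_prod_XsubC (enum S) xpredT y; rewrite /lead_coef.
  by rewrite big_enum /= -/(Q S y) sQ.
have cQ (S : {set P}) y l : #|S| = l.+1 -> (Q S y)`_l = - \sum_(b in S) y b.
  move=> Sl; rewrite /Q -!big_enum /=.
  have := @coefPn_prod_XsubC _ [seq y b | b <- enum S]; rewrite size_map -cardE Sl /= !big_map.
  by apply.
have hQ S y u : (Q S y).[u] = \prod_(b in S) (u - y b).
  by rewrite /Q horner_prod; apply: eq_bigr => b _; rewrite hornerXsubC.
(* The difference of the two monic products has degree below |B|, and the last sum interpolates it
   at the points x a; so [F] has |B| roots and too small a degree. Its coefficient just below degree
   |B| is c |B| minus c times the sum of the [w a]. *)
pose F : {poly K} := Q B (fun b => x b - c) - Q B x - \sum_(a in B) (c * w a) *: Q (B :\ a) x.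
have xne a b : a \in B -> b \in B :\ a -> x a - x b != 0.
  rewrite !inE => aB /andP[ba bB]; rewrite subr_eq0; apply: contraNneq ba => /xinj->//.
have F0 : F = 0.
  apply/eqP/negPn/negP => Fn0.
  have := max_poly_roots Fn0 (rs := [seq x a | a <- enum B]); rewrite size_map -cardE.
  have -> : uniq [seq x a | a <- enum B].
    by rewrite map_inj_in_uniq ?enum_uniq // => a b; rewrite !mem_enum; apply: xinj.
  have -> : all (root F) [seq x a | a <- enum B].
    apply/allP => u /mapP[a]; rewrite mem_enum => aB ->; rewrite /root /F !hornerD !hornerN horner_sum !hQ.
    have -> : \prod_(b in B) (x a - x b) = 0 by rewrite (big_setD1 a) //= subrr mul0r.
    have -> : \prod_(b in B) (x a - (x b - c)) = c * \prod_(b in B :\ a) (x a - x b + c).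
      rewrite (big_setD1 a) //= opprB addrC subrK; congr (_ * _); apply: eq_bigr => b _.
      by rewrite opprB addrA addrAC.
    have -> : \sum_(i in B) ((c * w i) *: Q (B :\ i) x).[x a] = c * w a * \prod_(b in B :\ a) (x a - x b).
      rewrite (big_setD1 a) //= hornerZ hQ [X in _ + X]big1 ?addr0 // => b /setD1P[ba bB].
      by rewrite hornerZ hQ (big_setD1 a) /= ?subrr ?mul0r ?mulr0 // !inE eq_sym ba.
    rewrite subr0 -mulrA -big_split /= subr_eq0; apply/eqP; congr (_ * _); apply: eq_bigr => b bB.
    by rewrite divfK ?xne.
  move=> /(_ isT isT); apply/negP; rewrite -leqNgt; apply/leq_sizeP => l.
  rewrite Bm leq_eqVlt => /orP[/eqP <-|ml].
    rewrite !coefB coef_sum -Bm !lQ subrr sub0r big1 ?oppr0 // => a aB.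
    rewrite coefZ nth_default ?mulr0 // sQ [in X in (_ <= X)%N](cardsD1 a) aB.
    by rewrite add1n ltnS.
  rewrite !coefB coef_sum !nth_default ?sQ ?Bm // subrr sub0r big1 ?oppr0 // => a aB.
  rewrite coefZ nth_default ?mulr0 // sQ; move: (cardsD1 a B); rewrite aB Bm add1n => -[<-].
  exact: leq_trans ml.
have : F`_m = 0 by rewrite F0 coef0.
rewrite !coefB coef_sum !(cQ _ _ _ Bm).
have -> : \sum_(i in B) ((c * w i) *: Q (B :\ i) x)`_m = \sum_(i in B) c * w i.
  apply: eq_bigr => a aB; rewrite coefZ; move: (cardsD1 a B); rewrite aB Bm add1n => -[->].
  by rewrite lQ mulr1.
rewrite -mulr_sumr sumrB opprB opprK subrK sumr_const => /eqP; rewrite subr_eq0 => /eqP E.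
by apply: (mulfI c0); rewrite -E mulr_natr.
Qed.

(** * Divided powers in the shuffle algebra *)

Section ShuffleDividedPower.
Variables (D : idomainType) (P : finType) (col : P -> nat) (X : P -> D).
Hypothesis D2 : (2 : D) != 0.
Hypothesis Xinj : forall a b, col a = col b -> X a = X b -> a = b.
Notation Sh := (Sh col X).

(** Both orders of each pair occur, so this is the discriminant up to sign. *)
Definition disc (S : {set P}) : D := \prod_(a in S) \prod_(b in S :\ a) (X a - X b).

Lemma disc_D1 a (S : {set P}) : a \in S ->
  disc S = disc (S :\ a) * \prod_(b in S :\ a) ((X a - X b) * (X b - X a)).
Proof.
move=> aS; rewrite /disc (big_setD1 a) //= big_split /= mulrCA; congr (_ * _).
rewrite mulrC -big_split /=; apply: eq_bigr => b /setD1P[ba bS].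
rewrite (big_setD1 a) /=; last by rewrite !inE eq_sym ba.
congr (_ * _); apply: eq_bigl => c.
by rewrite !inE; case: (c == a); case: (c == b).
Qed.

(** This is [lagrange_count] for c = 2 in the fraction field, with the denominators cleared by
    [disc S]. *)
Lemma disc_count (S : {set P}) i : (forall a, a \in S -> col a = i) ->
  \sum_(a in S) (\prod_(b in S :\ a) ((X a - X b + 2) * (X b - X a)) * disc (S :\ a)) = #|S|%:R * disc S.
Proof.
move=> Si; pose f : {rmorphism D -> {fraction D}} := @FracField.tofrac D.
have f_inj : injective f by move=> a b /eqP; rewrite tofrac_eq => /eqP.
apply: (f_inj); rewrite rmorphM rmorph_nat rmorph_sum /=.
have inj : {in S &, injective (fun a => f (X a))}.
  by move=> a b aS bS /f_inj /Xinj; apply; rewrite !Si.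
rewrite -(@lagrange_count _ P (fun a => f (X a)) S (f 2)) //; last by rewrite tofrac_eq0.
rewrite mulr_suml; apply: eq_bigr => a aS; rewrite (disc_D1 aS) !rmorphM mulrCA mulrC; congr (_ * _).
rewrite !rmorph_prod /= -big_split; apply: eq_bigr => b bS /=.
rewrite !(rmorphM, rmorphB, rmorphD) /=.
have : f (X a) - f (X b) != 0.
  rewrite subr_eq0; move/setD1P: bS => [ba bS]; apply: contraNneq ba => /inj->//.
by move=> H; rewrite mulrA divfK.
Qed.

(** An explicit t-th divided power of [genS i r], defined without division. This is what survives
    reduction modulo p. *)
Definition shdp i r t : Sh :=
  [ffun S : {set P} => if [forall a in S, col a == i] && (#|S| == t)
                       then (\prod_(a in S) X a ^+ r) * disc S else 0].

Lemma genS_shdp i r t : genS col X i r * shdp i r t = shsc col X t.+1%:R * shdp i r t.+1.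
Proof.
apply/ffunP => B; rewrite sing_mulE shscE !ffunE.
case: ifP => [/andP[/forall_inP Bi /eqP Bt]|BN]; last first.
  rewrite mulr0 big1 // => a aB; rewrite ffunE; case: eqP => [ai|]; last by rewrite !mul0r.
  case: ifP => [/andP[/forall_inP H /eqP Ht]|]; last by rewrite mulr0.
  case/negP: BN; apply/andP; split; last by rewrite (cardsD1 a) aB Ht.
  apply/forall_inP => b bB; have [->|ba] := eqVneq b a; first by rewrite ai.
  by apply: H; rewrite !inE ba.
rewrite mulrCA -Bt -(@disc_count B i); last by move=> a /Bi/eqP.
rewrite mulr_sumr; apply: eq_bigr => a aB; rewrite (eqP (Bi _ aB)) eqxx mul1r ffunE.
have -> : [forall b in B :\ a, col b == i] && (#|B :\ a| == t).
  apply/andP; split; last by move: (cardsD1 a B); rewrite aB Bt add1n => -[->].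
  by apply/forall_inP => b /setD1P[_ /Bi].
rewrite [in RHS](big_setD1 a) //= zetaS1l -!mulrA; congr (_ * _); rewrite mulrCA; congr (_ * (_ * _)).
apply: eq_bigr => b /setD1P[ba bB].
by rewrite /zeta (eqP (Bi _ aB)) (eqP (Bi _ bB)) eqxx.
Qed.

Lemma shdp0 i r : shdp i r 0 = 1.
Proof.
apply/ffunP => B; rewrite sh1E ffunE cards_eq0; case: eqP => [->|]; last by rewrite andbF.
rewrite big_set0 /disc big_set0 mul1r andbT ifT //.
by apply/forall_inP => a; rewrite inE.
Qed.

Lemma genS_exp i r t : genS col X i r ^+ t = shsc col X t`!%:R * shdp i r t.
Proof.
elim: t => [|t IH]; first by rewrite expr0 shdp0 rmorph1 mulr1.
rewrite exprS IH mulrA -shscC -mulrA genS_shdp mulrA -rmorphM /= factS natrM.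
by rewrite mulrC.
Qed.
End ShuffleDividedPower.

Section BaseChange.
Variables (D D' : comNzRingType) (f : {rmorphism D -> D'}) (P : finType) (col : P -> nat).
Variables (X : P -> D) (X' : P -> D').
Hypothesis XX' : forall a, X' a = f (X a).

Definition bc (g : Sh col X) : Sh col X' := [ffun B => f (g B)].

Lemma bc_zeta a b : zeta col X' a b = f (zeta col X a b).
Proof.
rewrite /zeta !XX'; do !case: ifP => _;
  by rewrite ?(rmorphM, rmorphB, rmorphD, rmorph1, rmorph_nat).
Qed.
Lemma bc_is_zmod : zmod_morphism bc.
Proof. by move=> g h; apply/ffunP => B; rewrite shBE !ffunE rmorphD rmorphN. Qed.
Lemma bc_is_mon : monoid_morphism bc.
Proof.
split; first by apply/ffunP => B; rewrite !ffunE rmorph_nat.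
move=> g h; apply/ffunP => B; rewrite shME ffunE shME rmorph_sum; apply: eq_bigr => S _.
rewrite !ffunE !rmorphM /zetaS rmorph_prod; congr (_ * _ * _); apply: eq_bigr => a _.
by rewrite rmorph_prod; apply: eq_bigr => b _; rewrite bc_zeta.
Qed.

Lemma bc_genS i r : bc (genS col X i r) = genS col X' i r.
Proof.
apply/ffunP => B; rewrite !ffunE rmorph_sum; apply: eq_bigr => a _.
by rewrite !rmorphM !rmorph_nat rmorphXn XX'.
Qed.
Lemma bc_inj : injective f -> injective bc.
Proof. by move=> fi g h /ffunP E; apply/ffunP => B; apply: fi; move: (E B); rewrite !ffunE. Qed.
End BaseChange.

Section FreeEvaluation.
Variables (K : comNzRingType) (A : pzRingType) (s : {rmorphism K -> A}) (g : letter -> A).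
Hypothesis sC : forall c a, s c * a = a * s c.

Definition weval (w : word) : A := \prod_(l <- w) g l.
Definition feval (x : fsum K) : A := \sum_(cw <- x) s cw.1 * weval cw.2.

Lemma feval_cat x y : feval (x ++ y) = feval x + feval y.
Proof. by rewrite /feval big_cat. Qed.
Lemma fevalZ c x : feval (fscale c x) = s c * feval x.
Proof.
by rewrite /feval big_map mulr_sumr; apply: eq_bigr => a _; rewrite /= rmorphM mulrA.
Qed.
Lemma feval_sub x y : feval (fsub x y) = feval x - feval y.
Proof. by rewrite feval_cat fevalZ rmorphN1 mulN1r. Qed.
Lemma fevalM x y : feval (fmul x y) = feval x * feval y.
Proof.
rewrite /feval /fmul big_flatten big_map mulr_suml; apply: eq_bigr => a _.
rewrite big_map mulr_sumr; apply: eq_bigr => b _ /=.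
rewrite /weval big_cat rmorphM /= -!mulrA; congr (_ * _).
by rewrite mulrA sC -mulrA.
Qed.
Lemma feval_comm x y : feval (fcomm x y) = br (feval x) (feval y).
Proof. by rewrite feval_sub !fevalM. Qed.
Lemma feval_one : feval (fone K) = 1.
Proof. by rewrite /feval big_seq1 /weval big_nil rmorph1 mulr1. Qed.
Lemma feval_gen l : feval (fgen K l) = g l.
Proof. by rewrite /feval big_seq1 /weval big_seq1 rmorph1 mul1r. Qed.
Lemma feval_pow x t : feval (fpow x t) = feval x ^+ t.
Proof. by elim: t => [|t IH]; rewrite ?expr0 ?feval_one // fevalM IH exprS. Qed.
Lemma feval_prod l : feval (fprod l) = \prod_(x <- l) feval x.
Proof. by elim: l => [|x l IH]; rewrite ?big_nil ?feval_one // big_cons fevalM IH. Qed.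
Lemma feval_suml l : feval (fsuml l) = \sum_(x <- l) feval x.
Proof. by elim: l => [|x l IH]; rewrite ?big_cons ?feval_cat ?IH // /feval !big_nil. Qed.
End FreeEvaluation.

(** * A functional on the base change with values over k *)

Section Points.
Variables (P : finType) (col : P -> nat) (DZ : idomainType) (XZ : P -> DZ).

Section FieldEval.
Variables (K : fieldType) (DK : comNzRingType) (iK : {rmorphism K -> DK}) (fK : {rmorphism DZ -> DK}).
Hypothesis K2 : (2 : K) != 0.

Definition posK (a : P) : DK := fK (XZ a).
Notation ShK := (Sh col posK).

Definition shK (c : K) : ShK := shsc col posK (iK c).
HB.instance Definition _ := GRing.RMorphism.copy shK (shsc col posK \o iK).

Lemma shKC c f : shK c * f = f * shK c.
Proof. exact: shscC. Qed.

(** This is x^r with x = X / 2, the image of e_{i,r} itself; the scaling restores the coefficient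
    1/2. *)
Definition gK i r : ShK := shK (2 ^- r) * genS col posK i r.

Lemma shK_mul (c d : K) x y : (shK c * x) * (shK d * y) = shK (c * d) * (x * y).
Proof. by rewrite -mulrA [x * _]mulrA -shKC rmorphM -!mulrA. Qed.
Lemma shK_br (c d : K) x y : br (shK c * x) (shK d * y) = shK (c * d) * br x y.
Proof. by rewrite /br !shK_mul [d * c]mulrC mulrBr. Qed.

Lemma gK_mul i j r s : gK i r * gK j s =
  shK (2 ^- (r + s)) * (genS col posK i r * genS col posK j s).
Proof. by rewrite /gK shK_mul exprD invfM. Qed.
Lemma gK_br i j r s : br (gK i r) (gK j s) =
  shK (2 ^- (r + s)) * br (genS col posK i r) (genS col posK j s).
Proof. by rewrite /gK shK_br exprD invfM. Qed.

Lemma gK_rel1 i j r s :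
  br (gK i r.+1) (gK j s) - br (gK i r) (gK j s.+1)
  = shK ((cartan i j)%:~R / 2) * (gK i r * gK j s + gK j s * gK i r).
Proof.
rewrite !gK_br !gK_mul [(s + r)%N]addnC -!mulrDr addnS addSn -mulrBr genS_rel1.
rewrite mulrA [RHS]mulrA -!rmorphM /=; congr (_ * _).
have -> : (cartan i j)%:~R = shK (cartan i j)%:~R :> ShK by rewrite rmorph_int.
rewrite -rmorphM; congr shK; rewrite exprS invfM; by rewrite mulrC mulrA.
Qed.
Lemma gK_rel2 i j r s : cartan i j = 0 -> br (gK i r) (gK j s) = 0.
Proof. by move=> ij; rewrite gK_br genS_rel2 // mulr0. Qed.
Lemma gK_br2 i j r1 r2 s : br (gK i r1) (br (gK i r2) (gK j s)) =
  shK (2 ^- (r1 + (r2 + s))) * br (genS col posK i r1) (br (genS col posK i r2) (genS col posK j s)).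
Proof.
by rewrite gK_br /gK shK_br -invfM -exprD.
Qed.
Lemma gK_rel3 i j r1 r2 s : cartan i j = (-1)%Z ->
  br (gK i r1) (br (gK i r2) (gK j s)) + br (gK i r2) (br (gK i r1) (gK j s)) = 0.
Proof. by move=> ij; rewrite !gK_br2 [(r2 + (r1 + s))%N]addnCA -mulrDr genS_rel3 // mulr0. Qed.

Definition bcK : Sh col XZ -> ShK := @bc _ _ fK P col XZ posK.
HB.instance Definition _ := GRing.isZmodMorphism.Build (Sh col XZ) ShK bcK (@bc_is_zmod _ _ _ _ _ _ _).
HB.instance Definition _ := GRing.isMonoidMorphism.Build (Sh col XZ) ShK bcK (bc_is_mon _ (fun a => erefl)).

Lemma shK_nat m : shK m%:R = m%:R. Proof. exact: rmorph_nat. Qed.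
Lemma shKN c : shK (- c) = - shK c. Proof. exact: rmorphN. Qed.
Lemma shK1 : shK 1 = 1. Proof. exact: rmorph1. Qed.
Lemma shKM c d : shK (c * d) = shK c * shK d. Proof. exact: rmorphM. Qed.

Lemma bcK_genS i r : bcK (genS col XZ i r) = genS col posK i r.
Proof. exact: bc_genS. Qed.

Lemma pow2_shK M : (2%:R ^+ M : ShK) = shK (2%:R ^+ M).
Proof. by rewrite rmorphXn /= shK_nat. Qed.

Lemma pow2_inj M (u v : ShK) : 2%:R ^+ M * u = 2%:R ^+ M * v -> u = v.
Proof.
rewrite pow2_shK => /(congr1 (fun w => shK (2%:R ^- M) * w)).
by rewrite !mulrA -!shKM mulVf ?shK1 ?mul1r // expf_neq0.
Qed.

Lemma zhalf_shK q : 2%:R ^+ q.2 * shK (zhalf K q) = bcK (q.1%:~R).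
Proof.
rewrite rmorph_int pow2_shK -shKM /zhalf mulrCA divff ?expf_neq0 // mulr1.
by rewrite rmorph_int.
Qed.

Lemma gK_exp i r t : gK i r ^+ t = shK (2 ^- (r * t)) * genS col posK i r ^+ t.
Proof.
rewrite /gK exprMn_comm; last exact: shKC.
by rewrite -rmorphXn /= exprVn -exprM.
Qed.

Hypothesis DZ2 : (2 : DZ) != 0.
Hypothesis XZ_inj : forall a b, col a = col b -> XZ a = XZ b -> a = b.

Lemma genS_exp_bc i r t : genS col posK i r ^+ t = t`!%:R * bcK (shdp col XZ i r t).
Proof.
rewrite -bcK_genS -rmorphXn genS_exp // /=.
by rewrite rmorphM /= !rmorph_nat.
Qed.

Lemma gK_exp_bc i r t : gK i r ^+ t = shK (t`!%:R * 2 ^- (r * t)) * bcK (shdp col XZ i r t).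
Proof. by rewrite gK_exp genS_exp_bc shKM shK_nat mulrA; congr (_ * _); apply: commr_nat. Qed.
End FieldEval.

Section ComplexEval.
Variables (R : realType) (n : nat).
Notation C := (complex R).
Variables (DC : comNzRingType) (iC : {rmorphism C -> DC}) (fC : {rmorphism DZ -> DC}).
Notation ShC := (Sh col (posK fC)).
Notation shC := (shK iC fC).
Notation gC := (gK iC fC).
Let shCC c f : shC c * f = f * shC c. Proof. exact: shKC. Qed.

Definition evC (x : fsum C) : ShC := feval shC (fun l : letter => gC l.1 l.2) x.

Lemma evC_coef x y : (forall w, fcoef x w = fcoef y w) -> evC x = evC y.
Proof.
move=> E; apply: (@lin_ext C word (ShC) (fun w c => shC c * weval (fun l : letter => gC l.1 l.2) w)) => //.
  by move=> t; rewrite rmorph0 mul0r.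
by move=> t a b; rewrite rmorphD mulrDl.
Qed.

Lemma evC_ye i r : evC (ye R i r) = gC i r.
Proof. exact: feval_gen. Qed.

Lemma evC_yrel x : yrel n x -> evC x = 0.
Proof.
have sC := shCC.
case=> [[i [j [r [s [_ [_ ->]]]]]]|[[i [j [r [s [_ [_ [ij ->]]]]]]]|]].
- rewrite /evC feval_sub feval_sub !(feval_comm _ sC) fevalZ feval_cat !(fevalM _ sC) -!/(evC _) !evC_ye.
  by rewrite gK_rel1 subrr.
- by rewrite /evC (feval_comm _ sC) -!/(evC _) !evC_ye gK_rel2.
move=> [i [j [r1 [r2 [s [_ [_ [ij ->]]]]]]]].
rewrite /evC feval_cat (feval_comm _ sC (ye R i r1)) (feval_comm _ sC (ye R i r2) (fcomm _ _)); by rewrite !(feval_comm _ sC) -!/(evC _) !evC_ye gK_rel3.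
Qed.

Lemma evC_yeq x y : yeq n x y -> evC x = evC y.
Proof.
move=> [l [Hl E]]; apply/eqP; rewrite -subr_eq0 /evC -feval_sub -/(evC _) (evC_coef E); apply/eqP.
have sC := shCC.
rewrite /evC feval_suml big_map big1_seq // => t /andP[_ tl].
have [_ [/evC_yrel H _]] := Hl _ (elimT (InP _ _) tl).
by rewrite !(fevalM _ sC) -/(evC t.1.2) H mulr0 mul0r.
Qed.

Variables (k : fieldType) (Dk : comNzRingType) (ik : {rmorphism k -> Dk}) (fk : {rmorphism DZ -> Dk}).
Notation Shk := (Sh col (posK fk)).
Notation shk := (shK ik fk).
Notation gk := (gK ik fk).
Hypothesis k2 : (2 : k) != 0.
Hypothesis fC_inj : injective fC.
Hypothesis DZ2 : (2 : DZ) != 0.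
Hypothesis XZ_inj : forall a b, col a = col b -> XZ a = XZ b -> a = b.

Let C2 : (2 : C) != 0. Proof. by rewrite pnatr_eq0. Qed.
Lemma bcKC_inj : injective (bcK fC).
Proof. exact: bc_inj. Qed.

Lemma pow2C (A : pzRingType) M (u : A) : (2%:R ^+ M) * u = u * (2%:R ^+ M).
Proof. by apply: commr_sym; apply: commrX; apply: commr_nat. Qed.

Lemma pow2_mul (A : pzRingType) M M' (u v : A) :
  2%:R ^+ (M + M') * (u * v) = (2%:R ^+ M * u) * (2%:R ^+ M' * v).
Proof. by rewrite exprD -!mulrA; congr (_ * _); rewrite mulrA pow2C -mulrA. Qed.

(* Up to a power of 2, u is integral and w is its reduction. *)
Definition rep (u : ShC) (w : Shk) := exists M (v : (Sh col XZ)),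
  2%:R ^+ M * u = bcK fC v /\ 2%:R ^+ M * w = bcK fk v.

(** After a common power of 2 the integral representative is determined by [u], because integral
    functions embed over C; over k that power of 2 is cancelled. *)
Lemma rep_uniq u w w' : rep u w -> rep u w' -> w = w'.
Proof.
move=> [M [v [E1 E2]]] [M' [v' [E1' E2']]].
have E : 2%:R ^+ M' * v = 2%:R ^+ M * v'.
  apply: bcKC_inj; rewrite !rmorphM !rmorphXn !rmorph_nat /= -E1 -E1'.
  by rewrite !mulrA -!exprD addnC.
apply: (@pow2_inj _ _ ik fk k2 (M' + M)); transitivity (bcK fk (2%:R ^+ M' * v)).
  by rewrite rmorphM rmorphXn rmorph_nat /= -E2 mulrA -exprD.
by rewrite E rmorphM rmorphXn rmorph_nat /= -E2' mulrA -exprD addnC.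
Qed.
Lemma rep_D u w u' w' : rep u w -> rep u' w' -> rep (u + u') (w + w').
Proof.
move=> [M [v [E1 E2]]] [M' [v' [E1' E2']]].
exists (M + M')%N, (2%:R ^+ M' * v + 2%:R ^+ M * v').
rewrite !rmorphD !rmorphM !rmorphXn !rmorph_nat /= -E1 -E1' -E2 -E2' !mulrA -!exprD.
by rewrite [(M' + M)%N]addnC -!mulrDr.
Qed.
Lemma rep_M u w u' w' : rep u w -> rep u' w' -> rep (u * u') (w * w').
Proof.
move=> [M [v [E1 E2]]] [M' [v' [E1' E2']]].
by exists (M + M')%N, (v * v'); rewrite !rmorphM /= !pow2_mul E1 E1' E2 E2'.
Qed.
Lemma rep_0 : rep 0 0. Proof. by exists 0%N, 0; rewrite !mulr0 !rmorph0. Qed.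
Lemma rep_1 : rep 1 1. Proof. by exists 0%N, 1; rewrite !mulr1 !expr0 !rmorph1. Qed.
Lemma rep_sum (I : eqType) (r : seq I) (f : I -> ShC) (g : I -> Shk) :
  (forall i, i \in r -> rep (f i) (g i)) -> rep (\sum_(i <- r) f i) (\sum_(i <- r) g i).
Proof.
elim: r => [|i r IH] H; first by rewrite !big_nil; apply: rep_0.
rewrite !big_cons; apply: rep_D; first by apply: H; rewrite inE eqxx.
by apply: IH => j jr; apply: H; rewrite inE jr orbT.
Qed.
Lemma rep_prod (I : eqType) (r : seq I) (f : I -> ShC) (g : I -> Shk) :
  (forall i, i \in r -> rep (f i) (g i)) -> rep (\prod_(i <- r) f i) (\prod_(i <- r) g i).
Proof.
elim: r => [|i r IH] H; first by rewrite !big_nil; apply: rep_1.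
rewrite !big_cons; apply: rep_M; first by apply: H; rewrite inE eqxx.
by apply: IH => j jr; apply: H; rewrite inE jr orbT.
Qed.
Lemma rep_zhalf q : rep (shC (zhalf C q)) (shk (zhalf k q)).
Proof.
by exists q.2, (q.1%:~R); rewrite !zhalf_shK.
Qed.
Lemma rep_N u w : rep u w -> rep (- u) (- w).
Proof.
move=> /(rep_M (rep_zhalf (-1, 0%N))).
by rewrite !zhalfN !(zhalf_nat _ 1) !rmorphN !rmorph1 !mulN1r.
Qed.
Lemma rep_br u w u' w' : rep u w -> rep u' w' -> rep (br u u') (br w w').
Proof. by move=> r r'; apply: rep_D; [|apply: rep_N]; apply: rep_M. Qed.

(** The factor t! cancels over C, before reduction; in k there is no division by t!. *)
Lemma rep_ydp i r t : rep (evC (ydp R i r t)) (shk (2 ^- (r * t)) * bcK fk (shdp col XZ i r t)).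
Proof.
exists (r * t)%N, (shdp col XZ i r t); rewrite (pow2_shK iC) (pow2_shK ik); split; last first.
  by rewrite mulrA -shKM mulfV ?shK1 ?mul1r // expf_neq0.
rewrite /evC /ydp fevalZ (feval_pow _ shCC) -/(evC _) evC_ye gK_exp_bc //.
rewrite !mulrA -!shKM [X in shC X](_ : _ = 1) ?shK1 ?mul1r //.
have f0 : t`!%:R != 0 :> C by rewrite pnatr_eq0 -lt0n fact_gt0.
by rewrite mulrA divfK // mulfV // expf_neq0.
Qed.

Lemma rep_gK i r : rep (gC i r) (gk i r).
Proof.
exists r, (genS col XZ i r); rewrite (pow2_shK iC) (pow2_shK ik) /gK !mulrA -!shKM.
by rewrite !mulfV ?expf_neq0 // !shK1 !mul1r !bcK_genS.
Qed.

Lemma rep_bfY y : in_bfY n y -> exists w, rep (evC y) w.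
Proof.
move=> [l [_ /evC_yeq ->]].
pose wdp i r t := shk (2 ^- (r * t)) * bcK fk (shdp col (XZ) i r t).
exists (\sum_(t <- l) shk (zhalf k t.1) * \prod_(g <- t.2) wdp g.1.1 g.1.2 g.2).
rewrite /evC feval_suml big_map; apply: rep_sum => t _; rewrite fevalZ; apply: rep_M.
  exact: rep_zhalf.
rewrite (feval_prod _ shCC) big_map; apply: rep_prod => g _.
exact: rep_ydp.
Qed.

(** Total on formal sums, so that [tpsi] is its linear extension to the free module. The relations
    of the base change only involve elements of bfY, where it is the reduction of [evC y]. *)
Definition psi (y : fsum C) : Shk :=
  match pselect (exists w, rep (evC y) w) with left H => sval (cid H) | right _ => 0 end.

Lemma psiE y w : rep (evC y) w -> psi y = w.
Proof.
move=> H; rewrite /psi; case: pselect => [H'|[]]; last by exists w.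
by apply: rep_uniq H; apply: (svalP (cid H')).
Qed.
Lemma psi_bfY y : in_bfY n y -> rep (evC y) (psi y).
Proof. by move=> /rep_bfY[w H]; rewrite (psiE H). Qed.

Definition tpsi (x : tsum R k) : Shk := \sum_(cy <- x) shk cy.1 * psi cy.2.

Lemma tpsi_cons c y (x : tsum R k) : tpsi ((c, y) :: x) = shk c * psi y + tpsi x.
Proof. by rewrite /tpsi big_cons. Qed.
Lemma tpsi_nil : tpsi [::] = 0.
Proof. by rewrite /tpsi big_nil. Qed.
Lemma tpsi_gen g : tgen n g -> tpsi g = 0.
Proof.
case=> [[y [y' [By [By' [yy ->]]]]]|[[y [y' [By [By' ->]]]]|[q [y [By ->]]]]].
- have E : psi y = psi y' by apply: psiE; rewrite (evC_yeq yy); apply: psi_bfY.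
  by rewrite !tpsi_cons tpsi_nil addr0 shKN shK1 mulN1r mul1r E subrr.
- have E : psi (fadd y y') = psi y + psi y'.
    by apply: psiE; rewrite /evC feval_cat; apply: rep_D; apply: psi_bfY.
  by rewrite !tpsi_cons tpsi_nil addr0 shKN shK1 !mulN1r mul1r E -opprD subrr.
have E : psi (fscale (zhalf C q) y) = shk (zhalf k q) * psi y.
  by apply: psiE; rewrite /evC fevalZ; apply: rep_M; [apply: rep_zhalf|apply: psi_bfY].
by rewrite !tpsi_cons tpsi_nil addr0 shKN shK1 mulNr mul1r E subrr.
Qed.

Lemma tpsi_zero x : tzero n x -> tpsi x = 0.
Proof.
move=> [l [Hl E]]; rewrite /tpsi.
rewrite (@lin_ext k (fsum C) (Shk) (fun y c => shk c * psi y) _ _ _ _ E).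
- rewrite big_flatten big_map big1_seq // => t /andP[_ tl]; rewrite big_map /=.
  under eq_bigr do rewrite rmorphM /= -mulrA.
  rewrite -mulr_sumr; have := tpsi_gen (Hl _ (elimT (InP _ _) tl)); rewrite /tpsi => ->.
  by rewrite mulr0.
- by move=> t; rewrite rmorph0 mul0r.
by move=> t a b; rewrite rmorphD mulrDl.
Qed.

Lemma rep_Eh (h : hfun) : rep (evC (Eh R h)) (mon gk (hexp h)).
Proof.
have -> : evC (Eh R h) = mon gC (hexp h).
  rewrite /evC (feval_prod _ shCC) big_map /mon /hexp big_flatten big_map; apply: eq_bigr => a _.
  rewrite (feval_pow _ shCC) big_nseq iter_mulr_1; congr (_ ^+ _).
  rewrite /ebeta /rootv_key /rootv /ebr subSS; move: (iota _ _) => l.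
  rewrite -evC_ye; elim: l (ye R _ _) => [//|b l IH] x /=; rewrite IH.
  by rewrite /evC (feval_comm _ shCC) -!/(evC _) evC_ye.
apply: rep_prod => a _; rewrite /rootv_key /rootv /ebr.
elim: (iota _ _) (gC _ _) (gk _ _) (rep_gK a.1.1 a.2) => [//|b l IH] u w uw /=.
by apply: IH; apply: rep_br => //; apply: rep_gK.
Qed.

Lemma Ecomb_zero (l : seq (k * hfun)) : tzero n (@Ecomb R k l) ->
  \sum_(t <- l) shk t.1 * mon gk (hexp t.2) = 0.
Proof.
move=> /tpsi_zero; rewrite /tpsi big_map => H; rewrite -[RHS]H; apply: eq_bigr => t _ /=.
by rewrite (psiE (rep_Eh _)).
Qed.
End ComplexEval.
End Points.

(** * Root vectors as functions on chains *)

Section Chains.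
Variables (P : finType) (col : P -> nat).
Implicit Types (S B : {set P}).

Definition card_col S l := #|[set a in S | col a == l]|.
Definition chainp i j S : bool :=
  [forall a in S, (i <= col a <= j)%N] && [forall l : 'I_j.+1, (i <= l)%N ==> (card_col S l == 1%N)].

Lemma chainpP i j S : reflect (forall l, card_col S l = (i <= l <= j)%N) (chainp i j S).
Proof.
apply: (iffP andP) => [[/forall_inP H1 /forallP H2] l|H].
  have [/andP[il lj]|lij] := boolP (i <= l <= j)%N.
    by have := H2 (Ordinal (lj : (l < j.+1)%N)); rewrite /= il => /eqP.
  apply/eqP; rewrite cards_eq0; apply/eqP/setP => a; rewrite !inE; apply/negP => /andP[aS /eqP al].
  by case/negP: lij; rewrite -al H1.
split; last by apply/forallP => l; apply/implyP => il; rewrite H il -ltnS ltn_ord.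
apply/forall_inP => a aS; have := H (col a); case: (_ <= _ <= _)%N => // /eqP.
by rewrite cards_eq0 => /eqP/setP/(_ a); rewrite !inE aS eqxx.
Qed.

Lemma card_col_D1 a S l : a \in S -> card_col S l = ((col a == l) + card_col (S :\ a) l)%N.
Proof.
move=> aS; rewrite /card_col (cardsD1 a) inE aS; congr (_ + _)%N; apply: eq_card => b.
by rewrite !inE andbA.
Qed.

Lemma chainp_col i j S a : chainp i j S -> a \in S -> (i <= col a <= j)%N.
Proof. by move=> /andP[/forall_inP H _]; apply: H. Qed.

Lemma chainp_ex i j S l : chainp i j S -> (i <= l <= j)%N -> exists2 a, a \in S & col a = l.
Proof.
move=> /chainpP/(_ l) + lij; rewrite lij => /eqP/cards1P[a E].
by have := set11 a; rewrite -E inE => /andP[aS /eqP al]; exists a.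
Qed.

Lemma chainp_inj i j S a b : chainp i j S -> a \in S -> b \in S -> col a = col b -> a = b.
Proof.
move=> ch aS bS ab; move/chainpP: (ch) => /(_ (col a)).
rewrite (chainp_col ch aS) => /eqP/cards1P[c E].
have : a \in [set c] by rewrite -E inE aS eqxx.
have : b \in [set c] by rewrite -E inE bS ab eqxx.
by rewrite !inE => /eqP-> /eqP->.
Qed.

Lemma chainp_S i j B a : (i <= j.+1)%N -> a \in B -> col a = j.+1 ->
  chainp i j.+1 B = chainp i j (B :\ a).
Proof.
move=> ij aB ca; apply/chainpP/chainpP => H l; have := H l; rewrite (card_col_D1 l aB) ca.
  by case: eqP => [<-|ne] /=; lia.
by move=> ->; case: eqP => [<-|ne] /=; lia.
Qed.

Lemma chainp1 i B : chainp i i B -> exists2 a, B = [set a] & col a = i.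
Proof.
move=> ch; have [a aB ca] := chainp_ex (l := i) ch (introT andP (conj (leqnn i) (leqnn i))).
exists a => //; apply/setP => b; rewrite inE; apply/idP/eqP => [bB|-> //].
apply: (chainp_inj ch) => //; have := chainp_col ch bB; lia.
Qed.
Lemma chainp_set1 i a : col a = i -> chainp i i [set a].
Proof.
move=> ca; apply/chainpP => l; rewrite (card_col_D1 _ (set11 a)) ca setDv /card_col.
rewrite [X in #|pred_of_set X|](_ : _ = set0) ?cards0; last by apply/setP => b; rewrite !inE.
by case: eqP; lia.
Qed.

Section Product.
Variables (D : comNzRingType) (X : P -> D).
Notation Sh := (Sh col X).

(** On a chain the inner sum has exactly one term, the power of X at the point of the first colour
    [i]. *)
Definition chainf i j r : Sh :=
  [ffun S : {set P} => if chainp i j S then \sum_(a in S | col a == i) X a ^+ r else 0].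

Lemma mul_singE (f : Sh) (phi : P -> D) B : (f * sing _ _ phi) B =
  \sum_(a in B) f (B :\ a) * zetaS col X (B :\ a) [set a] * phi a.
Proof.
rewrite shME; under eq_bigr do rewrite ffunE mulr_sumr.
rewrite exchange_big /= (bigID (fun a => a \in B)) /= [X in _ + X]big1 ?addr0; last first.
  move=> a aB; apply: big1 => S SB; case: eqP => [Sa|]; last by rewrite mul0r mulr0.
  by have := set11 a; rewrite -Sa inE (negPf aB) andbF.
apply: eq_bigr => a aB; rewrite (bigD1 (B :\ a)) ?subD1set //=.
have -> : B :\: (B :\ a) = [set a] by rewrite setDDr setDv set0U; apply/setIidPr; rewrite sub1set.
rewrite eqxx mul1r big1 ?addr0 // => S /andP[SB /negPf SN].
case: eqP => [E|]; last by rewrite mul0r mulr0.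
by move: SN; rewrite -E setDDr setDv set0U (setIidPr SB) eqxx.
Qed.

Lemma genS_chainf i r : genS col X i r = chainf i i r.
Proof.
apply/ffunP => B; rewrite !ffunE; case: ifP => [/chainp1[a -> ca]|nch].
  rewrite (bigD1 a) //= eqxx ca eqxx !mul1r big1 ?addr0; last first.
    by move=> b ba; rewrite (inj_eq set1_inj) eq_sym (negPf ba) mul0r.
  rewrite (big_pred1 a) // => b; rewrite /= inE; case: (eqVneq b a) => //= ->.
  by rewrite ca eqxx.
rewrite big1 // => a _; case: eqP => [Ba|]; last by rewrite mul0r.
case: eqP => [ca|]; last by rewrite mul0r mulr0.
by rewrite Ba chainp_set1 in nch.
Qed.

(** Only the point b of colour j interacts with [a]: zeta is X_b - X_a - 1 in one order and X_b -
    X_a + 1 in the other, so the positions cancel. *)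
Lemma zetaS_chain i j S a : (i <= j)%N -> chainp i j S -> col a = j.+1 ->
  zetaS col X S [set a] - zetaS col X [set a] S = - 2.
Proof.
move=> ij ch ca; have [b bS cb] : exists2 b, b \in S & col b = j.
  by apply: (chainp_ex ch); lia.
have far c : c \in S :\ b -> zeta col X c a = 1 /\ zeta col X a c = 1.
  case/setD1P => cb' cS; have := chainp_col ch cS => cc'.
  have ne : col c <> j by move=> cj; case/eqP: cb'; apply: (chainp_inj ch) => //; rewrite cj cb.
  rewrite /zeta ca.
  have /negPf -> : col c != j.+1 by lia.
  have /negPf -> : j.+1 != (col c).+1 by lia.
  have /negPf -> : col c != j.+2 by lia.
  by have /negPf -> : j.+1 != col c by lia.
rewrite zetaS1l /zetaS (big_setD1 b bS) /= big_set1 big1 ?mulr1; last first.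
  by move=> c cS; rewrite big_set1; have [] := far c cS.
rewrite (big_setD1 b bS) /= big1 ?mulr1; last by move=> c cS; have [] := far c cS.
rewrite /zeta ca cb eqxx.
have /negPf -> : j != j.+1 by lia.
have /negPf -> : j.+1 != j by lia.
have /negPf -> : j != j.+2 by lia.
by ring.
Qed.

(** Only the removal of the point of colour j + 1 contributes, with the constant of [zetaS_chain].
    Hence root vectors are exact scalar multiples of chain functions, with no lower terms. *)
Lemma chainf_rec i j r : (i <= j)%N -> br (chainf i j r) (genS col X j.+1 0) = shsc col X (- 2) * chainf i j.+1 r.
Proof.
move=> ij; apply/ffunP => B; rewrite /br shBE shscE mul_singE sing_mulE -sumrB.
rewrite (eq_bigr (fun a => -2 * ((col a == j.+1)%:R * chainf i j r (B :\ a)))); last first.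
  move=> a aB; rewrite expr0 mulr1; case: eqP => [ca|]; last by rewrite mulr0 !mul0r mulr0 subrr.
  rewrite mulr1 !mul1r ffunE; case: ifP => [ch|]; last by rewrite !(mul0r, mulr0) subrr.
  by rewrite mulrC -mulrBl (zetaS_chain ij ch ca).
rewrite -mulr_sumr; congr (_ * _); rewrite [RHS]ffunE; case: ifP => [ch|nch]; last first.
  rewrite big1 // => a aB; case: eqP => [ca|]; last by rewrite mul0r.
  by rewrite ffunE -(@chainp_S _ _ B a) ?nch ?mulr0 //; lia.
have [a aB ca] : exists2 a, a \in B & col a = j.+1 by apply: (chainp_ex ch); lia.
rewrite (bigD1 a) //= ca eqxx mul1r ffunE -(@chainp_S _ _ B a) ?ch //; last lia.
rewrite [X in _ + X]big1 ?addr0; last first.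
  move=> b /andP[bB ba]; case: eqP => [cb|]; last by rewrite mul0r.
  by case/eqP: ba; apply: (chainp_inj ch) => //; rewrite cb.
apply: eq_bigl => b; rewrite !inE; case: eqVneq => // -> /=.
have /negPf -> : col a != i by rewrite ca; lia.
by rewrite andbF.
Qed.
End Product.

Section Scaled.
Variables (DZ : idomainType) (XZ : P -> DZ).
Variables (K : fieldType) (DK : comNzRingType) (iK : {rmorphism K -> DK}) (fK : {rmorphism DZ -> DK}).
Notation ShK := (Sh col (posK XZ fK)).

(** The power of 1/2 comes from X = 2x, and each of the j - i brackets contributes a factor -2. *)
Definition kscal (a : key) : K := 2 ^- a.2 * (- 2) ^+ (a.1.2 - a.1.1).
Definition chainf_key (a : key) : ShK := chainf _ a.1.1 a.1.2 a.2.

Lemma rootv_chainf i j r : (i <= j)%N ->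
  rootv (gK col XZ iK fK) i j.+1 r = shK col XZ iK fK (2 ^- r * (- 2) ^+ (j - i)) * chainf (posK XZ fK) i j r.
Proof.
move=> /subnKC <-; elim: (j - i)%N => {j} [|m IH].
  by rewrite addn0 rootv1 subnn expr0 mulr1 /gK genS_chainf.
rewrite addnS rootvS ?IH; last lia.
rewrite /gK expr0 invr1 shK_br chainf_rec; last lia.
have -> : shsc col (posK XZ fK) (- 2) = shK col XZ iK fK (- 2).
  by congr (shsc _ _ _); rewrite rmorphN rmorph_nat.
rewrite mulrA -shKM; congr (_ * _); apply: congr1.
by rewrite !addKn -addnS addKn exprSr mulr1 mulrA.
Qed.

Lemma mon_chainf (n : nat) (l : seq key) : all (valid_key n) l ->
  mon (gK col XZ iK fK) l = shK col XZ iK fK (\prod_(a <- l) kscal a) * \prod_(a <- l) chainf_key a.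
Proof.
elim: l => [|a l IH] /=; first by rewrite /mon !big_nil shK1 mulr1.
case/andP=> oa /IH; rewrite mon_cons !big_cons => ->.
rewrite /rootv_key rootv_chainf; last by move: oa; rewrite /valid_key /inDelta; lia.
by rewrite -/(kscal a) shK_mul.
Qed.

Lemma kscal_neq0 (K2 : (2 : K) != 0) l : \prod_(a <- l) kscal a != 0.
Proof.
elim: l => [|a l IH]; first by rewrite big_nil oner_eq0.
by rewrite big_cons mulf_neq0 // /kscal mulf_neq0 // ?invr_eq0 expf_neq0 // oppr_eq0.
Qed.
End Scaled.
End Chains.

(** * Leading coefficients *)

Section TopCoefficient.
Variable R : comNzRingType.
Implicit Types (p q : {poly R}) (c : R).

(** Degree at most d, with [c] possibly 0, so that cancellation of leading terms in sums needs no
    case distinction. *)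
Definition top d p c := (size p <= d.+1)%N /\ p`_d = c.

Lemma top0 d : top d 0 0. Proof. by split; rewrite ?size_poly0 ?coef0. Qed.
Lemma top1 : top 0 1 1. Proof. by split; rewrite ?size_poly1 ?coef1. Qed.
Lemma topC c : top 0 c%:P c. Proof. by split; rewrite ?size_polyC_leq1 ?coefC. Qed.
Lemma top_gt d d' p c : (d < d')%N -> top d p c -> top d' p 0.
Proof. by move=> dd [sp _]; split; [apply: leq_trans sp _; lia|rewrite nth_default ?(leq_trans sp)]. Qed.
Lemma topD d p q c c' : top d p c -> top d q c' -> top d (p + q) (c + c').
Proof.
move=> [sp <-] [sq <-]; split; last by rewrite coefD.
by rewrite (leq_trans (size_polyD _ _)) // geq_max sp.
Qed.
Lemma topM d d' p q c c' : top d p c -> top d' q c' -> top (d + d') (p * q) (c * c').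
Proof.
move=> [sp <-] [sq <-]; split.
  by apply: leq_trans (size_polyMleq _ _) _; lia.
rewrite coefM (bigD1 (inord d)) //= inordK; last lia.
rewrite addKn big1 ?addr0 // => -[j jd] /= jne.
have [dj|jd'] := ltnP d j; first by rewrite nth_default ?mul0r // (leq_trans sp).
rewrite [X in _ * X]nth_default ?mulr0 // (leq_trans sq) //.
have : j != d by apply: contraNneq jne => jd0; apply/eqP/val_inj; rewrite /= inordK //; lia.
by lia.
Qed.
Lemma topX d p c r : top d p c -> top (d * r) (p ^+ r) (c ^+ r).
Proof.
move=> tp; elim: r => [|r IH]; first by rewrite muln0 !expr0; apply: top1.
by rewrite mulnS !exprS; apply: topM.
Qed.
Lemma top_sum (I : finType) (A : pred I) d (f : I -> {poly R}) g :
  (forall i, A i -> top d (f i) (g i)) -> top d (\sum_(i | A i) f i) (\sum_(i | A i) g i).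
Proof.
by move=> H; apply: (big_ind2 (fun p c => top d p c)) => //; [apply: top0|move=> *; apply: topD].
Qed.
Lemma top_prod (I : finType) (A : pred I) (d : I -> nat) (f : I -> {poly R}) g :
  (forall i, A i -> top (d i) (f i) (g i)) ->
  top (\sum_(i | A i) d i) (\prod_(i | A i) f i) (\prod_(i | A i) g i).
Proof.
move=> H; apply: (big_ind3 (fun d p c => top d p c)) => //; first exact: top1.
by move=> *; apply: topM.
Qed.
Lemma top_lin u v : top 1 (u%:P * 'X + v%:P) u.
Proof.
split; last by rewrite coefD coefCM coefX coefC mulr1 addr0.
rewrite (leq_trans (size_polyD _ _)) // geq_max (leq_trans (size_polyC_leq1 _)) // andbT.
by rewrite (leq_trans (size_polyMleq _ _)) // size_polyX; have := size_polyC_leq1 u; lia.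
Qed.
End TopCoefficient.

(** * Degree in T of products of chain functions *)

Section LeadingTerm.
Variables (R : idomainType) (I P : finType) (ch : P -> I) (col : P -> nat) (eta : I -> R).
Variable X : P -> {poly R}.
Hypothesis XE : forall a, X a = (eta (ch a))%:P * 'X.
Hypothesis pts : forall a b, ch a = ch b -> col a = col b -> a = b.
Hypothesis eta_inj : injective eta.
Implicit Types (S B U : {set P}) (a b : P).

(** Here [wt] and [lz] are the T-degree and the leading coefficient of zeta at two distinct points.
    Points of one chain have the same position, so their zeta is constant. *)
Definition wt a b : nat :=
  if ch a == ch b then 0 else if col a == col b then 2
  else if (col b == (col a).+1) || (col a == (col b).+1) then 1 else 0.
Definition lz a b : R :=
  if ch a == ch b then (if col b == (col a).+1 then -1 else 1)
  else if col a == col b then (eta (ch a) - eta (ch b)) * (eta (ch b) - eta (ch a))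
  else if col b == (col a).+1 then eta (ch a) - eta (ch b)
  else if col a == (col b).+1 then eta (ch b) - eta (ch a) else 1.

Lemma top_XB a b v : top 1 (X a - X b + v%:P) (eta (ch a) - eta (ch b)).
Proof. by rewrite !XE -mulrBl -polyCB; apply: top_lin. Qed.

Lemma top_zeta a b : a != b -> top (wt a b) (zeta col X a b) (lz a b).
Proof.
move=> ab; rewrite /wt /lz /zeta; case: (eqVneq (ch a) (ch b)) => cab.
  have /negPf -> : col a != col b by apply: contraNneq ab => /(pts cab)->.
  have -> : X a = X b by rewrite !XE cab.
  rewrite subrr sub0r add0r; case: ifP => _; first by rewrite -polyCN; apply: topC.
  by rewrite if_same; apply: top1.
case: ifP => _.
  apply: (topM (d := 1) (d' := 1)); first by rewrite -polyC_natr; apply: top_XB.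
  by have := top_XB b a 0; rewrite polyC0 addr0.
case: (col b == (col a).+1) => /=; first by have := top_XB a b (-1); rewrite polyCN polyC1.
case: (col a == _) => //=; last exact: top1.
by have := top_XB b a 1; rewrite polyC1.
Qed.

Lemma wtC a b : wt a b = wt b a.
Proof. by rewrite /wt (eq_sym (ch a)) (eq_sym (col a) (col b)) orbC. Qed.
Lemma lzC a b : ch a != ch b -> lz a b = lz b a.
Proof.
move=> cab; rewrite /lz (eq_sym (ch b)) (negPf cab) (eq_sym (col b) (col a)).
case: ifP => _; first by rewrite mulrC.
case: (eqVneq (col b) (col a).+1) => [E|] //.
by have /negPf -> : col a != (col b).+1 by lia.
Qed.
Lemma lz_neq0 a b : ch a != ch b -> lz a b != 0.
Proof.
move=> cab; have n1 : eta (ch a) - eta (ch b) != 0.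
  by rewrite subr_eq0; apply: contraNneq cab => /eta_inj->.
have n2 : eta (ch b) - eta (ch a) != 0 by rewrite -opprB oppr_eq0.
rewrite /lz (negPf cab); do !case: ifP => _ //; first by rewrite mulf_neq0.
by rewrite oner_eq0.
Qed.

Definition wtS S U := (\sum_(a in S) \sum_(b in U) wt a b)%N.
Definition lzS S U : R := \prod_(a in S) \prod_(b in U) lz a b.

Lemma top_zetaS S U : [disjoint S & U] -> top (wtS S U) (zetaS col X S U) (lzS S U).
Proof.
move=> dSU; apply: top_prod => a aS; apply: top_prod => b bU; apply: top_zeta.
by apply: contraTneq bU => <-; rewrite (disjointFr dSU aS).
Qed.

Definition before a b := (enum_rank a < enum_rank b)%N.
Definition inner_wt B := (\sum_(a in B) \sum_(b in B | before a b) wt a b)%N.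

Lemma sum_setID S B (A : pred P) (f : P -> nat) : S \subset B ->
  (\sum_(a in B | A a) f a = \sum_(a in S | A a) f a + \sum_(a in B :\: S | A a) f a)%N.
Proof.
move=> SB; rewrite (bigID (fun a => a \in S)) /=; congr (_ + _)%N; apply: eq_bigl => a.
  by rewrite andbAC; case aS : (a \in S); rewrite ?andbF // (subsetP SB).
by rewrite !inE; case: (a \in S); rewrite ?andbF ?andbT.
Qed.

(** A pair of points lies inside S, outside S or across, and [before] counts it once. As [wtS] is
    the degree of the zeta factor, a term of the shuffle product falls short of the full weight of B
    by the weight inside the supports. *)
Lemma inner_wt_split S B : S \subset B -> inner_wt B = (inner_wt S + inner_wt (B :\: S) + wtS S (B :\: S))%N.
Proof.
move=> SB; rewrite {1}/inner_wt; have := sum_setID xpredT _ SB => E.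
have E' f : (\sum_(a in B) f a = \sum_(a in S) f a + \sum_(a in B :\: S) f a)%N.
  have := E f; rewrite !(eq_bigl _ _ (fun a => andbT _)); exact.
rewrite E'; set U := B :\: S.
have Ei a : (\sum_(b in B | before a b) wt a b =
  \sum_(b in S | before a b) wt a b + \sum_(b in U | before a b) wt a b)%N by apply: sum_setID.
under eq_bigr do rewrite Ei; under [X in (_ + X)%N]eq_bigr do rewrite Ei.
rewrite !big_split /= -/(inner_wt S) -/(inner_wt U).
have -> : wtS S U = (\sum_(a in S) \sum_(b in U | before a b) wt a b +
                   \sum_(a in U) \sum_(b in S | before a b) wt a b)%N.
  rewrite [X in (_ + X)%N](exchange_big_dep (fun b => b \in S)) /=; last by move=> a b _ /andP[].
  rewrite -big_split; apply: eq_bigr => a aS /=; rewrite (bigID (before a)) /=; congr (_ + _)%N.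
  apply: eq_big => [b|b _]; last exact: wtC.
  rewrite aS /= /before -leqNgt leq_eqVlt; case bU : (b \in U) => //=.
  case: eqP => // /val_inj/enum_rank_inj E0.
  by move: bU; rewrite E0 inE aS.
lia.
Qed.

Lemma inner_wt0 S a b : inner_wt S = 0%N -> a \in S -> b \in S -> a != b -> wt a b = 0%N.
Proof.
move=> /eqP; rewrite sum_nat_eq0 => /forall_inP H aS bS ab.
have H' x y : x \in S -> y \in S -> before x y -> wt x y = 0%N.
  move=> xS yS xy; have := H x xS; rewrite sum_nat_eq0 => /forallP/(_ y).
  by rewrite yS xy => /eqP.
have [|ba] := boolP (before a b); first exact: H'.
rewrite wtC; apply: H' => //; move: ba; rewrite /before -leqNgt leq_eqVlt => /orP[/eqP/val_inj/enum_rank_inj E|//].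
by rewrite E eqxx in ab.
Qed.

Definition chain_top (k : key) S : R :=
  if chainp col k.1.1 k.1.2 S then \sum_(a in S | col a == k.1.1) eta (ch a) ^+ k.2 else 0.

Lemma top_chainf (k : key) S : top k.2 (chainf col X k.1.1 k.1.2 k.2 S) (chain_top k S).
Proof.
rewrite ffunE /chain_top; case: ifP => _; last exact: top0.
apply: top_sum => a _; rewrite XE.
have := top_lin (eta (ch a)) 0; rewrite addr0 => /(@topX _ _ _ _ k.2).
by rewrite mul1n.
Qed.

(* The leading coefficient of a product of chain functions on B: each factor must lie in one chain. *)
Fixpoint topval (l : seq key) B : R :=
  if l is k :: l' then \sum_(S : {set P} | (S \subset B) && (inner_wt S == 0%N)) chain_top k S * lzS S (B :\: S) * topval l' (B :\: S)
  else (B == set0)%:R.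

Lemma top_prod_chainf (l : seq key) B :
  top (kdeg l + inner_wt B) ((\prod_(k <- l) (chainf col X k.1.1 k.1.2 k.2 : Sh col X)) B) (topval l B).
Proof.
elim: l B => [|k l IH] B /=.
  rewrite big_nil sh1E; case: eqP => [->|_]; last exact: top0.
  by rewrite /kdeg big_nil /inner_wt big_set0; apply: top1.
rewrite big_cons shME kdeg_cons big_mkcondr; apply: top_sum => S SB.
have tS : top (k.2 + wtS S (B :\: S) + (kdeg l + inner_wt (B :\: S)))
    (chainf col X k.1.1 k.1.2 k.2 S * zetaS col X S (B :\: S) * (\prod_(k <- l) (chainf col X k.1.1 k.1.2 k.2 : Sh col X)) (B :\: S))
    (chain_top k S * lzS S (B :\: S) * topval l (B :\: S)).
  apply: topM (IH _); apply: topM; first exact: top_chainf.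
  by apply: top_zetaS; rewrite disjoint_sym disjoints_subset setDE subsetIr.
(* If the weight inside S is positive, the term has strictly smaller degree and contributes 0 to the
   leading coefficient. *)
rewrite (inner_wt_split SB); case: eqP => PS.
  by rewrite PS (_ : (_ + _ + _)%N = (k.2 + wtS S (B :\: S) + (kdeg l + inner_wt (B :\: S)))%N) //; lia.
by apply: top_gt tS; lia.
Qed.

(** Points of consecutive colours in different chains have weight 1, so the chain cannot change
    along the colours of S. *)
Lemma chain_single (k : key) S : chainp col k.1.1 k.1.2 S -> inner_wt S = 0%N ->
  forall a b, a \in S -> b \in S -> ch a = ch b.
Proof.
move=> cS P0.
have step a b : a \in S -> b \in S -> col b = (col a).+1 -> ch a = ch b.
  move=> aS bS cab; have ab : a != b by apply/eqP => E; move: cab; rewrite E; lia.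
  have := inner_wt0 P0 aS bS ab; rewrite /wt cab eqxx /=.
  have /negPf -> : col a != (col a).+1 by lia.
  by case: eqP.
have main d a b : a \in S -> b \in S -> col b = (col a + d)%N -> ch a = ch b.
  elim: d b => [|d IH] b aS bS.
    by rewrite addn0 => E; rewrite (chainp_inj cS aS bS).
  move=> cb; have ca := chainp_col cS aS; have cb' := chainp_col cS bS.
  have [x xS cx] : exists2 x, x \in S & col x = (col a + d)%N by apply: (chainp_ex cS); lia.
  by rewrite (IH x aS xS cx); apply: step => //; lia.
move=> a b aS bS; have [ab|/ltnW ab] := leqP (col a) (col b).
  by apply: (main (col b - col a)%N) => //; rewrite subnKC.
by symmetry; apply: (main (col a - col b)%N) => //; rewrite subnKC.
Qed.

Lemma card_chains (k : key) S B : chainp col k.1.1 k.1.2 S -> inner_wt S = 0%N -> S \subset B ->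
  (#|ch @: B| <= #|ch @: (B :\: S)|.+1)%N.
Proof.
move=> cS P0 SB; have : (#|ch @: S| <= 1)%N.
  apply/card_le1_eqP => _ _ /imsetP[a aS ->] /imsetP[b bS ->].
  by rewrite (chain_single cS P0 aS bS).
have : (#|ch @: B| <= #|ch @: S| + #|ch @: (B :\: S)|)%N.
  apply: leq_trans (leq_card_setU _ _); apply: subset_leq_card.
  by rewrite -imsetU; apply: imsetS; apply/subsetP => a aB; rewrite !inE aB andbT orbN.
by lia.
Qed.

(** Each contributing factor removes points of a single chain, so too few factors leave points of B
    uncovered. *)
Lemma topval_few (l : seq key) B : (size l < #|ch @: B|)%N -> topval l B = 0.
Proof.
elim: l B => [|k l IH] B /= lB.
  by case: eqP lB => // ->; rewrite imset0 cards0.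
rewrite big1 // => S /andP[SB /eqP P0]; rewrite /chain_top; case: ifP => [cS|]; last by rewrite !mul0r.
rewrite IH ?mulr0 //; have := card_chains cS P0 SB; lia.
Qed.

(** * Leading coefficients as sums over bijections from factors to chains *)

Section Matching.
Variables (K : I -> key) (B0 : {set P}).
Hypothesis K_le : forall c, ((K c).1.1 <= (K c).1.2)%N.
Hypothesis B0E : forall a, (a \in B0) = ((K (ch a)).1.1 <= col a <= (K (ch a)).1.2)%N.
Hypothesis pts_ex : forall c l, ((K c).1.1 <= l <= (K c).1.2)%N -> exists2 a, ch a = c & col a = l.
Implicit Types (C : {set I}) (c : I).

Definition chain_set c := [set a in B0 | ch a == c].
Definition chain_sets C := [set a in B0 | ch a \in C].

Lemma card_col_chain_set c l : card_col col (chain_set c) l = ((K c).1.1 <= l <= (K c).1.2)%N.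
Proof.
have [lc|lc] := boolP (_ <= l <= _)%N.
  have [a ac al] := pts_ex lc; apply/eqP/cards1P; exists a; apply/setP => b.
  rewrite !inE B0E; apply/idP/eqP => [/andP[/andP[_ /eqP bc] /eqP bl]|->].
    by apply: pts; rewrite ?bc ?ac ?bl ?al.
  by rewrite ac al lc !eqxx.
apply/eqP; rewrite cards_eq0; apply/eqP/setP => a; rewrite !inE B0E.
by apply/negP => /andP[/andP[ba /eqP ac] /eqP al]; case/negP: lc; rewrite -ac -al.
Qed.
Lemma chainp_chain_set c : chainp col (K c).1.1 (K c).1.2 (chain_set c).
Proof. by apply/chainpP => l; apply: card_col_chain_set. Qed.
Lemma chainp_chain_set_eq i j c : (i <= j)%N -> chainp col i j (chain_set c) -> (i, j) = (K c).1.
Proof.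
move=> ij /chainpP H.
have {H} H l : (i <= l <= j)%N = ((K c).1.1 <= l <= (K c).1.2)%N :> nat by rewrite -H card_col_chain_set.
have := H i; have := H j; have := H (K c).1.1; have := H (K c).1.2; have := K_le c.
by case: (K c).1 => i' j' /=; rewrite !leqnn ij /= => ij'; rewrite ij' /= => *; congr (_, _); lia.
Qed.
Lemma inner_wt_chain_set c : inner_wt (chain_set c) = 0%N.
Proof.
rewrite /inner_wt big1 // => a; rewrite inE => /andP[_ /eqP ac]; rewrite big1 // => b /andP[].
by rewrite inE => /andP[_ /eqP bc] _; rewrite /wt ac bc eqxx.
Qed.
Lemma chain_set_neq0 c : exists a, a \in chain_set c.
Proof.
have [a ac al] := @pts_ex c (K c).1.1 (introT andP (conj (leqnn _) (K_le c))).
by exists a; rewrite inE B0E ac al leqnn K_le eqxx.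
Qed.
Lemma chain_set_inj : injective chain_set.
Proof.
move=> c d E; have [a ac] := chain_set_neq0 c; have : a \in chain_set d by rewrite -E.
by move: ac; rewrite !inE => /andP[_ /eqP <-] /andP[_ /eqP].
Qed.
Lemma chain_setsD c C : c \in C -> chain_sets C :\: chain_set c = chain_sets (C :\ c).
Proof.
move=> cC; apply/setP => a; rewrite !inE negb_and.
by case: (a \in B0) => //=; rewrite andbC.
Qed.
Lemma chain_set_sub c C : c \in C -> chain_set c \subset chain_sets C.
Proof. by move=> cC; apply/subsetP => a; rewrite !inE => /andP[-> /eqP->]. Qed.

Lemma prod_chain_sets C (f : P -> R) : \prod_(a in chain_sets C) f a = \prod_(c in C) \prod_(a in chain_set c) f a.
Proof.
rewrite (partition_big ch (fun c => c \in C)) /=; last by move=> a; rewrite inE => /andP[].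
apply: eq_bigr => c cC; apply: eq_bigl => a; rewrite !inE.
by case: eqP => [->|]; rewrite ?cC ?andbT ?andbF.
Qed.

Definition gg (c d : I) := lzS (chain_set c) (chain_set d).
Lemma ggC (c d : I) : c != d -> gg c d = gg d c.
Proof.
move=> cd; rewrite /gg /lzS exchange_big /=; apply: eq_bigr => a; rewrite inE => /andP[_ /eqP ac].
apply: eq_bigr => b; rewrite inE => /andP[_ /eqP bd]; apply: lzC.
by rewrite ac bd.
Qed.
Lemma gg_neq0 (c d : I) : c != d -> gg c d != 0.
Proof.
move=> cd; apply/prodf_neq0 => a; rewrite inE => /andP[_ /eqP ac].
apply/prodf_neq0 => b; rewrite inE => /andP[_ /eqP bd]; apply: lz_neq0.
by rewrite ac bd.
Qed.
Lemma lzS_chain_set c C : lzS (chain_set c) (chain_sets C) = \prod_(d in C) gg c d.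
Proof.
rewrite /gg /lzS [RHS]exchange_big /=; apply: eq_bigr => a _.
exact: prod_chain_sets.
Qed.

Definition cbefore (c d : I) := (enum_rank c < enum_rank d)%N.
(** The zeta contribution common to all bijections: by symmetry of [gg] it does not depend on the
    order in which the factors use up the chains. *)
Definition GG C : R := \prod_(c in C) \prod_(d in C | cbefore c d) gg c d.

Lemma GG_neq0 C : GG C != 0.
Proof.
apply/prodf_neq0 => c _; apply/prodf_neq0 => d /andP[_ cd]; apply: gg_neq0.
by apply: contraTneq cd => ->; rewrite /cbefore ltnn.
Qed.

Lemma GG_D c C : c \in C -> GG C = (\prod_(d in C :\ c) gg c d) * GG (C :\ c).
Proof.
move=> cC; rewrite /GG (big_setD1 c) //=.
rewrite [X in _ * X](eq_bigr (fun d => (if cbefore d c then gg d c else 1) *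
   \prod_(x in C :\ c | cbefore d x) gg d x)); last first.
  move=> d _; case: ifP => dc.
    rewrite (bigD1 c) /= ?cC //; congr (_ * _); apply: eq_bigl => x; rewrite !inE.
    by case: (x == c); case: (x \in C); case: (cbefore d x).
  rewrite mul1r; apply: eq_bigl => x; rewrite !inE.
  by case: eqP => [->|]; rewrite ?dc ?andbF.
rewrite big_split /= mulrA; congr (_ * _).
rewrite -big_mkcondr /= [RHS](bigID (cbefore c)) /=; congr (_ * _).
  apply: eq_bigl => d; rewrite !inE; case: eqP => // ->.
  by rewrite /cbefore ltnn andbF.
apply: eq_big => [d|d /andP[/setD1P[dc _] _]]; last by apply: ggC.
rewrite !inE /cbefore -leqNgt ltn_neqAle; case: (eqVneq d c) => //= dc.
by rewrite (inj_eq (@ord_inj _)) (inj_eq enum_rank_inj) (negPf dc).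
Qed.

(** When [l] and [C] have the same size this is a permanent: the sum, over bijections from factors
    to chains that respect the roots, of the products of the eta_c^r. *)
Fixpoint matching_sum (l : seq key) C : R :=
  if l is k :: l' then \sum_(c in C | (K c).1 == k.1) eta c ^+ k.2 * matching_sum l' (C :\ c) else 1.

Lemma chain_top_chain_set (k : key) c : (K c).1 = k.1 -> chain_top k (chain_set c) = eta c ^+ k.2.
Proof.
move=> Kk; rewrite /chain_top -Kk chainp_chain_set (eq_bigr (fun _ => eta c ^+ k.2)); last first.
  by move=> a /andP[]; rewrite inE => /andP[_ /eqP ->].
rewrite big_const -/(card_col col (chain_set c) _).
have -> : #|[pred a in chain_set c | col a == (K c).1.1]| = card_col col (chain_set c) (K c).1.1.
  by rewrite /card_col; apply: eq_card => a; rewrite !inE.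
by rewrite card_col_chain_set leqnn K_le /= addr0.
Qed.

(** The support of the first factor lies in one chain. If it were a proper part of it, all |C|
    chains would still be met with only |C| - 1 factors left, which [topval_few] excludes. So
    supports are whole chains, and their colours force the root. *)
Lemma topval_matching (l : seq key) C : size l = #|C| -> all (fun k : key => k.1.1 <= k.1.2)%N l ->
  topval l (chain_sets C) = GG C * matching_sum l C.
Proof.
elim: l C => [|k l IH] C /=.
  move=> /esym/eqP; rewrite cards_eq0 => /eqP -> _.
  rewrite /GG big_set0 mulr1 (_ : chain_sets set0 = set0) ?eqxx //.
  by apply/setP => a; rewrite !inE andbF.
move=> lC /andP[kk okl].
pose F S := chain_top k S * lzS S (chain_sets C :\: S) * topval l (chain_sets C :\: S).
pose J := [set chain_set c | c in [set c in C | (K c).1 == k.1]].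
rewrite (bigID (fun S => S \in J)) /= [X in _ + X]big1 ?addr0; last first.
  move=> S /andP[/andP[SB /eqP P0] SJ]; rewrite /chain_top; case: ifP => [cS|]; last by rewrite !mul0r.
  have [x xS _] : exists2 x, x \in S & col x = k.1.1 by apply: (chainp_ex cS); rewrite leqnn.
  have chS y : y \in S -> ch y = ch x by move=> yS; apply: (chain_single cS P0).
  have SC : S \subset chain_set (ch x).
    apply/subsetP => y yS; rewrite inE chS // eqxx andbT.
    by move/subsetP/(_ y yS): SB; rewrite inE => /andP[].
  have xC : ch x \in C by move/subsetP/(_ x xS): SB; rewrite inE => /andP[].
  have [SE|SN] := eqVneq S (chain_set (ch x)).
    case/negP: SJ; apply/imsetP; exists (ch x) => //; rewrite inE xC /=.
    by move: cS; rewrite SE => /(chainp_chain_set_eq kk) <-; case: (k.1).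
  have [y yC yS] : exists2 y, y \in chain_set (ch x) & y \notin S.
    by apply/subsetPn; apply: contra SN => H; rewrite eqEsubset SC.
  rewrite topval_few ?mulr0 //; apply: (@leq_trans #|C|); first by rewrite -lC.
  apply: subset_leq_card; apply/subsetP => c cC.
  have [->|cx] := eqVneq c (ch x).
    move: (yC); rewrite inE => /andP[yB /eqP yx].
    by rewrite -yx; apply: imset_f; rewrite !inE yS yB yx.
  have [z] := chain_set_neq0 c; rewrite inE => /andP[zB /eqP zc].
  rewrite -zc; apply: imset_f; rewrite !inE zB zc cC !andbT.
  by apply: contra cx => /chS; rewrite zc => ->.
rewrite (eq_bigl (fun S => S \in J)); last first.
  move=> S; case: (boolP (S \in J)) => [/imsetP[c]|_]; last by rewrite andbF.
  by rewrite inE => /andP[cC _] ->; rewrite chain_set_sub // inner_wt_chain_set.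
rewrite big_imset /=; last by move=> c d _ _; apply: chain_set_inj.
rewrite mulr_sumr; apply: eq_big => [c|c]; rewrite inE // => /andP[cC /eqP Kk].
have sl : size l = #|C :\ c| by move: lC; rewrite (cardsD1 c) cC add1n => -[].
rewrite chain_setsD // chain_top_chain_set // lzS_chain_set IH // (GG_D cC).
by rewrite !mulrA; congr (_ * _); rewrite -[RHS]mulrC mulrA.
Qed.

Lemma chains_B0 : ch @: B0 = setT.
Proof.
apply/setP => c; rewrite inE; have [a] := chain_set_neq0 c; rewrite inE => /andP[aB /eqP <-].
exact: imset_f.
Qed.
Lemma chain_setsT : chain_sets setT = B0.
Proof. by apply/setP => a; rewrite !inE andbT. Qed.
End Matching.
End LeadingTerm.

Lemma digits_inj Q m (d d' : 'I_m -> nat) : (forall c, d c < Q)%N -> (forall c, d' c < Q)%N ->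
  (\sum_c d c * Q ^ c = \sum_c d' c * Q ^ c)%N -> forall c, d c = d' c.
Proof.
elim: m d d' => [|m IH] d d' dQ d'Q; first by move=> _ [].
have E (f : 'I_m.+1 -> nat) : (\sum_c f c * Q ^ c = f ord0 + Q * \sum_(c < m) f (lift ord0 c) * Q ^ c)%N.
  rewrite big_ord_recl expn0 muln1 big_distrr; congr (_ + _)%N; apply: eq_bigr => c _.
  by rewrite /= expnS mulnCA.
have Q0 : (0 < Q)%N := leq_ltn_trans (leq0n _) (dQ ord0).
rewrite !E => H.
have H0 : d ord0 = d' ord0.
  have := congr1 (modn^~ Q) H; rewrite /= ![(_ + Q * _)%N]addnC ![(Q * _)%N]mulnC !modnMDl.
  by rewrite !modn_small.
have H1 : forall c, d (lift ord0 c) = d' (lift ord0 c).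
  apply: IH => // ; move: H; rewrite H0 => /addnI/eqP.
  by rewrite eqn_pmul2l // => /eqP.
by move=> c; case: (unliftP ord0 c) => [c'|] ->.
Qed.

(** * Counting bijections by expansions in base Q *)

Section Coefficient.
Variables (k : fieldType) (Q m : nat) (K : 'I_m -> key).
Hypothesis Q1 : (1 < Q)%N.
Hypothesis KQ : forall c, ((K c).2 < Q)%N.
Implicit Types C : {set 'I_m}.

(* Exponents stay < Q, so a monomial in the [etaQ c] is determined by its degree, written in base Q. *)
Definition etaQ (c : 'I_m) : {poly k} := 'X^(Q ^ c).
Notation MQ := (matching_sum etaQ K).

(** Counts, for equal sizes, the bijections that respect the whole key and not only its root. *)
Fixpoint cnt (l : seq key) C : nat :=
  if l is a :: l' then (\sum_(c in C | K c == a) cnt l' (C :\ c))%N else 1%N.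
(** The product of the factorials of the multiplicities: the count includes the head, so a key of
    multiplicity m contributes m, m - 1, ..., 1. *)
Fixpoint multfact (l : seq key) : nat :=
  if l is a :: l' then (count_mem a l * multfact l')%N else 1%N.

Definition keysC C := [seq K c | c <- enum C].

Lemma keysC_D1 a l C c : c \in C -> K c = a ->
  perm_eq (a :: l) (keysC C) = perm_eq l (keysC (C :\ c)).
Proof.
move=> cC <-; have : perm_eq (keysC C) (K c :: keysC (C :\ c)).
  rewrite /keysC -map_cons; apply: perm_map; apply: uniq_perm.
  - exact: enum_uniq.
  - by rewrite /= enum_uniq mem_enum !inE eqxx.
  - by move=> d; rewrite inE !mem_enum !inE; case: eqP => [->|].
by move=> /permPr ->; rewrite perm_cons.
Qed.

Lemma count_keysC a C : count_mem a (keysC C) = #|[pred c in C | K c == a]|.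
Proof.
rewrite /keysC count_map -size_filter cardE /enum_mem -filter_predI; congr size.
by apply: eq_filter => c; rewrite !inE andbC.
Qed.

Lemma cntE (l : seq key) C : size l = #|C| ->
  cnt l C = if perm_eq l (keysC C) then multfact l else 0%N.
Proof.
elim: l C => [|a l IH] C lC.
  have -> : C = set0 by apply/eqP; rewrite -cards_eq0 -lC.
  by rewrite /keysC enum_set0.
rewrite [LHS]/=; rewrite (eq_bigr (fun _ => if perm_eq (a :: l) (keysC C) then multfact l else 0%N)); last first.
  move=> c /andP[cC /eqP Kc]; rewrite (keysC_D1 l cC Kc); apply: IH.
  by move: lC; rewrite (cardsD1 c) cC add1n => -[].
rewrite sum_nat_const; case: ifP => [pe|_]; last by rewrite muln0.
by congr (_ * _)%N; rewrite -[RHS]/(count_mem a (a :: l)) (permP pe) count_keysC.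
Qed.

Definition wtE C := (\sum_(c in C) (K c).2 * Q ^ c)%N.

(** Each chain receives a single factor, so its exponent is one digit and no carries occur. *)
Lemma matching_sum_supp (l : seq key) C e : all (fun a : key => a.2 < Q)%N l -> (MQ l C)`_e != 0 ->
  exists d : 'I_m -> nat, [/\ forall c, (d c < Q)%N, forall c, c \notin C -> d c = 0%N &
    e = (\sum_c d c * Q ^ c)%N].
Proof.
elim: l C e => [|a l IH] C e /=.
  rewrite coef1 => _; case: (eqVneq e 0%N) => [->|]; last by rewrite eqxx.
  by exists (fun _ => 0%N); split=> //; [move=> _; lia|rewrite big1].
move=> /andP[aQ lQ] ne.
have [c /and3P[cC _ ce]] : exists c, [&& c \in C, (K c).1 == a.1 & (etaQ c ^+ a.2 * MQ l (C :\ c))`_e != 0].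
  apply/existsP; apply: contraNT ne; rewrite negb_exists => /forallP H.
  rewrite coef_sum big1 // => c /andP[cC Kc]; apply/eqP/negPn/negP => ne'.
  by have := H c; rewrite cC Kc ne'.
move: ce; rewrite /etaQ -exprM coefXnM; case: ltnP => [_|le]; first by rewrite eqxx.
move=> /(IH _ _ lQ)[d [dQ dC de]].
exists (fun x => if x == c then a.2 else d x); split.
- by move=> x; case: ifP.
- move=> x xC; case: eqP => [xc|_]; first by rewrite xc cC in xC.
  by apply: dC; rewrite !inE (negPf xC) andbF.
rewrite (bigD1 c) //= eqxx -(subnKC le) de mulnC; congr (_ + _)%N.
rewrite (bigD1 c) //= dC ?inE ?eqxx // mul0n add0n; apply: eq_bigr => x /negPf -> //.
Qed.

(** Among the bijections that respect roots, only those that also respect the degree r at every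
    chain produce the exponent [wtE C]. *)
Lemma matching_sum_coef (l : seq key) C : size l = #|C| -> all (fun a : key => a.2 < Q)%N l ->
  (MQ l C)`_(wtE C) = (cnt l C)%:R.
Proof.
elim: l C => [|a l IH] C /=.
  by move=> /esym/eqP; rewrite cards_eq0 => /eqP -> _; rewrite /wtE big_set0 coef1.
move=> lC /andP[aQ lQ]; rewrite coef_sum natr_sum.
rewrite big_mkcond [RHS]big_mkcond; apply: eq_bigr => c _.
case cC : (c \in C) => //=.
have sl : size l = #|C :\ c| by move: lC; rewrite (cardsD1 c) cC add1n => -[].
have wD : wtE C = ((K c).2 * Q ^ c + wtE (C :\ c))%N by rewrite /wtE (big_setD1 c cC).
have EK : (K c == a) = ((K c).1 == a.1) && ((K c).2 == a.2) by rewrite -pair_eqE.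
rewrite EK; case: eqP => //= K1; case: eqP => [K2|K2].
  rewrite /etaQ -exprM coefXnM wD K2 mulnC ltnNge leq_addr /= addKn.
  exact: IH.
rewrite /etaQ -exprM coefXnM; case: ltnP => // le.
(* A nonzero coefficient would give [wtE C] a second expansion in base Q, with digit [a.2] instead
   of [(K c).2] at [c]. *)
apply/eqP; apply: contraT => /(matching_sum_supp lQ)[d [dQ dC de]]; case: K2.
pose d1 x := if x \in C then (K x).2 else 0%N.
pose d2 x := if x == c then a.2 else d x.
have -> : a.2 = d2 c by rewrite /d2 eqxx.
have -> : (K c).2 = d1 c by rewrite /d1 cC.
apply: digits_inj.
- by move=> x; rewrite /d1; case: ifP => // _; lia.
- by move=> x; rewrite /d2; case: ifP.
have -> : (\sum_x d1 x * Q ^ x = wtE C)%N.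
  by rewrite /wtE [RHS]big_mkcond; apply: eq_bigr => x _; rewrite /d1; case: ifP.
rewrite -(subnKC le) de (bigD1 c) //= [in RHS](bigD1 c) //= dC ?inE ?eqxx // mul0n add0n.
rewrite /d2 eqxx mulnC; congr (_ + _)%N; apply: eq_bigr => x /negPf -> //.
Qed.
End Coefficient.

Lemma multfact_unit (k : fieldType) p (hp : p \in [pchar k]) (l : seq key) :
  (forall a, count_mem a l < p)%N -> ((multfact l)%:R : k) != 0.
Proof.
elim: l => [|a l IH] H /=; first by rewrite oner_eq0.
rewrite natrM mulf_neq0 //; last first.
  by apply: IH => b; apply: leq_ltn_trans (H b); rewrite /= leq_addl.
rewrite -(dvdn_pcharf hp) gtnNdvd //; first by rewrite eqxx.
by have := H a; rewrite /= eqxx.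
Qed.

Lemma seq_argmax (T : eqType) (f : T -> nat) (s : seq T) : s != [::] ->
  exists2 x, x \in s & forall y, y \in s -> (f y <= f x)%N.
Proof.
elim: s => [//|x s IH] _; have [->|/IH[y ys Hy]] := eqVneq s [::].
  by exists x; rewrite ?inE // => y; rewrite inE => /eqP->.
have [xy|yx] := leqP (f x) (f y).
  by exists y => [|z]; rewrite inE ?ys ?orbT // => /orP[/eqP->|/Hy].
exists x => [|z]; rewrite inE ?eqxx // => /orP[/eqP->//|/Hy zy].
exact: leq_trans zy (ltnW yx).
Qed.

Lemma uniq_map_inj (T U : eqType) (f : T -> U) (s : seq T) :
  uniq (map f s) -> {in s &, injective f}.
Proof.
elim: s => [//|x s IH] /= /andP[xs us] a b; rewrite !inE.
move=> /orP[/eqP->|as_] /orP[/eqP->|bs] E //; last exact: IH.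
  by rewrite E map_f in xs.
by rewrite -E map_f in xs.
Qed.

(** * Linear independence *)

Section Independence.
Variables (R : realType) (k : fieldType) (p n : nat).
Hypothesis hp : p \in [pchar k].
Hypothesis hp2 : (2 < p)%N.
Notation C := (complex R).

Let k2 : (2 : k) != 0.
Proof. by rewrite -(dvdn_pcharf hp) gtnNdvd. Qed.

Section Points.
Variables (L0 : seq key) (Q : nat).
Hypothesis L0ok : all (valid_key n) L0.
Hypothesis Q1 : (1 < Q)%N.
Let m := size L0.
(** One chain per factor of [L0], with a point of every colour below n; [B0] keeps the colours that
    belong to the root of that factor. *)
Let P : finType := ('I_m * 'I_n)%type.
Let K (c : 'I_m) : key := nth (0, 0, 0)%N L0 c.
Let col (x : P) : nat := x.2.
Let B0 : {set P} := [set x : P | ((K x.1).1.1 <= x.2 <= (K x.1).1.2)%N].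
(** The outer variable is T, and the inner one carries all eta_c at once, as its powers with
    exponent Q^c. *)
Let XZ (x : P) : {poly {poly int}} := ('X^(Q ^ x.1))%:P * 'X.
Let base (F : fieldType) : {rmorphism {poly {poly int}} -> {poly {poly F}}} :=
  map_poly (map_poly (intmul 1)).
Let const (F : fieldType) : {rmorphism F -> {poly {poly F}}} := @polyC {poly F} \o @polyC F.
Let X := posK XZ (base k).

Let Kok c : valid_key n (K c).
Proof. by apply: (allP L0ok); apply: mem_nth. Qed.
Let K_le c : ((K c).1.1 <= (K c).1.2)%N.
Proof. by have := Kok c; rewrite /valid_key /inDelta; lia. Qed.
Let pts (x y : P) : x.1 = y.1 -> col x = col y -> x = y.
Proof. by case: x y => [a b] [c d] /= -> bd; congr (_, _); apply: val_inj. Qed.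
Let B0E (x : P) : (x \in B0) = ((K x.1).1.1 <= col x <= (K x.1).1.2)%N.
Proof. by rewrite inE. Qed.
Let pts_ex c l : ((K c).1.1 <= l <= (K c).1.2)%N -> exists2 x : P, x.1 = c & col x = l.
Proof.
move=> lc; have ln : (l < n)%N by have := Kok c; rewrite /valid_key /inDelta; lia.
by exists (c, Ordinal ln).
Qed.
Let eta_inj : injective (@etaQ k Q m).
Proof.
move=> c d /(congr1 (fun q : {poly k} => size q)); rewrite !size_polyXn => -[] /eqP.
by rewrite eqn_exp2l // => /eqP/val_inj.
Qed.
Let XE (x : P) : X x = (@etaQ k Q m x.1)%:P * 'X.
Proof. by rewrite /X /posK /XZ /= rmorphM /= map_polyX map_polyC /= map_polyXn. Qed.
Let XZ_inj (x y : P) : col x = col y -> XZ x = XZ y -> x = y.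
Proof.
move=> cxy /(congr1 (fun q : {poly {poly int}} => q`_1)); rewrite /XZ !coefCM !coefX !mulr1.
move=> /(congr1 (fun q : {poly int} => size q)); rewrite !size_polyXn => -[] /eqP.
by rewrite eqn_exp2l // => /eqP/val_inj E; apply: pts.
Qed.
Let DZ2 : (2 : {poly {poly int}}) != 0.
Proof. by rewrite -polyC_natr polyC_eq0 -polyC_natr polyC_eq0. Qed.
Let baseC_inj : injective (base C).
Proof.
apply: map_inj_poly; last exact: rmorph0.
apply: map_inj_poly; last exact: rmorph0.
exact: intr_inj.
Qed.

Definition value (l : seq key) : {poly {poly k}} :=
  (\prod_(a <- l) (chainf col X a.1.1 a.1.2 a.2 : Sh col X)) B0.

Lemma value_top l : top (kdeg l + inner_wt (@fst _ _) col B0) (value l) (topval (@fst _ _) col (@etaQ k Q m) l B0).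
Proof. exact: top_prod_chainf. Qed.

Lemma value_few l : (size l < m)%N -> topval (@fst _ _) col (@etaQ k Q m) l B0 = 0.
Proof.
by move=> lm; apply: topval_few => //; rewrite (chains_B0 K_le B0E pts_ex) cardsT card_ord.
Qed.

Lemma value_M l : size l = m -> all (valid_key n) l ->
  topval (@fst _ _) col (@etaQ k Q m) l B0 = GG (@fst _ _) col (@etaQ k Q m) B0 setT * matching_sum (@etaQ k Q m) K l setT.
Proof.
move=> lm okl; rewrite -(topval_matching _ pts K_le B0E pts_ex) ?cardsT ?card_ord //.
  by rewrite chain_setsT.
by apply: sub_all okl => a; rewrite /valid_key /inDelta; lia.
Qed.

Lemma value_zero (l : seq (k * hfun)) :
  (forall t, t \in l -> all (valid_key n) (hexp t.2)) -> tzero n (@Ecomb R k l) ->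
  \sum_(t <- l) ((t.1 * \prod_(a <- hexp t.2) kscal k a)%:P)%:P * value (hexp t.2) = 0.
Proof.
move=> okl /(Ecomb_zero (const C) (const k) (base k) k2 baseC_inj DZ2 XZ_inj).
move=> /(congr1 (fun f : Sh col X => f B0)); rewrite sh0E => E.
rewrite -[RHS]E (big_morph (fun f : Sh col X => f B0) (id1 := 0) (op1 := +%R)) //; last first.
- exact: sh0E.
- by move=> f g; rewrite shDE.
rewrite big_seq [RHS]big_seq; apply: eq_bigr => t tl.
by rewrite (mon_chainf _ _ _ _ (okl _ tl)) mulrA -shKM shscE.
Qed.

(** Two coefficients are extracted: first that of the top power of T, where smaller degree or fewer
    factors give 0; then, after cancelling the nonzero [GG], that of the monomial of [L0] in the
    inner variable. *)
Lemma leading_coef (l : seq (k * hfun)) :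
  all (fun a : key => a.2 < Q)%N L0 ->
  (forall t, t \in l -> all (valid_key n) (hexp t.2) /\ all (fun a : key => a.2 < Q)%N (hexp t.2)) ->
  (forall t, t \in l -> t.1 != 0 -> (kdeg (hexp t.2) < kdeg L0)%N \/
     kdeg (hexp t.2) = kdeg L0 /\ (size (hexp t.2) <= m)%N) ->
  tzero n (@Ecomb R k l) ->
  \sum_(t <- l) t.1 * \prod_(a <- hexp t.2) kscal k a *
    (if perm_eq (hexp t.2) L0 then (multfact (hexp t.2))%:R else 0) = 0.
Proof.
move=> L0Q okl lmax /value_zero E0.
have {}E0 := E0 (fun t tl => (okl t tl).1).
pose d0 := (kdeg L0 + inner_wt (@fst _ _) col B0)%N.
pose c (t : k * hfun) : k := t.1 * \prod_(a <- hexp t.2) kscal k a.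
pose g : {poly k} := GG (@fst _ _) col (@etaQ k Q m) B0 setT.
pose q (t : k * hfun) : {poly k} := if (kdeg (hexp t.2) == kdeg L0) && (size (hexp t.2) == m)
  then matching_sum (@etaQ k Q m) K (hexp t.2) setT else 0.
have E1 : g * \sum_(t <- l) (c t)%:P * q t = 0.
  have := congr1 (fun r : {poly {poly k}} => r`_d0) E0; rewrite coef0 coef_sum => E.
  rewrite -[RHS]E mulr_sumr big_seq [RHS]big_seq; apply: eq_bigr => t tl.
  rewrite coefCM mulrCA -/(c t).
  have [t0|tn0] := eqVneq t.1 0; first by rewrite /c t0 mul0r polyC0 !mul0r.
  congr (_ * _); have [sp valid_root] := value_top (hexp t.2).
  have okt := (okl t tl).1.
  case: (lmax t tl tn0) => [lt|[dE sE]].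
    rewrite /q ltn_eqF //= mulr0 nth_default // (leq_trans sp) //.
    by rewrite /d0 ltn_add2r.
  rewrite /d0 -dE valid_root /q dE eqxx /=; case: eqP => sm; first by rewrite value_M.
  by rewrite mulr0 value_few // ltn_neqAle sE andbT; apply/eqP.
have {}E1 : \sum_(t <- l) (c t)%:P * q t = 0.
  have g0 : g != 0 by apply: GG_neq0.
  by apply: (mulfI g0); rewrite mulr0.
have := congr1 (fun r : {poly k} => r`_(wtE Q K setT)) E1; rewrite coef0 coef_sum => {}E1.
rewrite -[RHS]E1 big_seq [RHS]big_seq; apply: eq_bigr => t tl.
rewrite coefCM -/(c t); congr (_ * _); have [okt tQ] := okl t tl.
have KL0 : keysC K setT = L0.
  rewrite /keysC enum_setT -enumT -[RHS](mkseq_nth (0, 0, 0)%N) /mkseq -val_enum_ord -map_comp.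
  exact: eq_map.
rewrite /q; case: andP => [[dE /eqP sE]|ne].
  rewrite matching_sum_coef ?cardsT ?card_ord // ?cntE ?cardsT ?card_ord // ?KL0; first by case: ifP.
  by move=> x; apply: (allP L0Q); apply: mem_nth.
rewrite coef0; case: ifP => // pe; case: ne; split.
  by rewrite /kdeg (perm_big _ pe).
by rewrite (perm_size pe).
Qed.
End Points.

Theorem Eh_free (l : seq (k * hfun)) :
  uniq [seq t.2 | t <- l] ->
  (forall t, t \in l -> h_dom n t.2 /\ p_restricted p t.2) ->
  tzero n (@Ecomb R k l) -> forall t, t \in l -> t.1 = 0.
Proof.
move=> ul Hl z t1 t1l; apply/eqP/negPn/negP => t1n0.
pose s := [seq t <- l | t.1 != 0].
pose N := (\sum_(t <- l) size (hexp t.2)).+1.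
(* As N exceeds every number of factors, a maximum of [mu] is a lexicographic maximum of degree and
   number of factors. *)
pose mu (t : k * hfun) := (kdeg (hexp t.2) * N + size (hexp t.2))%N.
have [t0 + tmax] : exists2 x, x \in s & forall y, y \in s -> (mu y <= mu x)%N.
  apply: seq_argmax; apply/eqP => s0; have : t1 \in s by rewrite mem_filter t1n0.
  by rewrite s0.
rewrite mem_filter => /andP[t0n0 t0l].
have sN t : t \in l -> (size (hexp t.2) < N)%N.
  by move=> tl; rewrite /N ltnS (big_rem t) //= leq_addr.
(* Larger than every r that occurs, and at least 2 even if all of them are 0. *)
pose Q := (\sum_(t <- l) \sum_(a <- hexp t.2) a.2).+2.
have rQ t : t \in l -> all (fun a : key => a.2 < Q)%N (hexp t.2).
  move=> tl; apply/allP => a ah; rewrite /Q (big_rem t) //= (big_rem a) //=; lia.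
have okl t : t \in l -> all (valid_key n) (hexp t.2).
  move=> /Hl[hd _]; apply/allP => a; rewrite hexp_mem => ah; apply: hd.
  by rewrite mem_finsupp.
have := @leading_coef (hexp t0.2) Q (okl _ t0l) isT l (rQ _ t0l) (fun t tl => conj (okl t tl) (rQ t tl)) _ z.
have lmax t : t \in l -> t.1 != 0 -> (kdeg (hexp t.2) < kdeg (hexp t0.2))%N \/
     kdeg (hexp t.2) = kdeg (hexp t0.2) /\ (size (hexp t.2) <= size (hexp t0.2))%N.
  move=> tl tn0; have := tmax t; rewrite mem_filter tn0 tl => /(_ isT).
  have := sN _ tl; have := sN _ t0l; rewrite /mu.
  move: (kdeg _) (kdeg _) (size _) (size _) => a b c d; nia.
move=> /(_ lmax); rewrite (bigD1_seq t0) //=; last exact: map_uniq ul.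
(* A function is recovered from its multiset of factors, and the functions in [l] are distinct, so
   only the term of [t0] remains. *)
rewrite perm_refl [X in _ + X]big1_seq ?addr0; last first.
  move=> t /andP[tt0 tl]; case: ifP => [/hexp_inj E|]; last by rewrite mulr0.
  by case/eqP: tt0; apply: (uniq_map_inj ul).
move/eqP; rewrite !mulf_eq0 (negPf t0n0) (negPf (kscal_neq0 k2 _)) /=; apply/negP.
apply: (multfact_unit hp) => a; rewrite count_hexp.
by have [_] := Hl _ t0l; apply.
Qed.
End Independence.

(* The bar E_h, h p-restricted finitely supported Delta^+ x N -> N, form a
   k-basis of the small Yangian bar y_n^>(k):
   (1) they lie in bar y_n^>(k); (2) they are k-linearly independent in
   bar Y_n^>(k); (3) they span bar y_n^>(k). *)
Theorem theorem3p7 (R : realType) (k : closedFieldType) (p n : nat)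
  (hp : p \in [pchar k]) (hp2 : (2 < p)%N) (hn : (2 <= n)%N) :
  (forall h : hfun, h_dom n h -> p_restricted p h ->
     @in_smallY R k n p (@tbar R k (Eh R h)))
  /\ (forall l : seq (k * hfun),
        uniq [seq t.2 | t <- l] ->
        (forall t, List.In t l -> h_dom n t.2 /\ p_restricted p t.2) ->
        @tzero R k n (@Ecomb R k l) ->
        forall t, List.In t l -> t.1 = 0)
  /\ (forall x : tsum R k, @in_smallY R k n p x ->
        exists l : seq (k * hfun),
          (forall t, List.In t l -> h_dom n t.2 /\ p_restricted p t.2) /\
          @teq R k n x (@Ecomb R k l)).
Proof.
split; first by move=> h hd hr; apply: Eh_in_smallY.
split; last by move=> x; apply: smallY_span.
move=> l ul Hl z t /InP tl; apply: Eh_free hp hp2 _ ul _ z _ tl.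
by move=> u /InP; apply: Hl.
Qed.
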